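(* Let $G = \langle A * B;\ H\rangle$ be the generalized free product of groups $A$ and $B$ with amalgamated subgroup $H$, and let $\mathfrak{P}$ be a set of primes such that $G$ and $\mathfrak{P}$ satisfy Condition $( * )$. Suppose that $H$ is periodic and, for every prime $p$, let $H(p) = p\text{-}\mathfrak{Is}(H,1)$. For a prime $p$, let $\mathrm{S}(p)$ denote the following condition: there exist sequences of subgroups $$1 = Q_{0} \leqslant Q_{1} \leqslant \ldots \leqslant Q_{n} = H(p),\quad R_{0} \leqslant R_{1} \leqslant \ldots \leqslant R_{n} = A,\quad S_{0} \leqslant S_{1} \leqslant \ldots \leqslant S_{n} = B$$ such that, for all $i \in \{0,1,\ldots,n\}$ and $j \in \{0,1,\ldots,n-1\}$: $R_{i}$ is a normal subgroup of finite $p$-index of $A$; $S_{i}$ is a normal subgroup of finite $p$-index of $B$; $R_{i} \cap H(p) = Q_{i} = S_{i} \cap H(p)$; and $|Q_{j+1}/Q_{j}| = p$. Then $H$ is $\mathcal{FN}_{\mathfrak{P}}$-separable in $A$ and in $B$, and the following statements hold. 1. The group $G$ is residually an $\mathcal{FN}_{\mathfrak{P}}$-group if $H$ is $\mathcal{F}_{q}$-separable in $A$ and in $B$ for some $q \in \mathfrak{P}$ and, for every $p \in \mathfrak{P}$, condition $\mathrm{S}(p)$ holds. 2. If $G$ is residually an $\mathcal{FN}_{\mathfrak{P}}$-group, then $H$ is $q'$-isolated in $A$ and in $B$ for some $q \in \mathfrak{P}$ and, for every $p \in \mathfrak{P}$, condition $\mathrm{S}(p)$ holds. 3. The group $G$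 is residually a $\Phi\cdot\mathcal{FN}_{\mathfrak{P}}$-group and, for each prime $q$, residually an $\mathcal{F}_{q}\cdot\mathcal{FN}_{\mathfrak{P}}$-group if and only if, for every $p \in \mathfrak{P}$, condition $\mathrm{S}(p)$ holds.
   Context: $G=\langle A*B;\ H\rangle$ means that $G$ is the generalized (amalgamated) free product of $A$ and $B$ with amalgamated subgroup $H$; $A$ and $B$ are regarded as subgroups of $G$, with $A\cap B=H$. For a set of primes $\mathfrak{P}$, a $\mathfrak{P}$-number is an integer all of whose prime divisors lie in $\mathfrak{P}$ (a $p$-number is a power of $p$ up to sign; ''finite $p$-index'' means the index is a $p$-number), and a $\mathfrak{P}$-group is a periodic group all of whose element orders are $\mathfrak{P}$-numbers. $\Phi$, $\mathcal{FN}_{\mathfrak{P}}$, $\mathcal{F}_p$ are the classes of free groups, finite nilpotent $\mathfrak{P}$-groups and finite $p$-groups. For classes $\mathcal{C},\mathcal{D}$, $\mathcal{C}\cdot\mathcal{D}$ is the class of all extensions of a $\mathcal{C}$-group by a $\mathcal{D}$-group (groups having a normal subgroup in $\mathcal{C}$ with quotient in $\mathcal{D}$). A group $X$ is residually a $\mathcal{C}$-group if for every $x\in X\setminus\{1\}$ there is a homomorphism $\sigma$ of $X$ onto a group from $\mathcal{C}$ with $x\sigma\neq1$. A subgroup $Y\leqslant X$ is $\mathcal{C}$-separable in $X$ if for every $x\in X\setminus Y$ there is a homomorphism $\sigma$ of $X$ onto a group from $\mathcal{C}$ with $x\sigma\notin Y\sigma$. For a set $\mathfrak{S}$ of primes,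 a subgroup $Y\leqslant X$ is $\mathfrak{S}$-isolated in $X$ if for every $q\in\mathfrak{S}$ and $x\in X$, $x^q\in Y$ implies $x\in Y$; $\mathfrak{S}\text{-}\mathfrak{Is}(X,Y)$ is the smallest $\mathfrak{S}$-isolated subgroup of $X$ containing $Y$. One writes $p$ for $\mathfrak{S}=\{p\}$ and $q'$ for the set of all primes different from $q$. An abelian group is $\mathfrak{P}$-bounded if in each of its quotient groups, for every $p\in\mathfrak{P}$, the $p$-primary component of the periodic part is finite. A nilpotent group is $\mathfrak{P}$-bounded if it has a finite central series with $\mathfrak{P}$-bounded abelian factors; $\mathcal{BN}_{\mathfrak{P}}$ is the class of $\mathfrak{P}$-bounded nilpotent groups. $G=\langle A*B;\ H\rangle$ and $\mathfrak{P}$ satisfy Condition $( * )$ if: (i) $A\neq H\neq B$; (ii) $\mathfrak{P}$ is non-empty; (iii) $A$ and $B$ are residually $\mathcal{FN}_{\mathfrak{P}}$-groups; (iv) there exist homomorphisms of $A$ and of $B$ mapping them onto $\mathcal{BN}_{\mathfrak{P}}$-groups and acting injectively on $H$. *)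

(* Defs.v *)
(* Groups are the possibly infinite [groupType]s of mathcomp/boot/monoid.v, and
   subgroups are Prop-valued sets.  A {multiplicative X -> T} between groups is
   a group homomorphism. *)
From HB Require Import structures.
From mathcomp Require Import all_boot.
From mathcomp Require Import boolp classical_sets functions cardinality.

Set Implicit Arguments.
Unset Strict Implicit.
Unset Printing Implicit Defensive.

Local Open Scope classical_set_scope.
Local Open Scope card_scope.
Local Open Scope group_scope.

(* Sets of primes are rendered as [nat_pred]s.  Only their prime members are
   ever relevant: [P.-nat n] says that n > 0 and that every prime divisor of n
   belongs to P, a prime p coerces to the singleton {p}, and q^' contains
   exactly the primes different from q (besides irrelevant non-primes). *)

Section Subgroups.
Variable X : groupType.
Implicit Types (x y : X) (K L Y : set X) (P S : nat_pred).

Definition is_subgroup K : Prop :=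
  [/\ K 1, forall x y, K x -> K y -> K (x * y) & forall x, K x -> K x^-1].

Definition is_normal_subgroup K : Prop :=
  is_subgroup K /\ forall x y, K x -> K (x ^ y).

Definition has_order x (n : nat) : Prop :=
  [/\ (0 < n)%N, x ^+ n = 1 & forall m, (0 < m < n)%N -> x ^+ m <> 1].

(* |K : L| = n, counting the cosets x L with x in K. *)
Definition has_index K L (n : nat) : Prop :=
  [set [set x * y | y in L] | x in K] #= `I_n.

Definition finite_P_index P K : Prop :=
  exists2 n, P.-nat n & has_index [set: X] K n.

Definition isolated S Y : Prop :=
  forall q x, prime q -> q \in S -> Y (x ^+ q) -> Y x.

Definition isolator S Y : set X :=
  [set x | forall K, is_subgroup K -> isolated S K -> Y `<=` K -> K x].

Definition central_series (n : nat) (Z : nat -> set X) : Prop :=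
  [/\ Z 0 = [set 1], Z n = [set: X],
      forall i, (i <= n)%N -> is_normal_subgroup (Z i) &
      forall i, (i < n)%N -> Z i `<=` Z i.+1 /\
        forall x y, Z i.+1 x -> Z i [~ x, y]].

(* T is isomorphic to K / L: the function f, of which only the restriction to
   K matters, is a homomorphism of K onto T with kernel L. *)
Definition is_factor K L (T : groupType) : Prop :=
  exists f : X -> T,
    [/\ forall x y, K x -> K y -> f (x * y) = f x * f y,
        f @` K = [set: T] & K `&` f @^-1` [set 1] = L].

End Subgroups.

Definition group_class := groupType -> Prop.

Definition periodic : group_class := fun X =>
  forall x : X, exists n, has_order x n.

Definition P_group (P : nat_pred) : group_class := fun X =>
  forall x : X, exists2 n, has_order x n & P.-nat n.

Definition finite_group : group_class := fun X => finite_set [set: X].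

Definition nilpotent_group : group_class := fun X =>
  exists n, exists Z : nat -> set X, central_series n Z.

(* Freeness on a basis E, by the universal property. *)
Definition free_group : group_class := fun X =>
  exists E : set X, forall (T : groupType) (f : X -> T),
    exists2 h : {multiplicative X -> T}, {in E, h =1 f} &
      forall h' : {multiplicative X -> T}, {in E, h' =1 f} -> h' =1 h.

Definition finite_nilpotent_P_group (P : nat_pred) : group_class := fun X =>
  [/\ finite_group X, nilpotent_group X & P_group P X].

Definition finite_p_group (p : nat) : group_class := fun X =>
  finite_group X /\ P_group p X.

(* The quotients of X are taken, up to isomorphism, as its epimorphic images. *)
Definition bounded_abelian (P : nat_pred) : group_class := fun X =>
  (forall x y : X, commute x y) /\
  forall (T : groupType) (f : {multiplicative X -> T}), range f = [set: T] ->
    forall p, prime p -> p \in P ->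
      finite_set [set t : T | exists2 n, has_order t n & p.-nat n].

Definition bounded_nilpotent (P : nat_pred) : group_class := fun X =>
  exists n, exists Z : nat -> set X, central_series n Z /\
    forall i, (i < n)%N -> exists2 T : groupType,
      bounded_abelian P T & is_factor (Z i.+1) (Z i) T.

(* C . D, through short exact sequences 1 -> K -> X -> Q -> 1. *)
Definition extension_class (C D : group_class) : group_class := fun X =>
  exists (K Q : groupType) (i : {multiplicative K -> X})
         (s : {multiplicative X -> Q}),
    [/\ C K, D Q, injective i, range s = [set: Q] &
        s @^-1` [set 1] = range i].

Definition residually (C : group_class) : group_class := fun X =>
  forall x : X, x <> 1 ->
    exists (T : groupType) (s : {multiplicative X -> T}),
      [/\ C T, range s = [set: T] & s x <> 1].

Definition separable (C : group_class) (X : groupType) (Y : set X) : Prop :=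
  forall x : X, ~ Y x ->
    exists (T : groupType) (s : {multiplicative X -> T}),
      [/\ C T, range s = [set: T] & ~ (s @` Y) (s x)].

(* G = < A * B; H >: the amalgamated subgroup is given by embeddings of H into
   A and B, and G is the pushout of A and B over H.  That jA and jB are
   injective and that their images meet exactly in the image of H (which is
   what lets one regard A and B as subgroups of G with intersection H) is a
   consequence, not a hypothesis. *)
Definition is_amalgamated_product (H A B G : groupType)
    (iA : {multiplicative H -> A}) (iB : {multiplicative H -> B})
    (jA : {multiplicative A -> G}) (jB : {multiplicative B -> G}) : Prop :=
  [/\ injective iA, injective iB, forall h, jA (iA h) = jB (iB h) &
      forall (T : groupType)
             (f : {multiplicative A -> T}) (g : {multiplicative B -> T}),
        (forall h, f (iA h) = g (iB h)) ->
        exists2 k : {multiplicative G -> T},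
          (forall a, k (jA a) = f a) /\ (forall b, k (jB b) = g b) &
          forall k' : {multiplicative G -> T},
            (forall a, k' (jA a) = f a) -> (forall b, k' (jB b) = g b) ->
            k' =1 k].

Definition condition_star (H A B : groupType)
    (iA : {multiplicative H -> A}) (iB : {multiplicative H -> B})
    (P : nat_pred) : Prop :=
  [/\ range iA <> [set: A] /\ range iB <> [set: B],
      exists p, p \in P,
      residually (finite_nilpotent_P_group P) A /\
        residually (finite_nilpotent_P_group P) B &
      (exists (T : groupType) (f : {multiplicative A -> T}),
         [/\ bounded_nilpotent P T, range f = [set: T] &
             injective (f \o iA)]) /\
      (exists (T : groupType) (f : {multiplicative B -> T}),
         [/\ bounded_nilpotent P T, range f = [set: T] &
             injective (f \o iB)])].

(* H(p) is [isolator p [set 1]]; intersections with H(p) of subgroups of A and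
   B are computed inside H, through the embeddings iA and iB. *)
Definition condition_S (H A B : groupType)
    (iA : {multiplicative H -> A}) (iB : {multiplicative H -> B})
    (p : nat) : Prop :=
  let Hp : set H := isolator p [set 1] in
  exists (n : nat) (Q : nat -> set H) (R : nat -> set A) (S : nat -> set B),
    [/\ [/\ Q 0 = [set 1], Q n = Hp, R n = [set: A] & S n = [set: B]],
        forall j, (j < n)%N ->
          [/\ Q j `<=` Q j.+1, R j `<=` R j.+1 & S j `<=` S j.+1],
        forall i, (i <= n)%N ->
          [/\ is_subgroup (Q i),
              is_normal_subgroup (R i) /\ finite_P_index p (R i),
              is_normal_subgroup (S i) /\ finite_P_index p (S i),
              iA @^-1` R i `&` Hp = Q i & iB @^-1` S i `&` Hp = Q i] &
        forall j, (j < n)%N -> has_index (Q j.+1) (Q j) p].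

(* Main.v *)
(* Bounded nilpotent groups enter through one fact: if such a group X satisfies the
   boundedness condition for p, an element of X that is not p'-torsion survives in
   a finite p-quotient (take a normal subgroup maximal among those avoiding the
   p'-powers of x; its quotient has finite centre and is a finite p-group).  It
   makes the subgroups H(p) finite and separates H in A and in B, even in finite
   p-groups with p in P.

   All quotients of G are built inside wreath products T wr F, where G -> F is
   already known: by the universal property, such a homomorphism is a pair of
   T-valued cocycles of A and of B on F which agree on H.  Constant cocycles that
   agree on ker (H -> F) become equal on H after a coboundary change; going down
   the series of S(p), this yields finite p-quotients of G as fine as wanted on A
   and on B (Higman's theorem).  Trivial cocycles on A and coboundaries on B detect
   a reduced word: the word traces a path without backtracking in the graph of
   cosets of H in F, and its edges can be labelled in a finite q-group T so that
   the product of the labels is nontrivial.  The same graph, with arbitrary labels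
   outside a spanning tree, shows that the kernel over F is free.

   Conversely, suppose that a in A lies outside H but a^r is in H.  As H is
   periodic, one may take a to be an r-element.  If moreover x in A or B lies
   outside H but x^s is in H for a prime s <> r, then x may be taken to be an
   s-element; a commutes with x and its conjugates in all finite nilpotent
   quotients of G, but a reduced word shows that this fails in G.  The series of S(p) is induced by a chief series of a finite
   p-quotient of G which is faithful on H(p). *)

Require Import Defs.
From HB Require Import structures.
From mathcomp Require Import all_fingroup all_solvable ssralg zmodp all_boot.
From mathcomp Require Import boolp classical_sets functions cardinality.

Set Implicit Arguments.
Unset Strict Implicit.
Unset Printing Implicit Defensive.

Local Open Scope classical_set_scope.
Local Open Scope card_scope.
Local Open Scope group_scope.

(** * Homomorphisms, subgroups and quotients *)

Definition hom_of (X T : groupType) (f : X -> T)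
  (fM : {morph f : x y / x * y}) : {multiplicative X -> T} :=
  HB.pack f (isMultiplicative.Build X T f fM).

Section HomTheory.
Variables (X T : groupType) (f : {multiplicative X -> T}).

Lemma homM x y : f (x * y) = f x * f y. Proof. exact: gmulfM. Qed.

Lemma hom1 : f 1 = 1.
Proof. by apply: (@mulgI _ (f 1)); rewrite -homM !mulg1. Qed.

Lemma homV x : f x^-1 = (f x)^-1.
Proof. by apply/divg1_eq; rewrite invgK -homM mulVg hom1. Qed.

Lemma homX x n : f (x ^+ n) = f x ^+ n.
Proof. by elim: n => [|n IHn]; rewrite ?hom1 // !expgS homM IHn. Qed.

Lemma homJ x y : f (x ^ y) = f x ^ f y.
Proof. by rewrite /conjg !homM homV. Qed.

Lemma homR x y : f [~ x, y] = [~ f x, f y].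
Proof. by rewrite /commg homM homV homJ. Qed.

Lemma hom_eq x y : f (x^-1 * y) = 1 <-> f x = f y.
Proof.
rewrite homM homV; split=> [/(congr1 (mul (f x)))|->]; last by rewrite mulVg.
by rewrite mulVKg mulg1.
Qed.

Lemma hom_inj : (forall x, f x = 1 -> x = 1) -> injective f.
Proof.
move=> f1 x y fxy; apply/divg1_eq/f1.
by rewrite homM homV fxy mulgV.
Qed.

Lemma inj_hom1 x : injective f -> f x = 1 -> x = 1.
Proof. by move=> fI fx; apply: fI; rewrite fx hom1. Qed.

End HomTheory.

Lemma comp_morphM (X Y T : groupType) (f : {multiplicative Y -> T})
  (g : {multiplicative X -> Y}) : {morph f \o g : x y / x * y}.
Proof. by move=> x y /=; rewrite !homM. Qed.

Definition hom_comp (X Y T : groupType) (f : {multiplicative Y -> T})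
  (g : {multiplicative X -> Y}) := hom_of (comp_morphM f g).

Section SubgroupTheory.
Variables (X : groupType).
Implicit Types (K L N : set X) (x y : X).

Lemma sg1 K : is_subgroup K -> K 1. Proof. by case. Qed.
Lemma sgM K x y : is_subgroup K -> K x -> K y -> K (x * y).
Proof. by case=> _ h _; apply: h. Qed.
Lemma sgV K x : is_subgroup K -> K x -> K x^-1.
Proof. by case=> _ _; apply. Qed.
Lemma sgVE K x : is_subgroup K -> K x^-1 -> K x.
Proof. by move=> sK /(sgV sK); rewrite invgK. Qed.
Lemma sgX K x n : is_subgroup K -> K x -> K (x ^+ n).
Proof.
move=> sK Kx; elim: n => [|n IHn]; first exact: sg1.
by rewrite expgS; apply: sgM.
Qed.
Lemma sgMr K x y : is_subgroup K -> K y -> K (x * y) -> K x.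
Proof. by move=> sK Ky /sgM - /(_ _ sK (sgV sK Ky)); rewrite mulgK. Qed.
Lemma nsgJ N x y : is_normal_subgroup N -> N x -> N (x ^ y).
Proof. by case=> _; apply. Qed.
Lemma nsgC N x y : is_normal_subgroup N -> N (x * y) -> N (y * x).
Proof.
by move=> nN /(nsgJ x nN); rewrite /conjg !mulgA mulVg mul1g.
Qed.
Lemma nsgR N x y : is_normal_subgroup N -> N x -> N [~ x, y].
Proof.
move=> nN Nx; apply: (sgM nN.1); first exact: (sgV nN.1).
exact: nsgJ.
Qed.
Lemma nsgRr N x y : is_normal_subgroup N -> N y -> N [~ x, y].
Proof.
by move=> nN Ny; apply: (sgVE nN.1); rewrite invgR; apply: nsgR.
Qed.

Lemma trivial_normal : is_normal_subgroup [set (1 : X)].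
Proof.
split; first split=> //= [x y -> ->|x ->]; rewrite ?mulg1 ?invg1 //.
by move=> x y -> /=; rewrite conj1g.
Qed.

Lemma full_normal : is_normal_subgroup [set: X].
Proof. by do 2!split. Qed.

Lemma setI_normal K L :
  is_normal_subgroup K -> is_normal_subgroup L -> is_normal_subgroup (K `&` L).
Proof.
move=> nK nL; split; first split.
- by split; apply: sg1; [exact: nK.1|exact: nL.1].
- by move=> x y [Kx Lx] [Ky Ly]; split; apply: sgM; rewrite //; [exact: nK.1|exact: nL.1].
- by move=> x [Kx Lx]; split; apply: sgV; rewrite //; [exact: nK.1|exact: nL.1].
- by move=> x y [Kx Lx]; split; apply: nsgJ.
Qed.

Lemma bigcap_normal (I : Type) (D : set I) (F : I -> set X) :
  (forall i, D i -> is_normal_subgroup (F i)) ->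
  is_normal_subgroup (\bigcap_(i in D) F i).
Proof.
move=> nF; split; first split.
- by move=> i Di; apply: sg1; case: (nF i Di).
- by move=> x y Fx Fy i Di; apply: sgM (Fx i Di) (Fy i Di); case: (nF i Di).
- by move=> x Fx i Di; apply: sgV (Fx i Di); case: (nF i Di).
- by move=> x y Fx i Di; apply: nsgJ (nF i Di) (Fx i Di).
Qed.

End SubgroupTheory.

Lemma preim_subgroup (X T : groupType) (f : {multiplicative X -> T}) K :
  is_subgroup K -> is_subgroup (f @^-1` K).
Proof.
move=> sK; split=> [|x y Kx Ky|x Kx] /=.
- by rewrite hom1; apply: sg1.
- by rewrite homM; apply: sgM.
- by rewrite homV; apply: sgV.
Qed.

Lemma preim_normal (X T : groupType) (f : {multiplicative X -> T}) K :
  is_normal_subgroup K -> is_normal_subgroup (f @^-1` K).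
Proof.
move=> nK; split; first exact: preim_subgroup nK.1.
by move=> x y /= Kx; rewrite homJ; apply: nsgJ.
Qed.

Lemma ker_normal (X T : groupType) (f : {multiplicative X -> T}) :
  is_normal_subgroup [set x | f x = 1].
Proof. exact: (preim_normal f (trivial_normal T)). Qed.

Lemma range_subgroup (X T : groupType) (f : {multiplicative X -> T}) :
  is_subgroup (range f).
Proof.
split; first by exists 1 => //; rewrite hom1.
- by move=> _ _ [x _ <-] [y _ <-]; exists (x * y) => //; rewrite homM.
- by move=> _ [x _ <-]; exists x^-1 => //; rewrite homV.
Qed.

Lemma subgroup_exists (X : groupType) (K : set X) : is_subgroup K ->
  exists (T : groupType) (i : {multiplicative T -> X}),
    injective i /\ range i = K.
Proof.
move=> sK; pose T := {x : X | `[< K x >]}.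
have oneP : `[< K 1 >] by apply/asboolP; apply: sg1.
have KP (x : T) : K (val x) by apply/asboolP; apply: (valP x).
have mulP (x y : T) : `[< K (val x * val y) >].
  by apply/asboolP; apply: sgM.
have invP (x : T) : `[< K (val x)^-1 >].
  by apply/asboolP; apply: sgV.
pose one : T := exist (fun x => `[< K x >]) _ oneP.
pose mul (x y : T) : T := exist (fun x => `[< K x >]) _ (mulP x y).
pose inv (x : T) : T := exist (fun x => `[< K x >]) _ (invP x).
have mA : associative mul by move=> x y z; apply: val_inj; rewrite /= mulgA.
have m1 : left_id one mul by move=> x; apply: val_inj; rewrite /= mul1g.
have m1' : right_id one mul by move=> x; apply: val_inj; rewrite /= mulg1.
have mV : left_inverse one inv mul by move=> x; apply: val_inj; rewrite /= mulVg.
have mV' : right_inverse one inv mul by move=> x; apply: val_inj; rewrite /= mulgV.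
pose gT : groupType := HB.pack T (isGroup.Build T mA m1 m1' mV mV').
have iM : {morph (val : gT -> X) : x y / x * y} by [].
exists gT, (hom_of iM); split; first by move=> u v uv; exact: (@val_inj _ _ T u v uv).
apply/seteqP; split=> [_ [x _ <-]|x Kx]; first by apply/asboolP; apply: (valP x).
by exists (exist (fun x => `[< K x >]) x (asboolT Kx) : T).
Qed.

(** The carrier of X / N is the set of fixed points of a choice [r] of coset representatives, so
    that equality of classes is equality of elements. *)
Lemma quotient_exists (X : groupType) (N : set X) : is_normal_subgroup N ->
  exists (T : groupType) (s : {multiplicative X -> T}),
    range s = [set: T] /\ forall x, s x = 1 <-> N x.
Proof.
move=> nN; have sN := nN.1.
pose r x := xget 1 [set y | N (y^-1 * x)].
have rP x : N ((r x)^-1 * x).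
  by apply: (xgetPex 1 (P := [set y | N (y^-1 * x)])); exists x; rewrite /= mulVg; apply: sg1.
have rE x y : N (x^-1 * y) -> r x = r y.
  move=> Nxy; rewrite /r; congr xget; apply/seteqP; split=> z /= Nz.
    by rewrite -[y](mulVKg x) mulgA; apply: sgM.
  rewrite -[x](mulVKg y) mulgA; apply: sgM => //.
  by rewrite -[y^-1 * x]invgK; apply: sgV => //; rewrite invgM invgK.
have rE' x y : r x = r y -> N (x^-1 * y).
  move=> e; have h := rP x; rewrite {}e in h.
  have -> : x^-1 * y = ((r y)^-1 * x)^-1 * ((r y)^-1 * y).
    by rewrite invgM invgK -mulgA mulVKg.
  by apply: sgM => //; apply: sgV.
have rr x : r (r x) = r x by apply: rE.
have rM x y : r (r x * r y) = r (x * y).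
  apply: rE; rewrite invgM mulgA -(mulgA _ _ x).
  have -> : (r y)^-1 * ((r x)^-1 * x) * y = ((r x)^-1 * x) ^ (r y) * ((r y)^-1 * y).
    by rewrite /conjg !mulgA mulgK.
  by apply: sgM => //; apply: nsgJ.
pose T := {x : X | r x == x}.
have rT x : r (r x) == r x by rewrite rr.
pose p x : T := exist (fun x => r x == x) _ (rT x).
have pE x y : p x = p y <-> N (x^-1 * y).
  by split=> [/(congr1 val)/rE'|/rE e]//; apply: val_inj.
have vK (x : T) : p (val x) = x by apply: val_inj; apply/eqP/(valP x).
have pM x y : p (val (p x) * val (p y)) = p (x * y) by apply: val_inj; apply: rM.
pose mul (x y : T) : T := p (val x * val y).
pose inv (x : T) : T := p (val x)^-1.
have mE x y : mul (p x) (p y) = p (x * y) by apply: pM.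
have iE x : inv (p x) = p x^-1.
  apply/pE; have -> : (val (p x))^-1^-1 * x^-1 = (x * (r x)^-1)^-1.
    by rewrite invgM invgK.
  by apply: sgV => //; apply: nsgC.
have mA : associative mul.
  by move=> x y z; rewrite -(vK x) -(vK y) -(vK z) !mE mulgA.
have m1 : left_id (p 1) mul by move=> x; rewrite -(vK x) !mE mul1g.
have m1' : right_id (p 1) mul by move=> x; rewrite -(vK x) !mE mulg1.
have mV : left_inverse (p 1) inv mul by move=> x; rewrite -(vK x) iE mE mulVg.
have mV' : right_inverse (p 1) inv mul by move=> x; rewrite -(vK x) iE mE mulgV.
pose gT : groupType := HB.pack T (isGroup.Build T mA m1 m1' mV mV').
have sM : {morph (p : X -> gT) : x y / x * y} by move=> x y; rewrite -mE.
exists gT, (hom_of sM); split.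
  by apply/seteqP; split=> // x _; exists (val x).
move=> x; split=> [h|Nx].
  have /pE : p 1 = p x by [].
  by rewrite invg1 mul1g.
by apply/esym/pE; rewrite invg1 mul1g.
Qed.

(** * Torsion and finite p-groups *)

Definition torsion (X : groupType) (pi : nat_pred) (x : X) : Prop :=
  exists2 n, pi.-nat n & x ^+ n = 1.

Lemma pi_nat_gt0 (pi : nat_pred) n : pi.-nat n -> (0 < n)%N.
Proof. by case/andP. Qed.

Section Torsion.
Variables (X : groupType).
Implicit Types (x y : X) (pi : nat_pred).

Lemma has_order_dvd x n m : has_order x n -> x ^+ m = 1 -> n %| m.
Proof.
case=> n0 xn nmin xm; rewrite /dvdn; apply: contraT.
rewrite -lt0n => r0; exfalso; apply: (nmin (m %% n)%N); first by rewrite r0 ltn_mod.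
by move: xm; rewrite {1}(divn_eq m n) expgnDr mulnC expgnA xn expg1n mul1g.
Qed.

Lemma has_order_exists x n : (0 < n)%N -> x ^+ n = 1 ->
  exists2 m, has_order x m & m %| n.
Proof.
move=> n0 xn; have ex : exists n, (0 < n)%N && (x ^+ n == 1).
  by exists n; rewrite n0 xn eqxx.
case: (ex_minnP ex) => m /andP[m0 /eqP xm] mmin.
have om : has_order x m.
  split=> // k /andP[k0 km] xk.
  have := mmin k; rewrite k0 xk eqxx => /(_ isT).
  by rewrite leqNgt km.
by exists m => //; apply: has_order_dvd om xn.
Qed.

Lemma torsionP pi x : torsion pi x <-> exists2 n, has_order x n & pi.-nat n.
Proof.
split=> [[n pin xn]|[n [_ xn _] pin]]; last by exists n.
have [m om mn] := has_order_exists (pi_nat_gt0 pin) xn.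
by exists m => //; apply: pnat_dvd pin.
Qed.

Lemma P_groupP pi : P_group pi X <-> forall x, torsion pi x.
Proof. by split=> h x; apply/torsionP. Qed.

Lemma torsion1 pi : torsion pi (1 : X).
Proof. by exists 1%N; rewrite ?expg1n. Qed.

Lemma torsionV pi x : torsion pi x -> torsion pi x^-1.
Proof. by case=> m pim xm; exists m => //; rewrite expVgn xm invg1. Qed.

Lemma torsion_sub pi rho x : {subset pi <= rho} -> torsion pi x -> torsion rho x.
Proof. by move=> s [n pin xn]; exists n => //; apply: sub_in_pnat pin => q _; apply: s. Qed.

Lemma torsion_root pi x m : pi.-nat m -> torsion pi (x ^+ m) -> torsion pi x.
Proof. by move=> pim [n pin xn]; exists (m * n)%N; rewrite ?pnatM ?pim // expgnA. Qed.

(* Bezout in the cyclic group generated by x. *)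
Lemma subgroup_coprime K x m n : is_subgroup K -> coprime m n -> (0 < m)%N ->
  K (x ^+ m) -> K (x ^+ n) -> K x.
Proof.
move=> sK cmn m0 Km Kn; have [u v e _] := egcdnP n m0.
move: e; rewrite (eqP cmn) addn1 => e.
have h : K (x ^+ (u * m)) by rewrite mulnC expgnA; apply: sgX.
rewrite e expgS in h; apply: sgMr h => //.
by rewrite mulnC expgnA; apply: sgX.
Qed.

Lemma torsion_coprime pi x : torsion pi x -> torsion pi^' x -> x = 1.
Proof.
move=> [m pim xm] [n pin xn].
apply: (@subgroup_coprime [set 1] x m n) => //=; first exact: (trivial_normal X).1.
  exact: pnat_coprime pim pin.
exact: pi_nat_gt0 pim.
Qed.

End Torsion.

Lemma torsion_hom (X T : groupType) (f : {multiplicative X -> T}) pi x :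
  torsion pi x -> torsion pi (f x).
Proof. by case=> n pin xn; exists n => //; rewrite -homX xn hom1. Qed.

Lemma torsion_inj (X T : groupType) (f : {multiplicative X -> T}) pi x :
  injective f -> torsion pi (f x) -> torsion pi x.
Proof.
by move=> fI [n pin xn]; exists n => //; apply: (inj_hom1 fI); rewrite homX.
Qed.

Section FinitePGroup.
Variable p : nat.
Implicit Types X T : groupType.

Lemma finite_inj (X T : Type) (f : X -> T) :
  injective f -> finite_set [set: T] -> finite_set [set: X].
Proof.
move=> fI fT; have -> : [set: X] = f @^-1` [set: T] by [].
by apply: finite_preimage fT => x y _ _; apply: fI.
Qed.

Lemma finite_range (X T : Type) (f : X -> T) :
  range f = [set: T] -> finite_set [set: X] -> finite_set [set: T].
Proof. by move=> <-; apply: finite_image. Qed.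

Lemma finite_p_group_inj X T (f : {multiplicative X -> T}) :
  injective f -> finite_p_group p T -> finite_p_group p X.
Proof.
move=> fI [fT /P_groupP pT]; split; first exact: finite_inj fI fT.
by apply/P_groupP => x; apply: torsion_inj fI (pT _).
Qed.

Lemma finite_p_group_range X T (f : {multiplicative X -> T}) :
  range f = [set: T] -> finite_p_group p X -> finite_p_group p T.
Proof.
move=> fS [fX /P_groupP pX]; split; first exact: finite_range fS fX.
apply/P_groupP => t; have [x _ <-] : range f t by rewrite fS.
exact: torsion_hom.
Qed.

End FinitePGroup.

Lemma finite_fun (X T : groupType) :
  finite_set [set: X] -> finite_set [set: T] -> finite_set [set: X -> T].
Proof.
move=> /finite_seqP[s sE] /finite_seqP[t tE].
have sP (x : X) : x \in s by have : [set: X] x by []; rewrite sE.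
have tP (y : T) : y \in t by have : [set: T] y by []; rewrite tE.
pose c (f : X -> T) : {ffun 'I_(size s) -> 'I_(size t).+1} :=
  [ffun i : 'I_(size s) => inord (index (f (nth 1 s i)) t)].
apply: (@finite_inj _ _ c); last exact: finite_finset.
move=> f g /ffunP fg; apply/funext => x.
have xs : (index x s < size s)%N by rewrite index_mem.
have /(congr1 val) := fg (Ordinal xs); rewrite !ffunE /= nth_index //.
rewrite !inordK ?ltnS ?index_size // => e.
by rewrite -(nth_index 1 (tP (f x))) e nth_index.
Qed.

(** The bridge to the library of finite groups: an enumeration of X turns X itself into a
    [finGroupType], and f is the identity. *)
Lemma finite_groupE (X : groupType) : finite_group X ->
  exists (gT : finGroupType) (f : {multiplicative X -> gT}), bijective f.
Proof.
move=> /finite_seqP[s sE]; pose e := undup s.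
have eP (x : X) : x \in e by rewrite mem_undup; have : [set: X] x by []; rewrite sE.
have ue : uniq e := undup_uniq s.
pose g (n : nat) := if (n < size e)%N then Some (nth 1 e n) else None.
have gK : pcancel (fun x : X => index x e) g.
  by move=> x; rewrite /g index_mem eP nth_index.
have eA : Finite.axiom e by move=> x; rewrite count_uniq_mem // eP.
pose gT : finGroupType :=
  HB.pack X (Choice_isCountable.Build X gK) (isFinite.Build X eA).
have fM : {morph (id : X -> gT) : x y / x * y} by [].
by exists gT, (hom_of fM); exists id.
Qed.

Lemma p_group_card (p : nat) (X : groupType) (gT : finGroupType)
  (f : {multiplicative X -> gT}) : prime p -> bijective f -> P_group p X ->
  p.-group [set: gT]%G.
Proof.
move=> pp [g fK gK] /P_groupP pX; apply/pgroupP => q qp /(Cauchy qp)[x _ oq].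
have [k pk /(congr1 f) xk] := pX (g x); rewrite homX gK hom1 in xk.
have /eqP := xk; rewrite -order_dvdn oq => qk.
by apply: (pnatPpi pk); rewrite mem_primes qp qk (pi_nat_gt0 pk).
Qed.

Lemma p_group_nilpotent (p : nat) (X : groupType) :
  prime p -> finite_p_group p X -> nilpotent_group X.
Proof.
move=> pp [fX pX]; have [gT [f fB]] := finite_groupE fX.
have /pgroup_nil/ucnP[n Zn] := p_group_card pp fB pX.
exists n, (fun i => [set x | f x \in 'Z_i([set: gT]%G)]); split.
- apply/seteqP; split=> x /=; rewrite ucn0.
    by move=> /set1gP; apply: inj_hom1 (bij_inj fB).
  by move=> ->; rewrite hom1 group1.
- by apply/seteqP; split=> x // _ /=; rewrite Zn inE.
- move=> i _; split; first split=> [|x y|x] /=.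
  + by rewrite hom1 group1.
  + by rewrite homM; apply: groupM.
  + by rewrite homV groupV.
  + move=> x y /= h; rewrite homJ memJ_norm //.
    have /fintype.subsetP := ucn_norm i [set: gT]%G; apply.
    by rewrite finset.in_setT.
- move=> i _; split=> [x /=|x y /= h].
    by have /fintype.subsetP := ucn_subS i [set: gT]%G; apply.
  rewrite homR; have /fintype.subsetP := ucn_comm i [set: gT]%G; apply.
  by apply: mem_commg => //; rewrite finset.in_setT.
Qed.

Lemma card_cosets (X : groupType) (Y : Type) (s : X -> Y) (K L : set X) :
  is_subgroup L ->
  (forall x y, K x -> K y -> L (x^-1 * y) <-> s x = s y) ->
  [set [set x * y | y in L] | x in K] #= s @` K.
Proof.
move=> sL sP; apply/card_esym.
pose F (y : Y) : set X := [set x | K x /\ s x = y].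
have cosetE x y : [set x * z | z in L] = [set y * z | z in L] <-> L (x^-1 * y).
  split=> [e|Lxy].
    have [z Lz <-] : [set x * z | z in L] y.
      by rewrite e; exists 1; rewrite ?mulg1 //; apply: sg1.
    by rewrite mulKg.
  apply/seteqP; split=> _ [z Lz <-].
    exists (y^-1 * (x * z)); last by rewrite mulVKg.
    rewrite mulgA; apply: sgM => //; rewrite -[y^-1 * x]invgK invgM invgK.
    exact: sgV.
  exists (x^-1 * (y * z)); last by rewrite mulVKg.
  by rewrite mulgA; apply: sgM.
(* The union over a fibre of s gives the coset without choosing a representative. *)
pose G y : set X := \bigcup_(x in F y) [set x * z | z in L].
have GE x : K x -> G (s x) = [set x * z | z in L].
  move=> Kx; apply/seteqP; split=> [z [y [Ky syx]]|z zx]; last by exists x.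
  by have /cosetE -> : L (y^-1 * x) by apply/sP.
have -> : [set [set x * y | y in L] | x in K] = G @` (s @` K).
  apply/seteqP; split=> [_ [x Kx <-]|_ [_ [x Kx <-] <-]].
    by exists (s x); [exists x|rewrite GE].
  by exists x; rewrite // GE.
apply/card_esym/inj_card_eq => y z; rewrite !inE => -[x Kx <-] [x' Kx' <-].
by rewrite !GE // => /cosetE/sP; apply.
Qed.

Lemma card_bij (T U : Type) (f : T -> U) : bijective f -> [set: T] #= [set: U].
Proof.
move=> [g fK gK]; have -> : [set: U] = f @` [set: T].
  by apply/seteqP; split=> // u _; exists (g u).
by apply/card_esym/inj_card_eq => x y _ _; apply: can_inj fK _ _.
Qed.

Lemma card_finType (T : finType) : [set: T] #= `I_#|T|.
Proof.
by apply: card_eq_trans (card_esym card_II); apply/card_bij/enum_rank_bij.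
Qed.

(** For a prime p this amounts to normality and finite p-index, but kernels of maps to finite
    p-groups, onto or not, make intersections and preimages immediate. *)
Definition pfin (X : groupType) (p : nat) (N : set X) : Prop :=
  exists (T : groupType) (s : {multiplicative X -> T}),
    finite_p_group p T /\ forall x, s x = 1 <-> N x.

Lemma P_group_prod (P : nat_pred) (X Y : groupType) :
  P_group P X -> P_group P Y -> P_group P (X * Y)%type.
Proof.
move=> /P_groupP pX /P_groupP pY; apply/P_groupP => -[a b].
have [m pm am] := pX a; have [n pn bn] := pY b.
exists (m * n)%N; first by rewrite pnatM pm.
have XE k : (a, b) ^+ k = (a ^+ k, b ^+ k).
  by elim: k => // k IHk; rewrite !expgS IHk.
by rewrite XE {1}expgnA am expg1n mulnC expgnA bn expg1n.
Qed.

Lemma finite_group_prod (X Y : groupType) :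
  finite_group X -> finite_group Y -> finite_group (X * Y)%type.
Proof.
by move=> fX fY; rewrite /finite_group -setXTT; apply: finite_setX.
Qed.

Lemma finite_p_group_prod (p : nat) (X Y : groupType) :
  finite_p_group p X -> finite_p_group p Y -> finite_p_group p (X * Y)%type.
Proof.
by move=> [fX pX] [fY pY]; split; [apply: finite_group_prod|apply: P_group_prod].
Qed.

Lemma hom_factor (X Y Z : groupType) (s : {multiplicative X -> Y})
  (t : {multiplicative X -> Z}) :
  range s = [set: Y] -> (forall x, s x = 1 -> t x = 1) ->
  exists u : {multiplicative Y -> Z}, forall x, u (s x) = t x.
Proof.
move=> sS st; have /choice[g gP] (y : Y) : exists x, s x = y.
  by have [x _ <-] : range s y by [rewrite sS]; exists x.
have gE x : t (g (s x)) = t x by apply/hom_eq/st/hom_eq; rewrite gP.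
have gM : {morph (fun y => t (g y)) : x y / x * y}.
  by move=> x y /=; rewrite -{1}(gP x) -{1}(gP y) -homM gE homM.
by exists (hom_of gM).
Qed.

Section Pfin.
Variables (X : groupType) (p : nat).
Implicit Types (N M : set X) (x : X).

Lemma pfin_normal N : pfin p N -> is_normal_subgroup N.
Proof.
move=> [T [s [_ sN]]]; have -> : N = [set x | s x = 1].
  by apply/seteqP; split=> x /sN.
exact: ker_normal.
Qed.

Lemma pfin_quotient N : pfin p N ->
  exists (T : groupType) (s : {multiplicative X -> T}),
    [/\ finite_p_group p T, range s = [set: T] & forall x, s x = 1 <-> N x].
Proof.
move=> pN; have nN := pfin_normal pN.
have [T [s [sS sN]]] := quotient_exists nN.
exists T, s; split=> //; case: pN => T' [s' [pT' s'N]].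
have /choice[g gP] (t : T) : exists x, s x = t.
  by have [x _ <-] : range s t by [rewrite sS]; exists x.
have sE x y : s x = s y <-> s' x = s' y.
  by rewrite -!hom_eq sN s'N.
have gM : {morph (fun t => s' (g t)) : x y / x * y}.
  by move=> x y /=; rewrite -homM; apply/sE; rewrite homM !gP.
apply: (@finite_p_group_inj p _ _ (hom_of gM)) => // t u /=.
by move/sE; rewrite !gP.
Qed.

Lemma pfin_torsion N x : pfin p N -> torsion p^' x -> N x.
Proof.
move=> [T [s [[_ /P_groupP pT] sN]]] p'x.
by apply/sN; apply: torsion_coprime (pT _) (torsion_hom s p'x).
Qed.

Lemma pfin_root N x m : pfin p N -> p^'.-nat m -> N (x ^+ m) -> N x.
Proof.
move=> [T [s [[_ /P_groupP pT] sN]]] p'm /sN; rewrite homX => sx.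
by apply/sN; apply: torsion_coprime (pT _) _; exists m.
Qed.

Lemma pfinI N M : pfin p N -> pfin p M -> pfin p (N `&` M).
Proof.
move=> [T [s [pT sN]]] [U [t [pU tM]]].
have fM : {morph (fun x => (s x, t x)) : x y / x * y}.
  by move=> x y; rewrite !homM.
exists (T * U)%type, (hom_of fM); split; first exact: finite_p_group_prod.
move=> x; split=> [[/sN ? /tM ?] //|[/sN sx /tM tx]].
by rewrite /= sx tx.
Qed.

Lemma pfin_full : pfin p [set: X].
Proof.
have [T [s [sS sN]]] := quotient_exists (full_normal X).
have T1 (t : T) : t = 1 by have [x _ <-] : range s t; [rewrite sS|apply/sN].
exists T, s; split=> //; split.
  by apply: sub_finite_set (finite_set1 (1 : T)) => t _; rewrite (T1 t).
by apply/P_groupP => t; rewrite (T1 t); apply: torsion1.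
Qed.

Lemma pfin_sub N M : is_normal_subgroup M -> pfin p N -> N `<=` M -> pfin p M.
Proof.
move=> nM /pfin_quotient[T [s [pT sS sN]]] NM.
have [U [t [tS tM]]] := quotient_exists nM; exists U, t; split=> //.
have [r rE] : exists r : {multiplicative T -> U}, forall x, r (s x) = t x.
  by apply: hom_factor sS _ => x /sN/NM/tM.
apply: (finite_p_group_range (f := r) _ pT).
apply/seteqP; split=> // u _; have [x _ <-] : range t u by rewrite tS.
by exists (s x).
Qed.

Lemma pfin_bigcap (I : eqType) (r : seq I) (F : I -> set X) :
  (forall i, i \in r -> pfin p (F i)) ->
  exists2 N, pfin p N & forall i, i \in r -> N `<=` F i.
Proof.
elim: r => [|i r IHr] hF; first by exists [set: X]; [exact: pfin_full|].
have [|N pN NF] := IHr; first by move=> j jr; apply: hF; rewrite inE jr orbT.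
exists (N `&` F i); first by apply: pfinI => //; apply: hF; rewrite mem_head.
move=> j; rewrite inE => /predU1P[->|jr] x [Nx Fx] //.
exact: (NF j).
Qed.

(** The index is the order of X / N; by Lagrange's theorem, an index that is a p-number is an
    exponent of X / N. *)
Lemma pfin_index N : prime p ->
  pfin p N <-> is_normal_subgroup N /\ finite_P_index p N.
Proof.
move=> pp; have sP (T : groupType) (s : {multiplicative X -> T}) x y :
    (forall x, s x = 1 <-> N x) -> N (x^-1 * y) <-> s x = s y.
  by move=> sN; rewrite -hom_eq sN.
split=> [pN|[nN [n pn nI]]].
  split; first exact: pfin_normal.
  have [T [s [[fT pT] sS sN]]] := pfin_quotient pN.
  have [gT [f fB]] := finite_groupE fT.
  exists #|gT|; first by rewrite -cardsT; apply: p_group_card fB pT.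
  apply: card_eq_trans (card_cosets (s := s) (pfin_normal pN).1 _) _.
    by move=> x y _ _; apply: sP.
  rewrite sS; apply: card_eq_trans (card_finType gT).
  exact: card_bij fB.
have [T [s [sS sN]]] := quotient_exists nN.
have cT : [set: T] #= `I_n.
  rewrite -sS; apply: card_eq_trans nI; apply: card_esym.
  by apply: card_cosets nN.1 _ => x y _ _; apply: sP.
exists T, s; split=> //; split; first by exists n.
have [gT [f fB]] := finite_groupE (ex_intro _ n cT : finite_group T).
have nE : n = #|gT|.
  apply/card_eq_II; apply: card_eq_trans (card_finType gT).
  by apply: card_eq_trans (card_esym cT) _; apply: card_bij fB.
apply/P_groupP => t; exists n => //.
apply: (inj_hom1 (bij_inj fB)); rewrite homX nE -cardsT.
by apply: expg_cardG; rewrite finset.in_setT.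
Qed.

End Pfin.

(** * Residual properties of bounded nilpotent groups *)

Lemma commXg_central (X : groupType) (x y : X) n :
  commute x [~ x, y] -> [~ x ^+ n, y] = [~ x, y] ^+ n.
Proof.
move=> cxy; rewrite {1}/commg conjXg.
have -> : x ^ y = x * [~ x, y] by rewrite /commg mulVKg.
by rewrite expgMn // mulKg.
Qed.

Lemma torsion_expg_eq (X : groupType) (p : nat) (x : X) a b : prime p ->
  p^'.-nat a -> (p %| b)%N -> x ^+ a = x ^+ b -> torsion p^' x.
Proof.
move=> pp; rewrite p'natE // => npa pb xab.
case: (leqP a b) => [ab|/ltnW ba].
  exists (b - a)%N; first by rewrite p'natE // dvdn_subr.
  by rewrite expgnFr // xab mulgV.
exists (a - b)%N; first by rewrite p'natE // dvdn_subl.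
by rewrite expgnFr // xab mulgV.
Qed.

Definition central (X : groupType) (x : X) := forall y, commute x y.

(** Take the first term of the central series with nontrivial image: commutators with its elements
    lie in the previous term and die, so its image is central. *)
Lemma nilpotent_center (X U : groupType) (s : {multiplicative X -> U}) x :
  nilpotent_group X -> range s = [set: U] -> s x <> 1 ->
  exists2 u, central u & u <> 1 :> U.
Proof.
move=> [n [Z [Z0 Zn _ Zc]]] sS sx.
have ex : exists i, `[< exists2 y, Z i y & s y <> 1 >].
  by exists n; apply/asboolP; exists x; rewrite // Zn.
case: (ex_minnP ex) => -[|i] /asboolP[y Ziy sy] imin.
  by move: Ziy; rewrite Z0 => y1; case: sy; rewrite y1 hom1.
exists (s y) => // u; have [z _ <-] : range s u by rewrite sS.
apply/commgP/eqP; rewrite -homR; apply: contrapT => syz.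
have lin : (i < n)%N.
  rewrite ltnNge; apply/negP => /= ni.
  have := imin n; rewrite ltnNge ni => h; apply: notF; apply: h.
  by apply/asboolP; exists x; rewrite // Zn.
have [_ Zi] := Zc i lin; have := imin i; rewrite ltnn => h.
by apply: notF; apply: h; apply/asboolP; exists [~ y, z] => //; apply: Zi.
Qed.

(** * Quotients that are minimal for keeping an element out of the p'-torsion *)

Section Monolith.
Variables (X : groupType) (p : nat) (R : set X) (x : X).
Hypotheses (pp : prime p) (nilX : nilpotent_group X) (nR : is_normal_subgroup R).
Hypothesis xR : forall m, p^'.-nat m -> ~ R (x ^+ m).

Lemma maximal_normal : exists N, [/\ is_normal_subgroup N, R `<=` N,
  forall m, p^'.-nat m -> ~ N (x ^+ m) &
  forall M, is_normal_subgroup M -> N `<=` M -> ~ (M `<=` N) ->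
    exists2 m, p^'.-nat m & M (x ^+ m)].
Proof.
pose good N := is_normal_subgroup N /\ forall m, p^'.-nat m -> ~ N (x ^+ m).
(* Imposing the property on the union of R and N makes the empty chain harmless: it then stands for
   R. *)
have [F FP Ftot|A [[nA xA] Amax]] := @Zorn_bigcup X [set N | good (R `|` N)].
  pose D := R `|` \bigcup_(N in F) N.
  have DP (u v : X) : D u -> D v ->
      exists2 M, good M & [/\ M u, M v & M `<=` D].
    have Dsub N : F N -> (R `|` N) `<=` D.
      by move=> FN z [Rz|Nz]; [left|right; exists N].
    have RD : R `<=` D by move=> z Rz; left.
    have gd N : F N -> good (R `|` N) by move=> FN; apply: FP.
    case=> [Ru|[N FN Nu]]; case=> [Rv|[M FM Mv]].
    - by exists R; split.
    - by exists (R `|` M); [exact: gd|split; [left|right|exact: Dsub]].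
    - by exists (R `|` N); [exact: gd|split; [right|left|exact: Dsub]].
    case: (Ftot _ _ FN FM) => [NM|MN].
      by exists (R `|` M); [exact: gd|split; [right; exact: NM|right|exact: Dsub]].
    by exists (R `|` N); [exact: gd|split; [right|right; exact: MN|exact: Dsub]].
  split; last first.
    by move=> m p'm Dx; have [M [_ xM] [Mx _ _]] := DP _ _ Dx Dx; apply: (xM m).
  split; first split.
  - by left; apply: sg1 nR.1.
  - move=> u v Du Dv; have [M [nM _] [Mu Mv]] := DP _ _ Du Dv; apply.
    exact: sgM nM.1 Mu Mv.
  - move=> u Du; have [M [nM _] [Mu _]] := DP _ _ Du Du; apply.
    exact: sgV nM.1 Mu.
  - move=> u v Du; have [M [nM _] [Mu _]] := DP _ _ Du Du; apply.
    exact: nsgJ nM Mu.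
exists (R `|` A); split=> // M nM AM nMA.
apply: contrapT => nex; apply: (Amax M).
  split; first by move=> z Az; apply: AM; right.
  by move=> MA; apply: nMA => z Mz; right; apply: MA.
suff : good (R `|` M) by [].
have -> : R `|` M = M.
  by apply/seteqP; split=> z; [case=> // Rz; apply: AM; left|right].
by split=> // m p'm Mx; apply: nex; exists m.
Qed.

(** In the quotient U by a maximal N, a nontrivial central element generates a normal subgroup,
    which contains a p'-power of the image of x by maximality. Comparing exponents in such relations
    gives all the conclusions. *)
Lemma monolith : exists (U : groupType) (s : {multiplicative X -> U}),
  [/\ range s = [set: U], forall r, R r -> s r = 1, ~ torsion p^' (s x),
      forall u : U, central u -> torsion p u &
      exists2 m, p^'.-nat m & central (s x ^+ m)].
Proof.
have [N [nN RN xN Nmax]] := maximal_normal.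
have [U [s [sS sN]]] := quotient_exists nN.
have xtor : ~ torsion p^' (s x).
  by move=> [m p'm sx]; apply: (xN m p'm); apply/sN; rewrite homX.
(* The quotient of two natural powers stands for an integer power of u. *)
have meet (u : U) : central u -> u <> 1 ->
    exists2 m, p^'.-nat m & exists j k : nat, s x ^+ m = u ^+ j / u ^+ k.
  move=> cu u1; pose M := [set y | exists j k : nat, s y = u ^+ j / u ^+ k].
  have cX (j k : nat) : commute (u ^+ j) (u ^+ k) by apply: commuteX2; apply: commute_refl.
  have cXV (j k : nat) : commute (u ^+ j)^-1 (u ^+ k).
    by apply/commute_sym/commuteV; apply: cX.
  have nM : is_normal_subgroup M.
    split; first split.
    - by exists 0%N, 0%N; rewrite hom1 mulgV.
    - move=> y z [j [k yE]] [j' [k' zE]]; exists (j + j')%N, (k' + k)%N.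
      rewrite homM yE zE !expgnDr invgM !mulgA; congr (_ * _).
      by rewrite -!mulgA; congr (_ * _); apply: cXV.
    - move=> y [j [k yE]]; exists k, j.
      by rewrite homV yE invgM invgK.
    - move=> y z [j [k yE]]; exists j, k; rewrite homJ yE /conjg mulgA.
      have c : commute (u ^+ j / u ^+ k) (s z)^-1.
        apply: commute_sym; apply: commuteM; last apply: commuteV.
          by apply: commuteX; apply/commute_sym/cu.
        by apply: commuteX; apply/commute_sym/cu.
      by rewrite -c -mulgA mulVg mulg1.
  have [y _ yu] : range s u by rewrite sS.
  have NM : N `<=` M by move=> z /sN sz; exists 0%N, 0%N; rewrite sz mulgV.
  have [|m p'm [j [k e]]] := Nmax M nM NM.
    move=> MN; apply: u1; rewrite -yu; apply/sN/MN; exists 1%N, 0%N.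
    by rewrite yu divg1.
  by exists m => //; exists j, k; rewrite -homX.
have sx1 : s x <> 1 by move=> e; apply: xtor; rewrite e; apply: torsion1.
have [u0 cu0 u01] := nilpotent_center nilX sS sx1.
have centralX (u : U) (n : nat) : central u -> central (u ^+ n).
  by move=> cu w; apply/commute_sym/commuteX/commute_sym/cu.
have [m0 p'm0 [j0 [k0 e0]]] := meet u0 cu0 u01.
have cm0 : central (s x ^+ m0).
  move=> w; rewrite e0; apply/commute_sym/commuteM; last apply: commuteV.
    exact/commute_sym/centralX.
  exact/commute_sym/centralX.
(* If this central power were nontrivial, a p'-power of the image of x would be a power of it; the
   exponents differ modulo p, so that image would be p'-torsion. *)
have sxp : s x ^+ (m0 * p) = 1.
  apply: contrapT => ne; have [|m p'm [j [k]]] := meet _ _ ne.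
    by rewrite expgnA; apply: centralX.
  rewrite -!expgnA => e; apply: xtor.
  apply: (@torsion_expg_eq _ p _ (m + m0 * p * k) (m0 * p * j)) => //.
  - by rewrite p'natE // dvdn_addl -?p'natE // mulnAC dvdn_mull.
  - by rewrite mulnAC dvdn_mull.
  - by rewrite expgnDr e mulgVK.
exists U, s; split=> //; [by move=> r /RN/sN| |by exists m0].
move=> u cu; have [->|/eqP u1] := eqVneq u 1; first exact: torsion1.
have [m p'm [j [k e]]] := meet u cu u1.
have utor : exists2 d, (0 < d)%N & u ^+ d = 1.
  have [q q0 sxq] : exists2 q, (0 < q)%N & s x ^+ q = 1.
    by exists (m0 * p)%N => //; rewrite muln_gt0 (pi_nat_gt0 p'm0) prime_gt0.
  have cu' : commute (u ^+ j) (u ^+ k) by apply: commuteX2; apply: commute_refl.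
  have e2 : u ^+ (j * q) = u ^+ (k * q).
    apply/divg1_eq; rewrite !expgnA -expVgn -expgMn; last by apply: commuteV.
    by rewrite -e -expgnA mulnC expgnA sxq expg1n.
  have jk : j <> k.
    by move=> jk; apply: xtor; exists m; rewrite // e jk mulgV.
  case: (ltngtP j k) => [h|h|//].
    exists (k * q - j * q)%N; first by rewrite -mulnBl muln_gt0 subn_gt0 h.
    by rewrite expgnFr ?leq_mul // 1?ltnW // e2 mulgV.
  exists (j * q - k * q)%N; first by rewrite -mulnBl muln_gt0 subn_gt0 h.
  by rewrite expgnFr ?leq_mul // 1?ltnW // e2 mulgV.
have [d d0 ud] := utor.
exists (d`_p)%N; first exact: part_pnat.
(* The power of u by the p-part of d is p'-torsion; were it nontrivial, [meet] would make the image
   of x p'-torsion as well. *)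
apply: contrapT => u2; have [|m' p'm' [j' [k' e']]] := meet _ _ u2.
  exact: centralX.
apply: xtor; exists (m' * d`_p^')%N; first by rewrite pnatM p'm' part_pnat.
rewrite expgnA e' -!expgnA expgMn; last first.
  by apply/commuteV/commuteX2/commute_refl.
rewrite expVgn -!expgnA mulnAC partnC // mulnAC partnC //.
by rewrite !expgnA ud !expg1n mulgV.
Qed.

End Monolith.

(** * Finiteness of p-torsion sections *)

Definition covered (X : groupType) (K L : set X) : Prop :=
  exists s : seq X, forall x, K x -> exists2 y, y \in s & L (y^-1 * x).

Lemma covered_trans (X : groupType) (K L M : set X) :
  covered K L -> covered L M -> covered K M.
Proof.
move=> [s sP] [t tP]; exists [seq y * z | y <- s, z <- t] => x Kx.
have [y ys Lyx] := sP x Kx; have [z zt Mz] := tP _ Lyx.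
by exists (y * z); [apply: allpairs_f|rewrite invgM -mulgA].
Qed.

(* The only consequence of P-boundedness that is used. *)
Definition finite_sections (p : nat) (X : groupType) : Prop :=
  forall N C : set X, is_normal_subgroup N -> is_subgroup C ->
    (forall c, C c -> exists2 m, p.-nat m & N (c ^+ m)) -> covered C N.

Lemma finite_group_sections p (X : groupType) :
  finite_group X -> finite_sections p X.
Proof.
move=> /finite_seqP[s sE] N C nN _ _; exists s => x _; exists x.
  by have : [set: X] x by []; rewrite sE.
by rewrite mulVg; apply: sg1 nN.1.
Qed.

(** Climb the central series, following C modulo N. At each factor, N leaves a quotient of a bounded
    abelian group, in which C contributes only p-torsion elements, hence finitely many. *)
Lemma bounded_nilpotent_sections (P : nat_pred) p (X : groupType) :
  prime p -> p \in P -> bounded_nilpotent P X -> finite_sections p X.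
Proof.
move=> pp pP [n [Z [[Z0 Zn Znorm Zc] Zb]]] N C nN sC Ctor.
have [Y [r [rS rN]]] := quotient_exists nN.
have rNP x y : N (x^-1 * y) <-> r x = r y.
  by rewrite -hom_eq rN.
pose Ci i := [set x | C x /\ exists2 z, Z i z & r z = r x].
suff : forall i, (i <= n)%N -> covered (Ci i) N.
  move=> /(_ n (leqnn n))[s sP]; exists s => x Cx; apply: sP.
  by split=> //; exists x; rewrite // Zn.
elim=> [_|i IHi lin].
  exists [:: 1] => x [Cx [z]]; rewrite Z0 => -> e.
  by exists 1; rewrite ?mem_head //; apply/rNP.
apply: covered_trans (IHi (ltnW lin)).
have [T [cT Tfin] [f [fM fS fK]]] := Zb i lin.
set K := Z i.+1 in fM fS fK *; have sK : is_subgroup K := (Znorm i.+1 lin).1.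
have f1 : f 1 = 1.
  by apply: (@mulgI _ (f 1)); rewrite -fM ?mulg1 //; apply: sg1.
have fX z k : K z -> f (z ^+ k) = f z ^+ k.
  move=> Kz; elim: k => // k IHk; rewrite !expgS fM ?IHk //; exact: sgX.
have fV z : K z -> f z^-1 = (f z)^-1.
  move=> Kz; apply: (@mulgI _ (f z)); rewrite -fM //; last exact: sgV.
  by rewrite !mulgV.
pose M : set T := [set f w | w in N `&` K].
have nM : is_normal_subgroup M.
  split; first split.
  - by exists 1 => //; split; [exact: sg1 nN.1|exact: sg1].
  - move=> _ _ [u [Nu Ku] <-] [v [Nv Kv] <-]; exists (u * v); last by rewrite fM.
    by split; [apply: sgM nN.1 Nu Nv|apply: sgM].
  - move=> _ [u [Nu Ku] <-]; exists u^-1; last by rewrite fV.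
    by split; [apply: sgV nN.1 Nu|apply: sgV].
  - by move=> u v Mu; rewrite /conjg -cT -mulgA mulgV mulg1.
have [T' [t [tS tM]]] := quotient_exists nM.
have /finite_seqP[s sE] := Tfin _ t tS p pp pP.
pose Q (y : T') x := Ci i.+1 x /\ exists z, [/\ K z, r z = r x & t (f z) = y].
exists [seq xget 1 (Q y) | y <- s] => x [Cx [z Kz rz]].
have [m pm Nm] := Ctor x Cx.
have ts : t (f z) \in s.
  suff : [set` s] (t (f z)) by [].
  rewrite -sE /=; apply/torsionP; exists m => //.
  rewrite -homX -fX //; apply/tM; exists (z ^+ m) => //.
  by split; [apply/rN; rewrite homX rz -homX; apply/rN|apply: sgX].
exists (xget 1 (Q (t (f z)))); first by apply/map_f.
have ex : exists y, Q (t (f z)) y.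
  by exists x; split; [split=> //; exists z|exists z].
have [[Cy _] [z' [Kz' rz' tz']]] := xgetPex 1 ex.
set y := xget 1 _ in Cy rz' *.
split; first by apply: sgM => //; apply: sgV.
have [w [Nw Kw] fw] : M ((f z')^-1 * f z).
    by apply/tM; rewrite homM homV tz' mulVg.
have Kzz : K (z'^-1 * z) by apply: sgM => //; apply: sgV.
(* Dividing by w, an element of N, keeps the class modulo N and moves the element into Z i, the
   kernel of f on K. *)
exists (z'^-1 * z * w^-1).
  suff : (K `&` f @^-1` [set 1]) (z'^-1 * z * w^-1) by rewrite fK.
  split; first by apply: sgM => //; apply: sgV.
  rewrite /= fM //; last exact: sgV.
  by rewrite fM ?fV // -?fw ?mulgV //; apply: sgV.
by rewrite !homM !homV rz' rz (_ : r w = 1) ?invg1 ?mulg1 //; apply/rN.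
Qed.

(** By [monolith], pass to a quotient U where x is not p'-torsion and the centre is p-torsion.
    Finite sections give the centre an exponent e, a commutator identity carries it up the upper
    central series D, and so U is a p-group; finite sections once more make U finite. *)
Lemma p_residual (X : groupType) (p : nat) (x : X) : prime p ->
  nilpotent_group X -> finite_sections p X -> ~ torsion p^' x ->
  exists2 N, pfin p N & ~ N x.
Proof.
move=> pp nilX finX xtor.
have [|U [s [sS _ sx sC _]]] := @monolith X p [set 1] x pp nilX (trivial_normal X).
  by move=> m p'm e; apply: xtor; exists m.
pose N := [set y | s y = 1].
have nN : is_normal_subgroup N := ker_normal s.
pose C := [set y | central (s y)].
have sgC : is_subgroup C.
  split=> [u|u v cu cv w|u cu w]; rewrite /= ?hom1 ?homM ?homV.
  - exact/commute_sym/commute1.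
  - by apply/commute_sym/commuteM; apply/commute_sym.
  - by apply/commute_sym/commuteV/commute_sym.
have [|l lP] := finX N C nN sgC.
  by move=> c /sC[m pm cm]; exists m => //; rewrite /N /= homX.
have [e pe eP] : exists2 e, p.-nat e & forall u, central u -> u ^+ e = 1 :> U.
  have [e pe eP] : exists2 e, p.-nat e & forall y, y \in l -> central (s y) -> s y ^+ e = 1.
    elim: l {lP} => [|y l [e pe eP]]; first by exists 1%N.
    have [cy|ncy] := pselect (central (s y)); last first.
      by exists e => // z; rewrite inE => /predU1P[->|/eP].
    have [m pm ym] := sC _ cy; exists (m * e)%N; first by rewrite pnatM pm.
    move=> z; rewrite inE => /predU1P[-> _|/eP zl /zl ze].
      by rewrite expgnA ym expg1n.
    by rewrite mulnC expgnA ze expg1n.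
  exists e => // u; have [y _ <-] : range s u by rewrite sS.
  move=> cu; have [z zl Nz] := lP y cu.
  have /hom_eq szy : s (z^-1 * y) = 1 := Nz.
  by rewrite -szy; apply: eP zl _; rewrite szy.
pose fix D i : set U :=
  if i is i'.+1 then [set u | forall w, D i' [~ u, w]] else [set 1].
have nD i : is_normal_subgroup (D i).
  elim: i => [|i IHi]; first exact: trivial_normal.
  have [V [t [tS tD]]] := quotient_exists IHi.
  have DE u : D i.+1 u <-> central (t u).
    split=> [Du v|cu w]; last by apply/tD; rewrite homR; apply/eqP/commgP/cu.
    have [w _ <-] : range t v by rewrite tS.
    by apply/commgP/eqP; rewrite -homR; apply/tD/Du.
  split; first split.
  - by apply/DE; rewrite hom1 => w; apply/commute_sym/commute1.
  - move=> u v /DE cu /DE cv; apply/DE => w; rewrite homM.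
    by apply/commute_sym/commuteM; apply/commute_sym.
  - by move=> u /DE cu; apply/DE => w; rewrite homV; apply/commute_sym/commuteV/commute_sym.
  - move=> u v /DE cu; apply/DE; rewrite homJ (_ : _ ^ _ = t u) //.
    by rewrite /conjg mulgA -mulgA cu mulKg.
(* In the inductive step [u, w] is central modulo D i, so [u^e, w] is congruent to [u, w]^e, which
   is covered by the induction hypothesis. *)
have De i : forall u, D i.+1 u -> D i (u ^+ e).
  elim: i => [|i IHi] u Du.
    apply: eP => w; apply/commgP/eqP; exact: Du.
  move=> w; have [V [t [tS tD]]] := quotient_exists (nD i).
  apply/tD; rewrite homR homX commXg_central.
    by rewrite -homR -homX; apply/tD/IHi/Du.
  apply/commute_sym/commgP/eqP; rewrite -!homR; apply/tD.
  exact: (Du w).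
have [n [Z [Z0 Zn _ Zc]]] := nilX.
have ZD i : (i <= n)%N -> forall z, Z i z -> D i (s z).
  elim: i => [_ z|i IHi lin z Zz]; first by rewrite Z0 /= => ->; rewrite hom1.
  move=> w; have [y _ <-] : range s w by rewrite sS.
  by rewrite -homR; apply: IHi (ltnW lin) _ _; apply: (Zc i lin).2.
have De' i : forall u, D i u -> u ^+ (e ^ i) = 1.
  elim: i => [u -> //|i IHi u /De/IHi].
  by rewrite -expgnA -expnS.
have pU (u : U) : torsion p u.
  exists (e ^ n)%N; first by rewrite pnatX pe.
  by have [y _ <-] : range s u; [rewrite sS|apply/De'/ZD => //; rewrite Zn].
exists N; last by move=> sx1; apply: sx; rewrite sx1; apply: torsion1.
exists U, s; split=> //; split; last exact/P_groupP.
have [||k kP] := finX N setT nN.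
- by [].
- by move=> y _; have [m pm sm] := pU (s y); exists m => //; rewrite /N /= homX.
apply: sub_finite_set (finite_seq [seq s y | y <- k]) => u _.
have [x' _ <-] : range s u by rewrite sS.
have [//|y yk Ny] := kP x'.
have /hom_eq <- : s (y^-1 * x') = 1 := Ny.
exact: map_f.
Qed.

(** * The amalgamated subgroup *)

Lemma pfin_preim (X Y : groupType) (f : {multiplicative X -> Y}) p N :
  pfin p N -> pfin p (f @^-1` N).
Proof.
move=> [T [s [pT sN]]].
by exists T, (hom_comp s f); split=> // x; apply: sN.
Qed.

Lemma prime_p'nat (p q : nat) : prime p -> prime q -> p != q -> p^'.-nat q.
Proof. by move=> pp qp pq; rewrite p'natE // dvdn_prime2. Qed.

Lemma pnat_p'nat (p q n : nat) : p != q -> p.-nat n -> q^'.-nat n.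
Proof.
move=> pq; apply: sub_in_pnat => r _; rewrite !inE => /eqP ->.
exact: pq.
Qed.

Lemma torsion_split (X : groupType) pi (x : X) n : (0 < n)%N -> x ^+ n = 1 ->
  exists y z, [/\ torsion pi y, torsion pi^' z & x = y * z].
Proof.
move=> n0 xn; have cn : coprime (n`_pi)%N (n`_pi^')%N by apply: coprime_partC.
have [u v e _] := egcdnP (n`_pi^')%N (part_gt0 pi n).
move: e; rewrite (eqP cn) addn1 => e.
exists (x ^+ (v * n`_pi^'))^-1, (x ^+ (u * n`_pi)); split.
- exists (n`_pi)%N; first exact: part_pnat.
  by rewrite expVgn -expgnA -mulnA [(n`_pi^' * _)%N]mulnC partnC // mulnC expgnA xn expg1n invg1.
- exists (n`_pi^')%N; first exact: part_pnat.
  by rewrite -expgnA -mulnA partnC // mulnC expgnA xn expg1n.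
- by rewrite e expgSr mulKg.
Qed.

(** If a prime p divides the order of x, then x is not p'-torsion, and a finite p-quotient detects
    it. *)
Lemma finite_nilpotent_residual (P : nat_pred) (X : groupType) (x : X) :
  finite_nilpotent_P_group P X -> x <> 1 ->
  exists2 p, prime p /\ p \in P & exists2 N, pfin p N & ~ N x.
Proof.
move=> [fX nX pX] x1; have [n on pn] := pX x.
have n1 : (1 < n)%N.
  have [n0 xn _] := on; rewrite ltn_neqAle n0 andbT.
  by apply/eqP => n1; apply: x1; rewrite -xn -n1.
have pp := pdiv_prime n1.
exists (pdiv n); first by split=> //; apply: (pnatPpi pn); rewrite pi_pdiv.
apply: p_residual => //; first exact: finite_group_sections.
move=> [m p'm xm]; have nm := has_order_dvd on xm.
by move: p'm; rewrite p'natE // (dvdn_trans (pdiv_dvd n) nm).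
Qed.

Lemma residual_p (P : nat_pred) (X : groupType) (x : X) :
  residually (finite_nilpotent_P_group P) X -> x <> 1 ->
  exists2 p, prime p /\ p \in P & exists2 N, pfin p N & ~ N x.
Proof.
move=> rX x1; have [T [s [nT _ sx]]] := rX x x1.
have [p pP [N pN Nsx]] := finite_nilpotent_residual nT sx.
by exists p => //; exists (s @^-1` N) => //; apply: pfin_preim.
Qed.

Lemma p_group_FN (P : nat_pred) p (X : groupType) : prime p -> p \in P ->
  finite_p_group p X -> finite_nilpotent_P_group P X.
Proof.
move=> pp pP pX; split; [exact: pX.1|exact: p_group_nilpotent pX|].
apply/P_groupP => x; have [_ /P_groupP tX] := pX.
by apply: torsion_sub (tX x) => q; rewrite inE => /eqP ->.
Qed.

(** * Torsion and separability of H in one factor *)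

Section OneFactor.
Variables (H A T : groupType) (i : {multiplicative H -> A})
  (f : {multiplicative A -> T}) (P : nat_pred).
Hypothesis hP : forall p, p \in P -> prime p.
Hypothesis resA : residually (finite_nilpotent_P_group P) A.
Hypothesis bT : bounded_nilpotent P T.
Hypothesis fiI : injective (f \o i).
Hypothesis perH : periodic H.

Let iI : injective i.
Proof. by move=> x y e; apply: fiI; rewrite /= e. Qed.

(** If a prime q outside P divided the order n of h, the power of h by n / q would be a nontrivial
    q-element, yet vanish in every finite p-quotient of A with p in P. *)
Lemma amalgam_P_torsion (h : H) : torsion P h.
Proof.
have [n on] := perH h; have [n0 hn _] := on.
exists n => //; apply/(pnatP _ n0) => q qp qn; apply: contrapT => qP.
have hq1 : h ^+ (n %/ q) <> 1.
  move=> e; have := has_order_dvd on e; apply/negP; rewrite gtnNdvd //.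
    by rewrite divn_gt0 ?prime_gt0 // dvdn_leq.
  by rewrite ltn_Pdiv // prime_gt1.
have [|p [pp pP] [N pN]] := residual_p (x := i (h ^+ (n %/ q))) resA.
  by move=> e; apply: hq1; apply: inj_hom1 e.
apply; apply: pfin_torsion pN _; apply: torsion_hom; exists q.
  by apply: prime_p'nat => //; apply/eqP => e; apply: qP; rewrite -e.
by rewrite -expgnA divnK.
Qed.

Lemma nilT : nilpotent_group T.
Proof. by have [n [Z [h _]]] := bT; exists n, Z. Qed.

(** This description as an intersection is what makes the p'-torsion of T a normal subgroup. *)
Lemma torsion_p'E p (t : T) : p \in P ->
  torsion p^' t <-> forall N, pfin p N -> N t.
Proof.
move=> pP; split=> [tt N pN|tN]; first exact: pfin_torsion pN tt.
apply: contrapT => tt; have [N pN nNt] := p_residual (hP pP) nilT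
  (bounded_nilpotent_sections (hP pP) pP bT) tt.
exact: nNt (tN N pN).
Qed.

Lemma torsion_p'_normal p : p \in P ->
  is_normal_subgroup [set t : T | torsion p^' t].
Proof.
move=> pP; have -> : [set t : T | torsion p^' t] = \bigcap_(N in pfin p) N.
  by apply/seteqP; split=> t /torsion_p'E; apply.
by apply: bigcap_normal => N /pfin_normal.
Qed.

(** As H is P-torsion, excluding the primes of P other than p leaves p-torsion. The sets on the
    right are subgroups because H embeds into T. *)
Lemma torsion_pE p (h : H) : p \in P ->
  torsion p h <-> forall r, r \in P -> r != p -> torsion r^' h.
Proof.
move=> pP; split=> [[n pn hn] r rP rp|hr].
  by exists n => //; apply: pnat_p'nat pn; rewrite eq_sym.
have /torsionP[n on Pn] := amalgam_P_torsion h; have [n0 hn _] := on.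
exists n => //; apply/(pnatP _ n0) => q qp qn.
have qP : q \in P by apply: (pnatPpi Pn); rewrite mem_primes qp n0.
rewrite inE; apply: contraT => qp'.
have [m q'm hm] := hr q qP qp'.
by move: q'm; rewrite p'natE // (dvdn_trans qn) // (has_order_dvd on).
Qed.

Lemma torsion_p_subgroup p : p \in P -> is_subgroup [set h : H | torsion p h].
Proof.
move=> pP; have tM r : r \in P -> is_subgroup [set h : H | torsion r^' h].
  move=> rP; have := preim_subgroup (hom_comp f i) (torsion_p'_normal rP).1.
  congr is_subgroup; apply/seteqP; split=> h /=.
    exact: (@torsion_inj _ _ (hom_comp f i) _ _ fiI).
  exact: (torsion_hom (hom_comp f i)).
split=> [|x y|x] /=; first exact: torsion1; last exact: torsionV.
move=> /(torsion_pE _ pP) tx /(torsion_pE _ pP) ty; apply/(torsion_pE _ pP).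
by move=> r rP rp; apply: (sgM (tM r rP)); [exact: tx|exact: ty].
Qed.

(** The p-elements form a p-isolated subgroup; conversely, an element killed by p^k is reached from
    1 by k extractions of p-th roots. *)
Lemma isolator_torsion p : p \in P ->
  isolator p [set 1] = [set h : H | torsion p h].
Proof.
move=> pP; have pp := hP pP; apply/seteqP; split=> h /=.
  apply; first exact: torsion_p_subgroup.
    move=> q x _; rewrite inE => /eqP -> [n pn]; rewrite -expgnA => xn.
    by exists (p * n)%N; rewrite // pnatM pnat_id.
  by move=> _ ->; apply: torsion1.
move=> [n pn hn] K sK iK K1; have [k nE] := p_natP pn.
move: h hn; rewrite nE => {n pn nE}; elim: k => [|k IHk] h hn.
  by apply: K1; rewrite /= -hn.
apply: (iK p) => //; first by rewrite inE.
by apply: IHk; rewrite -expgnA -expnS.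
Qed.

Lemma torsion_p_finite p : p \in P -> finite_set [set h : H | torsion p h].
Proof.
move=> pP; pose fi := hom_comp f i.
have sC : is_subgroup (fi @` [set h : H | torsion p h]).
  have sH := torsion_p_subgroup pP; split.
  - by exists 1; [exact: torsion1|rewrite hom1].
  - move=> _ _ [x tx <-] [y ty <-]; exists (x * y); last by rewrite homM.
    exact: (sgM sH).
  - by move=> _ [x tx <-]; exists x^-1; [exact: torsionV|rewrite homV].
have [|s sP] := bounded_nilpotent_sections (hP pP) pP bT (trivial_normal T) sC.
  by move=> _ [h [m pm hm] <-]; exists m => //; suff : fi h ^+ m = 1 by []; rewrite -homX hm hom1.
apply: (@sub_finite_set _ _ (fi @^-1` [set` s])).
  move=> h th; have [|y ys e] := sP (fi h); first by exists h.
  suff e' : fi h = y by rewrite /preimage /mkset e'.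
  by apply: (@mulgI _ y^-1); rewrite mulVg; apply: e.
by apply: finite_preimage (finite_seq s) => x y _ _; apply: fiI.
Qed.

Hypothesis P0 : exists p, p \in P.

(* If every finite p-quotient (p in P) maps a into the image of H, then a lies
   in h_p D_p, where D_p is the intersection of the normal subgroups of finite
   p-index and h_p has p-power order; since f a then has finite order, almost
   all h_p are trivial, and a is the product of the others. *)
Lemma amalgam_p_separable a : ~ range i a ->
  exists2 p, p \in P & exists2 M, pfin p M & forall h, ~ M ((i h)^-1 * a).
Proof.
move=> aH; apply: contrapT => nosep.
have Ma p M : p \in P -> pfin p M -> exists h, M ((i h)^-1 * a).
  move=> pP pM; apply: contrapT => nh; apply: nosep.
  by exists p => //; exists M => // h Mh; apply: nh; exists h.
(* One element h_p must serve all M at once. As H(p) is finite, failures of all its elements would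
   occur together in one finite intersection of such M. *)
have comp p : exists h, p \in P ->
    torsion p h /\ forall M, pfin p M -> M ((i h)^-1 * a).
  have [pP|/negP npP] := boolP (p \in P); last by exists 1.
  have [l lE] := (finite_seqP _).1 (torsion_p_finite pP).
  have lP h : torsion p h <-> h \in l.
    by have -> : torsion p h = [set h | torsion p h] h by []; rewrite lE.
  apply: contrapT => nh.
  have /choice[N NP] h : exists N, h \in l -> pfin p N /\ ~ N ((i h)^-1 * a).
    have [hl|hl] := boolP (h \in l); last by exists setT.
    apply: contrapT => nN; apply: nh; exists h => _; split; first exact/lP.
    by move=> M pM; apply: contrapT => nM; apply: nN; exists M.
  have [|M pM MN] := @pfin_bigcap _ p _ l N; first by move=> h /NP[].
  have [h Mh] := Ma p M pP pM; have [n [n0 hn _]] := perH h.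
  have [y [z [ty tz hE]]] := torsion_split p n0 hn.
  have /lP yl := ty; case: (NP y yl) => _; apply; apply: MN yl _ _.
  have -> : (i y)^-1 * a = i z * ((i h)^-1 * a).
    by rewrite hE homM invgM !mulgA mulgV mul1g.
  apply: (sgM (pfin_normal pM).1) => //.
  by apply: pfin_torsion pM _; apply: torsion_hom.
have /choice[hp hpP] := comp.
have dP p : p \in P -> torsion p^' (f ((i (hp p))^-1 * a)).
  move=> pP; apply/(torsion_p'E _ pP) => N pN.
  exact: (hpP p pP).2 _ (pfin_preim f pN).
(* Modulo p'-torsion, f a agrees with an element of p-power order; this yields an exponent of f
   a. *)
have [n n0 fan] : exists2 n, (0 < n)%N & f a ^+ n = 1.
  have [p pP] := P0; have [V [t [tS tD]]] := quotient_exists (torsion_p'_normal pP).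
  have /tD := dP p pP; rewrite homM homV => /hom_eq/= e.
  have [k pk hk] := (hpP p pP).1.
  have [m p'm fam] : torsion p^' (f a ^+ k).
    by apply/tD; rewrite homX -e -!homX hk !hom1.
  exists (k * m)%N; last by rewrite expgnA.
  by rewrite muln_gt0 (pi_nat_gt0 pk) (pi_nat_gt0 p'm).
have hp1 p : p \in P -> p \notin primes n -> hp p = 1.
  move=> pP pn; have p'n : p^'.-nat n.
    rewrite p'natE ?hP //; apply: contraNN pn => pn.
    by rewrite mem_primes hP // n0.
  have sD := (torsion_p'_normal pP).1.
  have p'h : torsion p^' (f (i (hp p))).
    suff : [set t : T | torsion p^' t] (f (i (hp p)))^-1 by move/(sgVE sD).
    apply: (@sgMr _ _ _ (f a) sD) => /=; first by exists n.
    by have := dP p pP; rewrite homM homV.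
  apply: torsion_coprime (hpP p pP).1 _.
  exact: (@torsion_inj _ _ (hom_comp f i) _ _ fiI).
(* For p in P not dividing n the element h_p is 1, so no factor is lost by restricting to [r]. *)
pose r := [seq p <- primes n | p \in P].
pose h := foldr (fun p => mul (hp p)) 1 r.
apply: aH; exists h => //; apply/eqP; rewrite -[_ == _](inj_eq (@invg_inj A)).
apply/eqP/(@mulIg _ a); rewrite mulVg; apply: contrapT => ha.
have [p [pp pP] [M pM]] := residual_p resA ha; apply.
have [Y [s [[_ /P_groupP pY] sS sM]]] := pfin_quotient pM; apply/sM/hom_eq.
(* In a finite p-quotient the factors for the other primes die, so h and h_p have the same image. *)
have shq q : q \in P -> q != p -> s (i (hp q)) = 1.
  move=> qP qp; apply/sM; apply: pfin_torsion pM _; apply: torsion_hom.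
  have [k qk hk] := (hpP q qP).1; exists k => //.
  exact: pnat_p'nat qk.
have /sM/hom_eq <- := (hpP p pP).2 M pM.
have : {subset r <= P} by move=> q; rewrite mem_filter => /andP[].
have : uniq r by rewrite filter_uniq ?primes_uniq.
have : p \in r \/ hp p = 1.
  rewrite mem_filter pP /=; have [|pn] := boolP (p \in primes n); first by left.
  by right; apply: hp1.
rewrite /h; elim: (r) => [[//|->] _ _|q l IHl hpl /= /andP[ql ul] lP].
  by rewrite !hom1.
have qP : q \in P by apply: lP; rewrite mem_head.
have lP' : {subset l <= P} by move=> u ul'; apply: lP; rewrite inE ul' orbT.
rewrite !homM; have [qp|qp] := eqVneq q p; last first.
  rewrite shq // mul1g; apply: IHl => //.
  by case: hpl => [|->]; [rewrite inE eq_sym (negPf qp); left|right].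
rewrite qp (_ : s (i (foldr _ _ _)) = 1) ?mulg1 //.
rewrite qp in ql; move: ql lP'; clear -shq.
elim: l => [|u l IHl]; first by rewrite /= !hom1.
rewrite inE negb_or => /andP[pu pl] lP /=.
rewrite !homM shq ?mul1g; first apply: IHl => //; first last.
- by rewrite eq_sym.
- by apply: lP; rewrite mem_head.
by move=> v vl; apply: lP; rewrite inE vl orbT.
Qed.

Lemma amalgam_separable :
  separable (finite_nilpotent_P_group P) (range i).
Proof.
move=> a aH; have [p pP [M pM Mh]] := amalgam_p_separable aH.
have [Y [s [pY sS sM]]] := pfin_quotient pM; exists Y, s; split=> //.
  exact: p_group_FN (hP pP) pP pY.
by move=> [_ [h _ <-] /hom_eq/sM]; apply: Mh.
Qed.

End OneFactor.

(** * Wreath products and alternating words *)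

(** The unrestricted wreath product, with F translating arguments on the right. A homomorphism to it
    over s is a cocycle: c (g g') z = c g z * c g' (z * s g). *)
Definition wreath (T F : groupType) : Type := ((F -> T) * F)%type.

HB.instance Definition _ (T F : groupType) :=
  Choice.copy (wreath T F) ((F -> T) * F)%type.

Section Wreath.
Variables T F : groupType.
Implicit Types u v w : wreath T F.

Definition wreath_mul u v : wreath T F :=
  (fun z => u.1 z * v.1 (z * u.2), u.2 * v.2).
Definition wreath_one : wreath T F := (fun=> 1, 1).
Definition wreath_inv u : wreath T F :=
  (fun z => (u.1 (z * u.2^-1))^-1, u.2^-1).

Fact wreath_mulA : associative wreath_mul.
Proof.
move=> u v w; congr (_, _); last by rewrite /= mulgA.
by apply/funext => z; rewrite /= !mulgA.
Qed.
Fact wreath_mul1 : left_id wreath_one wreath_mul.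
Proof.
case=> u x; congr (_, _); last by rewrite /= mul1g.
by apply/funext => z; rewrite /= mul1g mulg1.
Qed.
Fact wreath_1mul : right_id wreath_one wreath_mul.
Proof.
case=> u x; congr (_, _); last by rewrite /= mulg1.
by apply/funext => z; rewrite /= mulg1.
Qed.
Fact wreath_mulV : left_inverse wreath_one wreath_inv wreath_mul.
Proof.
case=> u x; congr (_, _); last by rewrite /= mulVg.
by apply/funext => z; rewrite /= mulVg.
Qed.
Fact wreath_Vmul : right_inverse wreath_one wreath_inv wreath_mul.
Proof.
case=> u x; congr (_, _); last by rewrite /= mulgV.
by apply/funext => z; rewrite /= mulgK mulgV.
Qed.

HB.instance Definition _ := isGroup.Build (wreath T F)
  wreath_mulA wreath_mul1 wreath_1mul wreath_mulV wreath_Vmul.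

Fact wreath_sndM : {morph (fun u : wreath T F => u.2) : u v / u * v}.
Proof. by []. Qed.

Definition wreath_snd : {multiplicative wreath T F -> F} := hom_of wreath_sndM.

Lemma wreath_mulE u v z : (u * v).1 z = u.1 z * v.1 (z * u.2).
Proof. by []. Qed.

Lemma wreath_eq1 u : u = 1 <-> u.2 = 1 /\ forall z, u.1 z = 1.
Proof.
split=> [->//|]; case: u => u x /= [-> u1].
by congr (_, _); apply/funext.
Qed.

Lemma wreath_expg u n : u.2 = 1 -> forall z, (u ^+ n).1 z = u.1 z ^+ n.
Proof.
move=> u2; elim: n => // n IHn z.
by rewrite !expgS wreath_mulE u2 mulg1 IHn.
Qed.

Lemma finite_wreath : finite_group T -> finite_group F -> finite_group (wreath T F).
Proof.
by move=> fT fF; rewrite /finite_group -setXTT; apply: finite_setX; first exact: finite_fun.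
Qed.

Lemma wreath_base_torsion p u : finite_group F -> P_group p T -> u.2 = 1 ->
  torsion p u.
Proof.
move=> fF /P_groupP pT u2; have [s sE] := (finite_seqP _).1 fF.
suff [l pl ls] : exists2 l, p.-nat l & forall z, z \in s -> u.1 z ^+ l = 1.
  exists l => //; apply/wreath_eq1; split.
    have -> : (u ^+ l).2 = u.2 ^+ l by exact: (homX wreath_snd).
    by rewrite u2 expg1n.
  move=> z; rewrite wreath_expg //; apply: ls.
  by have : [set: F] z by []; rewrite sE.
elim: s {sE} => [|y s [l pl ls]]; first by exists 1%N.
have [k pk yk] := pT (u.1 y); exists (k * l)%N; first by rewrite pnatM pk.
move=> z; rewrite inE => /predU1P[->|/ls zl]; first by rewrite expgnA yk expg1n.
by rewrite mulnC expgnA zl expg1n.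
Qed.

Lemma finite_p_group_wreath p :
  finite_p_group p T -> finite_p_group p F -> finite_p_group p (wreath T F).
Proof.
move=> [fT pT] [fF /P_groupP pF]; split; first exact: finite_wreath.
apply/P_groupP => u; have [m pm um] := pF u.2.
apply: torsion_root pm _; apply: wreath_base_torsion => //.
by rewrite -um; exact: (homX wreath_snd).
Qed.

End Wreath.

(* Permutations act on the right. *)
Record symmetric (X : Type) : Type := Symmetric {
  sym_fun : X -> X; sym_inv : X -> X;
  sym_funK : cancel sym_fun sym_inv; sym_invK : cancel sym_inv sym_fun }.

HB.instance Definition _ (X : Type) := gen_eqMixin (symmetric X).
HB.instance Definition _ (X : Type) := gen_choiceMixin (symmetric X).

Section Symmetric.
Variable X : Type.
Implicit Types f g : symmetric X.

Lemma sym_ext f g : sym_fun f =1 sym_fun g -> f = g.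
Proof.
case: f g => [f f' fK f'K] [g g' gK g'K] /= fg.
have {}fg : f = g by apply/funext.
rewrite {f}fg in fK f'K *.
have fg' : f' = g' by apply/funext => x; rewrite -{1}(g'K x) fK.
rewrite {f'}fg' in fK f'K *.
by congr Symmetric; apply: Prop_irrelevance.
Qed.

Definition sym_one := @Symmetric X id id (fun=> erefl) (fun=> erefl).
Definition sym_mul f g : symmetric X :=
  Symmetric (can_comp (sym_funK g) (sym_funK f)) (can_comp (sym_invK f) (sym_invK g)).
Definition sym_opp f : symmetric X := Symmetric (sym_invK f) (sym_funK f).

Fact sym_mulA : associative sym_mul. Proof. by move=> f g h; apply: sym_ext. Qed.
Fact sym_mul1 : left_id sym_one sym_mul. Proof. by move=> f; apply: sym_ext. Qed.
Fact sym_1mul : right_id sym_one sym_mul. Proof. by move=> f; apply: sym_ext. Qed.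
Fact sym_mulV : left_inverse sym_one sym_opp sym_mul.
Proof. by move=> f; apply: sym_ext => x /=; rewrite sym_invK. Qed.
Fact sym_Vmul : right_inverse sym_one sym_opp sym_mul.
Proof. by move=> f; apply: sym_ext => x /=; rewrite sym_funK. Qed.

HB.instance Definition _ := isGroup.Build (symmetric X)
  sym_mulA sym_mul1 sym_1mul sym_mulV sym_Vmul.

End Symmetric.

Lemma action_hom (G : groupType) (X : Type) (act : X -> G -> X) :
  (forall x, act x 1 = x) -> (forall x g h, act x (g * h) = act (act x g) h) ->
  exists s : {multiplicative G -> symmetric X},
    forall g x, sym_fun (s g) x = act x g.
Proof.
move=> act1 actM.
have K g : cancel (act^~ g) (act^~ g^-1) by move=> x; rewrite -actM mulgV act1.
have K' g : cancel (act^~ g^-1) (act^~ g) by move=> x; rewrite -actM mulVg act1.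
have sM : {morph (fun g => Symmetric (K g) (K' g)) : g h / g * h}.
  by move=> g h; apply: sym_ext => x; apply: actM.
by exists (hom_of sM).
Qed.

(* A system of left coset representatives, as an equivariant map. *)
Lemma equivariant_retraction (H A : groupType) (i : {multiplicative H -> A}) :
  injective i -> exists r : A -> H, forall a h, r (a * i h) = r a * h.
Proof.
move=> iI; pose c a := xget 1 [set b | exists h, b = a * i h].
have cP a : exists h, c a = a * i h.
  apply: (xgetPex 1 (P := [set b | exists h, b = a * i h])).
  by exists a, 1; rewrite hom1 mulg1.
have cE a h : c (a * i h) = c a.
  congr xget; apply/seteqP; split=> _ [k ->].
    by exists (h * k); rewrite homM mulgA.
  by exists (h^-1 * k); rewrite homM homV mulgA mulgK.
have /choice[r rP] a : exists h, c a * i h = a.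
  by have [h ->] := cP a; exists h^-1; rewrite homV mulgK.
exists r => a h; apply: iI; apply: (@mulgI _ (c a)).
by rewrite homM mulgA rP -{1}(cE a h) rP.
Qed.

(** * Alternating products of labels in finite q-groups *)

Section AlternatingProduct.
Variables (I : eqType) (T : groupType) (w : I -> T).

Definition alt_letter (b : bool) c : T := if b then (w c)^-1 else w c.

Fixpoint alt_prod (b : bool) (s : seq I) : T :=
  if s is c :: s' then alt_letter b c * alt_prod (~~ b) s' else 1.

Lemma alt_prod_rcons b s c :
  alt_prod b (rcons s c) = alt_prod b s * alt_letter (b (+) odd (size s)) c.
Proof.
elim: s b => [|d s IHs] b /=; first by rewrite mulg1 mul1g addbF.
by rewrite IHs mulgA addNb addbN.
Qed.

End AlternatingProduct.

Lemma p_group_exists (q : nat) : prime q ->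
  exists2 T : groupType, finite_p_group q T & exists t : T, t <> 1.
Proof.
move=> qp; exists 'Z_q; last first.
  by exists Zp1; case: q qp => [|[]].
have q1 := prime_gt1 qp.
split; first exact: finite_finset.
apply/P_groupP => x; exists q; first exact: pnat_id.
rewrite Zp_expg; apply/val_inj/eqP; rewrite /= -/(dvdn _ _).
by apply: dvdn_mull; rewrite Zp_cast.
Qed.

Lemma alt_prod_hom (I : eqType) (T U : groupType) (f : {multiplicative T -> U})
  (w : I -> T) b s : f (alt_prod w b s) = alt_prod (f \o w) b s.
Proof.
elim: s b => [|c s IHs] b /=; first by rewrite hom1.
by rewrite homM IHs; case: b => //=; rewrite homV.
Qed.

(* The partial products are kept distinct: if they are distinct for all prefixes
   of length at most n, then the last edge of the path that they follow in the
   Cayley graph occurs only once, and its indicator function, seen in a wreath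
   product, distinguishes the new end point from all previous points. *)
Lemma alternating_path (q : nat) (I : eqType) (s : seq I) : prime q ->
  sorted (fun c d => c != d) s ->
  exists2 T : groupType, finite_p_group q T & exists w : I -> T,
    forall i j, (i < j <= size s)%N ->
      alt_prod w false (take i s) <> alt_prod w false (take j s).
Proof.
move=> qp; have [Z qZ [zeta zeta1]] := p_group_exists qp.
elim/last_ind: s => [_|s d IHs].
  exists Z => //; exists (fun=> 1) => i j /andP[ij]; rewrite leqn0 => /eqP j0.
  by rewrite j0 in ij.
move=> sd; have [|T qT [w wP]] := IHs.
  by have := take_sorted (size s) sd; rewrite -cats1 take_size_cat.
set n := size s in wP *; set s' := rcons s d.
have sz : size s' = n.+1 by rewrite size_rcons.
pose c k := nth d s' k.
have cn : c n = d by rewrite /c nth_rcons ltnn eqxx.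
have ck k : (k < n)%N -> c k != c k.+1.
  by move=> kn; have /(sortedP d) := sd; apply; rewrite sz ltnS.
have step (U : groupType) (u : I -> U) k : (k <= n)%N ->
    alt_prod u false (take k.+1 s') =
    alt_prod u false (take k s') * alt_letter u (odd k) (c k).
  move=> kn; rewrite (take_nth d) ?sz // alt_prod_rcons size_take sz.
  by rewrite ltnS kn addFb.
pose v k := alt_prod w false (take k s').
have vP i j : (i < j <= n)%N -> v i <> v j.
  move=> /[dup] /andP[ij jn] /wP; rewrite /v /s' -cats1 !takel_cat //.
  by rewrite (leq_trans (ltnW ij)).
have vS k : (k <= n)%N -> v k.+1 = v k * alt_letter w (odd k) (c k).
  exact: step.
(* The origin of the k-th edge, read in the direction of its label: at odd places the letter is
   inverted and the edge is traversed backwards. *)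
pose start k := if odd k then v k.+1 else v k.
(* No earlier step uses the last edge: the earlier partial products are distinct, and consecutive
   labels differ, which excludes both orientations. *)
have startE k : (k < n)%N -> c k = d -> start k <> start n.
  move=> kn ckd; rewrite /start => e.
  have kn1 : k.+1 <> n by move=> e1; have := ck k kn; rewrite e1 cn ckd eqxx.
  have vk : v k <> v n by apply: vP; rewrite kn /=.
  have vk1 : v k.+1 <> v n.
    by apply: vP; rewrite leqnn andbT ltn_neqAle kn andbT; apply/eqP.
  move: e; case ok: (odd k); case on: (odd n) => e.
  - by move: e; rewrite !vS ?(ltnW kn) // ok on ckd cn => /mulIg.
  - exact: vk1.
  - by apply: vk1; rewrite vS ?(ltnW kn) // e vS // ok on ckd cn /= mulgVK.
  - exact: vk.
pose f e (t : T) : Z := if (e == d) && (t == start n) then zeta else 1.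
pose w2 e : wreath Z T := (f e, w e).
exists (wreath Z T); first exact: finite_p_group_wreath.
exists w2; pose v2 k := alt_prod w2 false (take k s').
have v22 k : (v2 k).2 = v k by rewrite -[LHS]/(wreath_snd Z T _) alt_prod_hom.
(* The base coordinate at 1 collects the values of f on the edges met, so it stays trivial until the
   last edge. *)
have v2S k : (k <= n)%N -> (v2 k.+1).1 1 =
    (v2 k).1 1 * (if odd k then (f (c k) (start k))^-1 else f (c k) (start k)).
  move=> kn; rewrite /v2 step // wreath_mulE -/(v2 k) mul1g v22 /start.
  by case ok: (odd k) => //=; rewrite vS // ok.
have v21 k : (k <= n)%N -> (v2 k).1 1 = 1.
  elim: k => [|k IHk] kn; first by rewrite /v2 take0.
  rewrite v2S ?(ltnW kn) // IHk ?(ltnW kn) // mul1g (_ : f _ _ = 1) ?invg1 ?if_same //.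
  rewrite /f; case: eqP => //= ckd; case: eqP => // e.
  by case: (startE k kn ckd).
move=> i j /andP[ij]; rewrite sz leq_eqVlt => /orP[/eqP jn|jn] e; last first.
  by apply: (vP i j); rewrite ?ij // -!v22 /v2 e.
have : (v2 j).1 1 = 1 by rewrite /v2 -e; apply: v21; rewrite -ltnS -jn.
rewrite jn v2S // v21 // mul1g /f cn !eqxx /=.
by case: (odd n) => //; rewrite -[RHS]invg1 => /invg_inj.
Qed.

Lemma alternating_product (q : nat) (I : eqType) (s : seq I) : prime q ->
  sorted (fun c d => c != d) s -> (0 < size s)%N ->
  exists2 T : groupType, finite_p_group q T & exists w : I -> T,
    alt_prod w false s <> 1.
Proof.
move=> qp sP s0; have [T qT [w wP]] := alternating_path qp sP.
exists T => //; exists w => e; apply: (wP 0%N (size s)); first by rewrite s0 /=.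
by rewrite take0 take_size e.
Qed.

(** * Amalgamated products *)

Section Amalgam.
Variables (H A B G : groupType)
    (iA : {multiplicative H -> A}) (iB : {multiplicative H -> B})
    (jA : {multiplicative A -> G}) (jB : {multiplicative B -> G}).
Hypothesis amalgG : is_amalgamated_product iA iB jA jB.

Let jH h : jA (iA h) = jB (iB h). Proof. by case: amalgG. Qed.
Let iAI : injective iA. Proof. by case: amalgG. Qed.
Let iBI : injective iB. Proof. by case: amalgG. Qed.

Lemma amalgam_lift (T : groupType)
    (f : {multiplicative A -> T}) (g : {multiplicative B -> T}) :
  (forall h, f (iA h) = g (iB h)) ->
  exists k : {multiplicative G -> T},
    (forall a, k (jA a) = f a) /\ (forall b, k (jB b) = g b).
Proof. by case: amalgG => _ _ _ univ /univ[k]; exists k. Qed.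

Lemma amalgam_hom_ext (T : groupType) (k l : {multiplicative G -> T}) :
  (forall a, k (jA a) = l (jA a)) -> (forall b, k (jB b) = l (jB b)) -> k =1 l.
Proof.
move=> klA klB; case: amalgG => _ _ _ /(_ T (hom_comp k jA) (hom_comp k jB))[].
  by move=> h; rewrite /= jH.
by move=> m _ muniq g; rewrite (muniq k) // (muniq l) // => x /=; rewrite ?klA ?klB.
Qed.

(** The factors generate G: the universal property gives a map from G to K, and uniqueness makes its
    composite with the inclusion the identity. *)
Lemma amalgam_ind (K : set G) : is_subgroup K ->
  (forall a, K (jA a)) -> (forall b, K (jB b)) -> forall g, K g.
Proof.
move=> sK KA KB; have [T [i [iI iK]]] := subgroup_exists sK.
have lift (X : groupType) (j : {multiplicative X -> G}) : (forall x, K (j x)) ->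
    exists f : {multiplicative X -> T}, forall x, i (f x) = j x.
  move=> Kj; have /choice[f fP] x : exists t, i t = j x.
    by have := Kj x; rewrite -iK => -[t _ <-]; exists t.
  have fM : {morph f : x y / x * y} by move=> x y; apply: iI; rewrite homM !fP homM.
  by exists (hom_of fM).
have [fA fAE] := lift A jA KA; have [fB fBE] := lift B jB KB.
have [|k [kA kB]] := amalgam_lift (f := fA) (g := fB).
  by move=> h; apply: iI; rewrite fAE fBE.
have idM : {morph (id : G -> G) : x y / x * y} by [].
move=> g; rewrite -[g]/(hom_of idM g) -iK; exists (k g) => //.
apply: (@amalgam_hom_ext _ (hom_comp i k) (hom_of idM)) => [a|b] /=.
  by rewrite kA fAE.
by rewrite kB fBE.
Qed.

(** G acts on the set A x B. An element of A multiplies the first coordinate on the right and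
    changes the second by the resulting change of [rA]; B acts symmetrically. Under both recipes an
    element of H multiplies both coordinates, so the actions agree on H. *)
Lemma amalgam_faithful : exists (F : groupType) (s : {multiplicative G -> F}),
  injective (s \o jA) /\ injective (s \o jB).
Proof.
have [rA rAE] := equivariant_retraction iAI.
have [rB rBE] := equivariant_retraction iBI.
pose actA (x : A * B) a := (x.1 * a, x.2 * iB ((rA x.1)^-1 * rA (x.1 * a))).
pose actB (x : A * B) b := (x.1 * iA ((rB x.2)^-1 * rB (x.2 * b)), x.2 * b).
have [||sA sAE] := @action_hom A _ actA.
- by move=> [a b]; rewrite /actA /= mulg1 mulVg hom1 mulg1.
- move=> [a b] u v; rewrite /actA /= mulgA; congr (_, _).
  by rewrite -[RHS]mulgA -homM -(mulgA (_)^-1 _ (_ * _)) mulVKg.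
have [||sB sBE] := @action_hom B _ actB.
- by move=> [a b]; rewrite /actB /= mulg1 mulVg hom1 mulg1.
- move=> [a b] u v; rewrite /actB /= mulgA; congr (_, _).
  by rewrite -[RHS]mulgA -homM -(mulgA (_)^-1 _ (_ * _)) mulVKg.
have [|k [kA kB]] := amalgam_lift (f := sA) (g := sB).
  move=> h; apply: sym_ext => -[a b]; rewrite sAE sBE /actA /actB /=.
  by rewrite rAE rBE !mulKg.
exists (symmetric (A * B)), k; split=> [a a'|b b'] /=.
  rewrite !kA => /(congr1 (fun s => sym_fun s (1, 1))).
  by rewrite !sAE /actA /= !mul1g => -[].
rewrite !kB => /(congr1 (fun s => sym_fun s (1, 1))).
by rewrite !sBE /actB /= !mul1g => -[].
Qed.

Lemma amalgam_injA : injective jA.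
Proof. by have [F [s [sI _]]] := amalgam_faithful; apply: inj_compr sI. Qed.

Fixpoint amalgam_word (l : seq (B * A)) : G :=
  if l is (b, a) :: l' then jB b * jA a * amalgam_word l' else 1.

(** U and V are the images of H or, for a quotient of G, the letters that fall into the image of H
    there. The last letter from A is unrestricted and may be 1. *)
Fixpoint reduced (U : set B) (V : set A) (l : seq (B * A)) : Prop :=
  if l is (b, a) :: l' then
    [/\ ~ U b, l' <> [::] -> ~ V a & reduced U V l'] else True.

(** The set N of such products is stable under left multiplication by A and by B, letters being
    merged when one falls into H. As N contains 1 and the factors generate G, it is everything. *)
Lemma amalgam_normal_form g : exists a l,
  g = jA a * amalgam_word l /\ reduced (range iB) (range iA) l.
Proof.
pose N := [set g | exists a l,
  g = jA a * amalgam_word l /\ reduced (range iB) (range iA) l].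
have NA a n : N n -> N (jA a * n).
  by move=> [a' [l [-> rl]]]; exists (a * a'), l; rewrite homM mulgA.
have NB b n : N n -> N (jB b * n).
  move=> [a [l [-> rl]]]; rewrite mulgA.
  have [[h _ hb]|bH] := pselect (range iB b).
    by exists (iA h * a), l; rewrite -hb homM jH.
  have [[h _ ha]|aH] := pselect (range iA a); last first.
    by exists 1, ((b, a) :: l); rewrite hom1 mul1g.
  case: l rl => [_|[b' a'] l /= [b'H a'H rl]].
    by exists 1, [:: (b, a)]; rewrite hom1 mul1g.
  have -> : jB b * jA a * (jB b' * jA a' * amalgam_word l) =
      jB (b * iB h * b') * jA a' * amalgam_word l.
    by rewrite -ha jH !homM !mulgA.
  have [[k _ hk]|kH] := pselect (range iB (b * iB h * b')).
    by exists (iA k * a'), l; rewrite -hk homM jH.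
  by exists 1, ((b * iB h * b', a') :: l); rewrite hom1 mul1g.
pose K := [set g | forall n, N n -> N (g * n) /\ N (g^-1 * n)].
have N1 : N 1 by exists 1, [::]; rewrite hom1 mulg1.
suff /(_ g 1 N1)[] : forall g, K g by rewrite mulg1.
apply: amalgam_ind => [|a n Nn|b n Nn].
- split=> [n Nn|x y Kx Ky n Nn|x Kx n Nn].
  + by rewrite invg1 !mul1g.
  + rewrite invgM -!mulgA; split.
      by apply: (Kx _ _).1; apply: (Ky _ _).1.
    by apply: (Ky _ _).2; apply: (Kx _ _).2.
  + by rewrite invgK; split; [apply: (Kx _ Nn).2|apply: (Kx _ Nn).1].
- by rewrite -homV; split; apply: NA.
- by rewrite -homV; split; apply: NB.
Qed.

(* A graph-of-cosets argument: the cosets of s(H) met by the path that the word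
   traces in F are the colours, and consecutive ones differ. *)
Lemma reduced_word_detected (F : groupType) (s : {multiplicative G -> F}) q a l :
  prime q -> l <> [::] ->
  reduced [set b | exists h, s (jB b) = s (jA (iA h))]
          [set a | exists h, s (jA a) = s (jA (iA h))] l ->
  exists (T : groupType) (t : {multiplicative G -> wreath T F}),
    [/\ finite_p_group q T, forall g, (t g).2 = s g,
        t (jA a * amalgam_word l) <> 1,
        forall a, s (jA a) = 1 -> t (jA a) = 1 &
        forall b, s (jB b) = 1 -> t (jB b) = 1].
Proof.
move=> qp l0 rl; pose sH h := s (jA (iA h)).
pose col x : set F := [set y | exists h, y = x * sH h].
have colE x h : col (x * sH h) = col x.
  apply/seteqP; split=> _ [k ->].
    by exists (h * k); rewrite /sH !homM mulgA.
  by exists (h^-1 * k); rewrite /sH !(homM, homV) mulgA mulgK.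
have colP x y : col x = col (x * y) -> exists h, y = sH h.
  move=> e; have : col (x * y) x by rewrite -e; exists 1; rewrite /sH !hom1 mulg1.
  move=> [h e']; exists h^-1; rewrite /sH !homV -/(sH h).
  by apply: (@mulgI _ x); rewrite {2}e' mulgK.
(* A letter of B contributes the colours at both ends of its step; letters of A contribute none, as
   their cocycle is trivial. *)
pose fix trace x (l : seq (B * A)) : seq (set F) :=
  if l is (b, a) :: l' then
    [:: col x, col (x * s (jB b)) & trace (x * s (jB b) * s (jA a)) l']
  else [::].
have tr_sorted x : sorted (fun c d => c != d) (trace x l).
  elim: l x rl {l0} => //= -[b a'] l IHl x [bU aV rl] /=.
  apply/andP; split; first by apply/eqP => /colP[h e]; apply: bU; exists h.
  have := IHl (x * s (jB b) * s (jA a')) rl; case: l aV {rl IHl} => //= -[b' a''] l aV.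
  move=> IHx; apply/andP; split; last exact: IHx.
  by apply/eqP => /colP[h e]; apply: aV => //; exists h.
have [|T qT [w ww]] := alternating_product qp (tr_sorted (s (jA a))).
  by case: l l0 {rl tr_sorted} => [|[]].
(* The trivial cocycle on A and the coboundary of [w \o col] on B agree on H because [col] is
   constant on the cosets of s(H). *)
have fAM : {morph (fun a => (fun=> 1, s (jA a)) : wreath T F) : x y / x * y}.
  move=> x y; congr (_, _); last by rewrite !homM.
  by apply/funext => z; rewrite /= mulg1.
have fBM : {morph (fun b => (fun z => w (col z) * (w (col (z * s (jB b))))^-1, s (jB b))
    : wreath T F) : x y / x * y}.
  move=> x y; congr (_, _); last by rewrite !homM.
  by apply/funext => z; rewrite /= !homM !mulgA mulgVK.
have [|t [tA tB]] := amalgam_lift (f := hom_of fAM) (g := hom_of fBM).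
  move=> h; congr (_, _); last by rewrite jH.
  by apply/funext => z; rewrite -jH colE mulgV.
have t2 g : (t g).2 = s g.
  apply: (@amalgam_hom_ext _ (hom_comp (wreath_snd T F) t) s) => x.
    by rewrite /= tA.
  by rewrite /= tB.
exists T, t; split=> //.
- suff tw x k : (t (amalgam_word k)).1 x = alt_prod w false (trace x k).
    move=> /wreath_eq1[_ /(_ 1)]; rewrite homM wreath_mulE t2 mul1g tw tA /= mul1g.
    exact: ww.
  elim: k x => [|[b a'] k IHk] x; first by rewrite hom1.
  rewrite !homM !wreath_mulE t2 tA tB /= mulg1 -!mulgA; congr (_ * (_ * _)).
  exact: IHk.
- by move=> a' sa; rewrite tA; apply/wreath_eq1.
- by move=> b sb; rewrite tB; apply/wreath_eq1; split=> //= z; rewrite sb mulg1 mulgV.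
Qed.

(** In a target that is faithful on both factors, letters outside H stay outside the image of H, so
    the word remains reduced and is detected. *)
Lemma reduced_word_neq1 a l : l <> [::] ->
  reduced (range iB) (range iA) l -> jA a * amalgam_word l <> 1.
Proof.
move=> l0 rl; have [F [s [sA sB]]] := amalgam_faithful.
have [|T [t [_ _ nt _ _]]] := @reduced_word_detected F s 2 a l isT l0.
  elim: l rl {l0} => //= -[b a'] l IHl [bU aV rl]; split; last exact: IHl.
    by move=> [h e]; apply: bU; exists h => //; apply: sB; rewrite /= -jH e.
  by move=> /aV aV' [h e]; apply: aV'; exists h => //; apply: sA; rewrite /= e.
by move=> e; apply: nt; rewrite e hom1.
Qed.

(** The constant cocycles f and g agree on the part of H killed by s. A function u on F that
    intertwines them over H turns g into a cohomologous cocycle on B which agrees with f on all of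
    H. *)
Lemma amalgam_glue (F T : groupType) (s : {multiplicative G -> F})
    (f : {multiplicative A -> T}) (g : {multiplicative B -> T}) :
  (forall h, s (jA (iA h)) = 1 -> f (iA h) = g (iB h)) ->
  exists t : {multiplicative G -> wreath T F},
    (forall a, t (jA a) = 1 <-> s (jA a) = 1 /\ f a = 1) /\
    (forall b, t (jB b) = 1 <-> s (jB b) = 1 /\ g b = 1).
Proof.
move=> fg; pose sH h := s (jA (iA h)).
pose r x := xget 1 [set y | exists h, x = y * sH h].
have rP x : exists h, x = r x * sH h.
  apply: (xgetPex 1 (P := [set y | exists h, x = y * sH h])).
  by exists x, 1; rewrite /sH !hom1 mulg1.
have rE x h : r (x * sH h) = r x.
  congr xget; apply/seteqP; split=> y [k e].
    by exists (k * h^-1); rewrite /sH !(homM, homV) mulgA -e mulgK.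
  by exists (k * h); rewrite e /sH !homM mulgA.
have /choice[c cP] := rP; pose u x := (f (iA (c x)))^-1 * g (iB (c x)).
have fgE h k : sH h = sH k -> (f (iA h))^-1 * g (iB h) = (f (iA k))^-1 * g (iB k).
  move=> e; have /fg : s (jA (iA (h * k^-1))) = 1.
    by rewrite !homM !homV -/(sH h) -/(sH k) e mulgV.
  rewrite !homM !homV => e'.
  apply: (@mulgI _ (f (iA h))); rewrite mulVKg mulgA.
  by rewrite e' mulgVK.
(* By this rule the cocycle twisted by u takes the value f (iA h) at iB h. *)
have uE x h : u (x * sH h) = (f (iA h))^-1 * u x * g (iB h).
  rewrite /u (fgE _ (c x * h)).
    by rewrite !homM invgM !mulgA.
  have -> : sH (c x * h) = sH (c x) * sH h by rewrite /sH !homM.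
  have e1 := cP (x * sH h); have e2 := cP x; rewrite rE in e1.
  by apply: (@mulgI _ (r x)); rewrite -e1 mulgA -e2.
clearbody u.
have fAM : {morph (fun a => (fun=> f a, s (jA a)) : wreath T F) : x y / x * y}.
  by move=> x y; congr (_, _); [apply/funext => z|]; rewrite /= !homM.
have fBM : {morph (fun b => (fun z => u z * g b * (u (z * s (jB b)))^-1, s (jB b))
    : wreath T F) : x y / x * y}.
  move=> x y; congr (_, _); last by rewrite !homM.
  by apply/funext => z; rewrite /= !homM !mulgA mulgVK.
have [|t [tA tB]] := amalgam_lift (f := hom_of fAM) (g := hom_of fBM).
  move=> h; congr (_, _); last by rewrite jH.
  apply/funext => z; rewrite /= -jH -/(sH h) uE !invgM invgK !mulgA.
  by rewrite mulgK mulgV mul1g.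
exists t; split=> [a|b]; rewrite ?tA ?tB; split=> [/wreath_eq1[/= s1]|[s1 f1]].
- by move=> /(_ 1).
- by apply/wreath_eq1.
- move=> /(_ 1); rewrite s1 mulg1 => e; split=> //.
  by apply: (@mulgI _ (u 1)); apply: (@mulIg _ (u 1)^-1); rewrite e mulg1 mulgV.
- by apply/wreath_eq1; split=> //= z; rewrite s1 f1 !mulg1 mulgV.
Qed.

End Amalgam.

(** * Condition S *)

(** Applied to the finite p-group X / R, [monolith] keeps z nontrivial and makes a p'-power of z
    central. Since the p-th power of z is trivial there, z itself is central. *)
Lemma central_mod_normal (X : groupType) p (R : set X) (z : X) : prime p ->
  pfin p R -> ~ R z -> R (z ^+ p) ->
  exists U : set X, [/\ pfin p U, R `<=` U, ~ U z & forall y, U [~ z, y]].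
Proof.
move=> pp pR nRz Rzp; have [Y [t [pY tS tR]]] := pfin_quotient pR.
have tz m : p^'.-nat m -> ~ [set 1] (t z ^+ m).
  by move=> p'm; rewrite -homX => /tR; move/(pfin_root pR p'm).
have [U [s [sS _ sz _ [m p'm cm]]]] :=
  monolith pp (p_group_nilpotent pp pY) (trivial_normal Y) tz.
pose st := hom_comp s t; have st1 x : R x -> st x = 1.
  by move=> /tR /= ->; rewrite hom1.
exists [set x | st x = 1]; split.
- apply: pfin_sub pR _; first exact: ker_normal.
  by move=> x /st1.
- by move=> x /st1.
- by move=> e; apply: sz; rewrite [s _]e; apply: torsion1.
- move=> y; apply: etrans (homR st z y) _; apply/eqP/commgP.
  apply: (@subgroup_coprime _ [set u | central u] (s (t z)) p m) => //.
  + split=> [u|u v cu cv w|u cu w] /=.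
    * exact/commute_sym/commute1.
    * by apply/commute_sym/commuteM; apply/commute_sym.
    * by apply/commute_sym/commuteV/commute_sym.
  + by rewrite prime_coprime // -p'natE.
  + exact: prime_gt0.
  + by move=> w; rewrite -!homX [s _]st1 //; apply/commute_sym/commute1.
Qed.

(** The image of K is a subgroup of prime order p in a finite group, and Cauchy's theorem supplies a
    generator. *)
Lemma prime_image_cyclic (X Y : groupType) (s : {multiplicative X -> Y})
  (K : set X) p : prime p -> finite_group Y -> is_subgroup K ->
  s @` K #= `I_p ->
  exists z, [/\ K z, s z <> 1, s z ^+ p = 1 &
    forall x, K x -> exists k : nat, s x = s z ^+ k].
Proof.
move=> pp fY sK cK; have [gT [f fB]] := finite_groupE fY.
pose D : {set gT} := finset (fun y => `[< ((f \o s) @` K) y >]).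
have DP y : y \in D <-> ((f \o s) @` K) y.
  by rewrite finset.inE; split=> /asboolP.
have gD : group_set D.
  apply/group_setP; split.
    by apply/DP; exists 1; [exact: sg1|rewrite /= !hom1].
  move=> _ _ /DP[x Kx <-] /DP[y Ky <-]; apply/DP.
  by exists (x * y); [exact: sgM|rewrite /= !homM].
have cD : #|D| = p.
  apply/card_eq_II; apply: card_eq_trans card_II _.
  have fI : {in s @` K &, injective f} by move=> x y _ _; exact: (bij_inj fB).
  apply: card_eq_trans (card_eq_trans (inj_card_eq fI) cK).
  have -> : f @` (s @` K) = (@enum_val _ D) @` [set: 'I_#|D|].
    rewrite image_comp; apply/seteqP; split=> y.
      by move=> /DP yD; exists (enum_rank_in yD y) => //; apply: enum_rankK_in.
    by move=> [j _ <-]; apply/DP; apply: enum_valP.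
  by apply/card_esym/inj_card_eq => j k _ _; apply: enum_val_inj.
have [x Dx ox] : {x | x \in fingroup.Group gD & #[x] = p} by apply: Cauchy; rewrite //= cD.
have Dcycle : <[x]> = D.
  apply/eqP; rewrite eqEcard; apply/andP; split; last by rewrite cD -ox.
  by have := cycle_subG x (fingroup.Group gD) => /= ->.
have [z Kz zx] := (DP x).1 Dx; have fI := bij_inj fB; exists z; split=> //.
- move=> sz; move: zx; rewrite /= sz hom1 => x1.
  by move: ox; rewrite -x1 order1 => p1; rewrite -p1 in pp.
- by apply: (inj_hom1 fI); rewrite homX [f _]zx -ox expg_order.
- move=> y Ky; have /cycleP[k yk] : f (s y) \in <[x]>.
    by rewrite Dcycle; apply/DP; exists y.
  by exists k; apply: fI; rewrite homX [f (s z)]zx.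
Qed.

(** * Finite p-quotients of G from the series of S(p) *)

Section Steps.
Variables (H A B G : groupType)
    (iA : {multiplicative H -> A}) (iB : {multiplicative H -> B})
    (jA : {multiplicative A -> G}) (jB : {multiplicative B -> G}).
Hypothesis amalgG : is_amalgamated_product iA iB jA jB.
Variable p : nat.
Hypothesis pp : prime p.

(* Modulo suitable U >= R and V >= S the image of z is central, so A / U and
   B / V have a central product amalgamating <z>, to which [amalgam_glue]
   applies. *)
Lemma amalgam_p_step (F : groupType) (s : {multiplicative G -> F})
    (R : set A) (S : set B) (z : H) :
  finite_p_group p F -> pfin p R -> pfin p S ->
  (forall h, R (iA h) <-> S (iB h)) -> ~ R (iA z) -> R (iA z ^+ p) ->
  s (jA (iA z)) = 1 -> (forall h, R (iA h) -> s (jA (iA h)) = 1) ->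
  (forall h, s (jA (iA h)) = 1 -> exists k : nat, R ((iA z ^+ k)^-1 * iA h)) ->
  exists (F' : groupType) (t : {multiplicative G -> F'}),
    finite_p_group p F' /\ forall h, t (jA (iA h)) = 1 <-> R (iA h).
Proof.
move=> pF pR pS RS nRz Rzp sz Rs sR.
have [U [pU RU nUz Uz]] := central_mod_normal pp pR nRz Rzp.
have [||V [pV SV nVz Vz]] := central_mod_normal (z := iB z) pp pS.
- by move/RS.
- by rewrite -homX; apply/RS; rewrite homX.
have [YA [a [pYA aS aU]]] := pfin_quotient pU.
have [YB [b [pYB bS bV]]] := pfin_quotient pV.
pose L := [set h | s (jA (iA h)) = 1].
(* On the kernel L of H -> F, h is congruent to the same power of z modulo R and modulo S. *)
have aL h : L h -> exists k : nat, [/\ a (iA h) = a (iA z ^+ k),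
    b (iB h) = b (iB z ^+ k) & (p %| k)%N -> R (iA h)].
  move=> /sR[k Rk]; exists k; split.
  - by apply/esym/hom_eq/aU/RU.
  - by apply/esym/hom_eq/bV/SV; rewrite -homX -homV -homM; apply/RS; rewrite homM homV homX.
  - case/dvdnP=> l kE; rewrite -[iA h](mulVKg (iA z ^+ k)).
    apply: sgM (pfin_normal pR).1 _ Rk.
    by rewrite kE mulnC expgnA; apply: sgX (pfin_normal pR).1 Rzp.
have pk (X : groupType) (K : set X) x k :
    pfin p K -> ~ K x -> K (x ^+ k) -> (p %| k)%N.
  move=> pK nKx Kxk; apply: contraT => npk; exfalso; apply: nKx.
  by apply: pfin_root pK _ Kxk; rewrite p'natE.
(* If a kills z^k, then p divides k because z is outside U, and so h is in R. *)
have kerA h : L h -> a (iA h) = 1 -> R (iA h).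
  by move=> /aL[k [-> _ Rh]] /aU /(pk _ _ _ _ pU nUz)/Rh.
have kerB h : L h -> b (iB h) = 1 -> R (iA h).
  by move=> /aL[k [_ -> Rh]] /bV /(pk _ _ _ _ pV nVz)/Rh.
have cA h : L h -> central (a (iA h)).
  move=> /aL[k [-> _ _]] y; have [x _ <-] : range a y by rewrite aS.
  rewrite homX; apply/commute_sym/commuteX/commute_sym/commgP/eqP.
  by rewrite -homR; apply/aU.
have cB h : L h -> central (b (iB h)).
  move=> /aL[k [_ -> _]] y; have [x _ <-] : range b y by rewrite bS.
  rewrite homX; apply/commute_sym/commuteX/commute_sym/commgP/eqP.
  by rewrite -homR; apply/bV.
have sgL : is_subgroup L := preim_subgroup (hom_comp s (hom_comp jA iA)) (trivial_normal F).1.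
(* The antidiagonal copy of L is central; dividing by it gives the central product of YA and YB in
   which the two images of L are identified. *)
pose W := [set w : (YA * YB)%type | exists2 h, L h & w = (a (iA h), (b (iB h))^-1)].
have nW : is_normal_subgroup W.
  split; first split.
  - by exists 1; [exact: sg1|rewrite !hom1 invg1].
  - move=> _ _ [h Lh ->] [k Lk ->]; exists (h * k); first exact: sgM.
    rewrite !homM; congr (_, _); rewrite /= -invgM; congr (_^-1).
    exact: cB.
  - move=> _ [h Lh ->]; exists h^-1; first exact: sgV.
    by rewrite !homV.
  - move=> _ [u v] [h Lh ->]; exists h => //.
    have cE (Y : groupType) (x y : Y) : central x -> x ^ y = x.
      by move=> cx; rewrite /conjg cx mulKg.
    congr (_, _); first exact: cE (cA h Lh).
    by apply: etrans (conjVg _ _) _; congr (_^-1); apply: cE (cB h Lh).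
have [T [c [cS cW]]] := quotient_exists nW.
have pT : finite_p_group p T.
  exact: finite_p_group_range cS (finite_p_group_prod pYA pYB).
have fM : {morph (fun x => c (a x, 1)) : x y / x * y}.
  by move=> x y; rewrite -homM homM; congr (c (_, _)); rewrite /= mulg1.
have gM : {morph (fun x => c (1, b x)) : x y / x * y}.
  by move=> x y; rewrite -homM homM; congr (c (_, _)); rewrite /= mulg1.
have [|t [tA tB]] := amalgam_glue amalgG (s := s) (f := hom_of fM) (g := hom_of gM).
  move=> h Lh; suff : c (a (iA h), 1) = c (1, b (iB h)) by [].
  apply/esym/hom_eq/cW; exists h => //.
  by congr (_, _); rewrite /= ?invg1 ?mul1g ?mulg1.
exists (wreath T F), t; split; first exact: finite_p_group_wreath.
move=> h; split=> [/tA[Lh /cW[k Lk [e1 e2]]]|Rh].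
  apply: kerA => //; rewrite e1; apply/aU/RU/kerB => //.
  by rewrite -[b _]invgK -e2 invg1.
apply/tA; split; first exact: Rs.
rewrite /=; have -> : a (iA h) = 1 by apply/aU/RU.
by rewrite [X in c X](_ : _ = 1) ?hom1.
Qed.

Hypothesis perH : periodic H.
Hypothesis torE : isolator p [set 1] = [set h : H | torsion p h].

Lemma p_part (h : H) : exists2 y, torsion p y & torsion p^' (y^-1 * h).
Proof.
have [n [n0 hn _]] := perH h.
by have [y [z [ty tz ->]]] := torsion_split p n0 hn; exists y; rewrite ?mulKg.
Qed.

(** The p'-part of h lies in every M of finite p-index, so M sees h only through its p-part y. In
    this way conditions on H(p) control all of H. *)
Lemma pfin_p_part (X : groupType) (i : {multiplicative H -> X}) (M : set X)
    (Q : set H) y h :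
  pfin p M -> i @^-1` M `&` isolator p [set 1] = Q ->
  torsion p y -> torsion p^' (y^-1 * h) ->
  (M (i h) <-> Q y) /\ M ((i y)^-1 * i h).
Proof.
move=> pM QE ty tz; have sM := (pfin_normal pM).1.
have Mz : M ((i y)^-1 * i h).
  by rewrite -homV -homM; apply: pfin_torsion pM (torsion_hom i tz).
split=> //; rewrite -QE torE; split=> [My|[My _]].
  by split=> //; apply: (sgVE sM); apply: sgMr sM My Mz.
by rewrite -[i h](mulVKg (i y)); apply: sgM.
Qed.

(** Start with the trivial quotient at R n = A and descend. Each [amalgam_p_step] cuts the kernel on
    H from R (j+1) to R j; at R 0, which meets H(p) trivially, exactly the p'-elements of H
    remain. *)
Lemma condition_S_hom : condition_S iA iB p ->
  exists (F : groupType) (s : {multiplicative G -> F}),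
    finite_p_group p F /\ forall h, s (jA (iA h)) = 1 <-> torsion p^' h.
Proof.
move=> [n [Q [R [S [[Q0 Qn Rn Sn] QRS norm idx]]]]].
have pR i : (i <= n)%N -> pfin p (R i) by case/norm=> _ ? *; apply/pfin_index.
have pS i : (i <= n)%N -> pfin p (S i) by case/norm=> _ _ ? *; apply/pfin_index.
suff : forall k, (k <= n)%N -> exists (F : groupType) (s : {multiplicative G -> F}),
    finite_p_group p F /\ forall h, s (jA (iA h)) = 1 <-> R (n - k)%N (iA h).
  move=> /(_ n (leqnn n)); rewrite subnn => -[F [s [pF sR]]].
  exists F, s; split=> // h; rewrite sR; split=> [Rh|th]; last first.
    by apply: pfin_torsion (pR 0%N isT) _; apply: torsion_hom.
  have [_ _ _ Q0E _] := norm 0%N isT.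
  have [y ty tz] := p_part h.
  have [RQ _] := pfin_p_part (pR 0%N isT) Q0E ty tz.
  have : Q 0%N y by apply/RQ.
  by rewrite Q0 => /= y1; rewrite y1 invg1 mul1g in tz.
elim=> [_|k IHk kn].
  have [F [s [pF sE]]] := pfin_full G p; exists F, s; split=> // h.
  by rewrite subn0 Rn sE.
have [F [s [pF sR]]] := IHk (ltnW kn).
set j := (n - k.+1)%N; have jE : (n - k)%N = j.+1 by rewrite /j subnSK.
rewrite {}jE in sR.
have jn : (j < n)%N by rewrite /j ltn_subrL /= (leq_ltn_trans _ kn).
have [sQ1 _ _ QR1 QS1] := norm j.+1 jn.
have [sQ _ _ QR QS] := norm j (ltnW jn).
have [QQ RR _] := QRS j jn.
have [Y [t [[fY pY] tS tR]]] := pfin_quotient (pR j (ltnW jn)).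
pose ti := hom_comp t iA.
have cQ : ti @` Q j.+1 #= `I_p.
  apply: card_eq_trans (card_esym _) (idx j jn).
  apply: card_cosets sQ _ => x y Qx Qy; rewrite -hom_eq -QR /= tR.
  split=> [[]|Rxy] //; split=> //.
  have : Q j.+1 (x^-1 * y) by apply: sgM => //; apply: sgV.
  by rewrite -QR1 => -[].
have [z [Qz tz1 tzp zgen]] := prime_image_cyclic pp fY sQ1 cQ.
apply: (amalgam_p_step (R := R j) (S := S j) (z := z) pF).
- exact: pR (ltnW jn).
- exact: pS (ltnW jn).
- move=> h; have [y ty tz] := p_part h.
  have [RQ _] := pfin_p_part (pR j (ltnW jn)) QR ty tz.
  have [SQ _] := pfin_p_part (pS j (ltnW jn)) QS ty tz.
  by rewrite RQ SQ.
- by move=> /tR.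
- by apply/tR; rewrite homX.
- by apply/sR; move: Qz; rewrite -QR1 => -[].
- by move=> h Rh; apply/sR/RR.
- move=> h /sR Rh.
  have [y ty tz] := p_part h.
  have [RQ _] := pfin_p_part (pR j.+1 jn) QR1 ty tz.
  have [_ Ry] := pfin_p_part (pR j (ltnW jn)) QR ty tz.
  have [k' tk] := zgen y (RQ.1 Rh); exists k'.
  move/tR/hom_eq: Ry => Ry; apply/tR/hom_eq; rewrite -Ry homX.
  exact: esym tk.
Qed.

(* Once the kernels meet the images of H in the p'-elements only, [amalgam_glue]
   applies to arbitrary finite p-quotients of A and B. *)
Lemma condition_S_separate (M : set A) (N : set B) :
  condition_S iA iB p -> pfin p M -> pfin p N ->
  exists (F : groupType) (s : {multiplicative G -> F}),
    [/\ finite_p_group p F, forall a, s (jA a) = 1 -> M a &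
        forall b, s (jB b) = 1 -> N b].
Proof.
move=> /condition_S_hom[F [s [pF sE]]] pM pN.
have [YA [a [pYA aS aM]]] := pfin_quotient pM.
have [YB [b [pYB bS bN]]] := pfin_quotient pN.
have fM : {morph (fun x => (a x, 1) : (YA * YB)%type) : x y / x * y}.
  by move=> x y; congr (_, _); rewrite /= ?homM ?mulg1.
have gM : {morph (fun x => (1, b x) : (YA * YB)%type) : x y / x * y}.
  by move=> x y; congr (_, _); rewrite /= ?homM ?mulg1.
have [|t [tA tB]] := amalgam_glue amalgG (s := s) (f := hom_of fM) (g := hom_of gM).
  move=> h /sE th; congr (_, _); [apply/aM|apply/esym/bN].
    exact: pfin_torsion pM (torsion_hom iA th).
  exact: pfin_torsion pN (torsion_hom iB th).
exists (wreath (YA * YB)%type F), t; split.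
- by apply: finite_p_group_wreath => //; apply: finite_p_group_prod.
- by move=> x /tA[_ []] /aM.
- by move=> x /tB[_ []] /bN.
Qed.

End Steps.

Lemma expg_prime_inj (X : groupType) p (u : X) a b : prime p -> u <> 1 ->
  u ^+ p = 1 -> (a < p)%N -> (b < p)%N -> u ^+ a = u ^+ b -> a = b.
Proof.
move=> pp u1 up; have ou m : u ^+ m = 1 -> (p %| m)%N.
  move=> um; apply: contraT => pm; exfalso; apply: u1.
  apply: (@subgroup_coprime _ [set 1] u p m) => //=.
  - exact: (trivial_normal X).1.
  - by rewrite prime_coprime.
  - exact: prime_gt0.
wlog ab : a b / (a <= b)%N.
  by move=> h ap bp e; case: (leqP a b) => [/h|/ltnW/h]; [apply|move=> -> //].
move=> _ bp e; have /ou : u ^+ (b - a) = 1 by rewrite expgnFr // e mulgV.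
case: (posnP (b - a)%N) => [/eqP|ba0 /(dvdn_leq ba0)].
  by rewrite subn_eq0 => ba _; apply/eqP; rewrite eqn_leq ab.
by rewrite leqNgt (leq_ltn_trans (leq_subr _ _) bp).
Qed.

Lemma expg_prime_gen (X : groupType) p (u : X) k j : prime p -> u ^+ p = 1 ->
  u ^+ k <> 1 -> exists c : nat, u ^+ j = u ^+ k ^+ c.
Proof.
move=> pp up uk; have k0 : (0 < k)%N by case: k uk.
have pk : ~~ (p %| k)%N.
  by apply/negP => /dvdnP[l kE]; apply: uk; rewrite kE mulnC expgnA up expg1n.
have [c d e _] := egcdnP p k0; move: e.
rewrite (eqP (_ : coprime k p)); last by rewrite coprime_sym prime_coprime.
rewrite addn1 => e; exists (c * j)%N.
by rewrite -expgnA mulnA [(k * c)%N]mulnC e mulSn expgnDr mulnAC mulnC expgnA up expg1n mulg1.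
Qed.

(** * The series of S(p) from a finite p-quotient of G *)

Section BuildS.
Variables (H A B G : groupType)
    (iA : {multiplicative H -> A}) (iB : {multiplicative H -> B})
    (jA : {multiplicative A -> G}) (jB : {multiplicative B -> G}).
Hypothesis jH : forall h, jA (iA h) = jB (iB h).
Variable p : nat.
Hypothesis pp : prime p.
Let Hp : set H := isolator p [set 1].
Hypothesis sHp : is_subgroup Hp.

Definition trace_on_Hp (C : set G) : set H := (hom_comp jA iA) @^-1` C `&` Hp.

Lemma trace_on_HpE C h : trace_on_Hp C h <-> C (jA (iA h)) /\ Hp h.
Proof. by []. Qed.

Lemma trace_on_Hp_subgroup C : is_subgroup C -> is_subgroup (trace_on_Hp C).
Proof.
move=> sC; have := preim_subgroup (hom_comp jA iA) sC => sC'; split.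
- by split; apply: sg1.
- by move=> x y [Cx Hx] [Cy Hy]; split; [apply: (sgM sC')|apply: (sgM sHp)].
- by move=> x [Cx Hx]; split; [apply: (sgV sC')|apply: (sgV sHp)].
Qed.

(** A nontrivial finite p-group has a central element u of order p; the preimage of the subgroup
    generated by u is the next normal subgroup above C. *)
Lemma minimal_normal_above (C : set G) g : pfin p C -> ~ C g ->
  exists (Y : groupType) (s : {multiplicative G -> Y}) (u : Y),
  [/\ forall x, s x = 1 <-> C x, u <> 1, u ^+ p = 1, exists x, s x = u &
      is_normal_subgroup [set x | exists k : nat, s x = u ^+ k]].
Proof.
move=> pC nCg; have [Y [s [pY sS sC]]] := pfin_quotient pC.
have sg : s g <> 1 by move/sC.
have [v cv v1] : exists2 v : Y, central v & v <> 1.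
  have nY := p_group_nilpotent pp pY.
  have idM : {morph (id : Y -> Y) : x y / x * y} by [].
  apply: (nilpotent_center (s := hom_of idM) nY _ sg).
  by apply/seteqP; split=> // y _; exists y.
have [_ /P_groupP /(_ v) /torsionP[n on pn]] := pY; have [n0 vn nmin] := on.
have n1 : (1 < n)%N.
  by rewrite ltn_neqAle n0 andbT; apply/eqP => n1; apply: v1; rewrite -vn -n1.
have pdn : (p %| n)%N.
  have [[|k] nE] := p_natP pn; first by rewrite nE in n1.
  by rewrite nE expnS dvdn_mulr.
pose u := v ^+ (n %/ p); exists Y, s, u.
have up : u ^+ p = 1 by rewrite -expgnA divnK.
have u1 : u <> 1.
  apply: nmin; rewrite divn_gt0 ?prime_gt0 // dvdn_leq //=.
  by rewrite ltn_Pdiv // prime_gt1.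
have cu k : central (u ^+ k).
  by move=> y; rewrite -expgnA; apply/commute_sym/commuteX/commute_sym/cv.
split=> //; first by have [x _ xu] : range s u by [rewrite sS]; exists x.
split; first split.
- by exists 0%N; rewrite hom1.
- by move=> x y [k xk] [l yl]; exists (k + l)%N; rewrite homM xk yl expgnDr.
- move=> x [k xk]; exists (k * p.-1)%N; rewrite homV xk.
  apply: (@mulgI _ (u ^+ k)); rewrite mulgV -expgnDr -mulnS prednK ?prime_gt0 //.
  by rewrite mulnC expgnA up expg1n.
- by move=> x y [k xk]; exists k; rewrite homJ xk /conjg cu mulKg.
Qed.

(** Climb a chief series from C to G. A link where the trace on H(p) does not grow is omitted;
    elsewhere the trace grows by index p. The inclusions at index 0 allow a new link to be put in
    front. *)
Lemma condition_S_above (C : set G) : pfin p C ->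
  exists (n : nat) (Q : nat -> set H) (R : nat -> set A) (S : nat -> set B),
    [/\ [/\ Q 0 = trace_on_Hp C, jA @^-1` C `<=` R 0 & jB @^-1` C `<=` S 0],
        [/\ Q n = Hp, R n = [set: A] & S n = [set: B]],
        forall j, (j < n)%N ->
          [/\ Q j `<=` Q j.+1, R j `<=` R j.+1 & S j `<=` S j.+1],
        forall i, (i <= n)%N ->
          [/\ is_subgroup (Q i),
              is_normal_subgroup (R i) /\ finite_P_index p (R i),
              is_normal_subgroup (S i) /\ finite_P_index p (S i),
              iA @^-1` R i `&` Hp = Q i & iB @^-1` S i `&` Hp = Q i] &
        forall j, (j < n)%N -> has_index (Q j.+1) (Q j) p].
Proof.
move=> pC; have [l lP] : exists l : seq G, forall x, exists2 y, y \in l & C (y^-1 * x).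
  have [Y [s [[/finite_seqP[l lE] _] sS sC]]] := pfin_quotient pC.
  have /choice[g gP] (y : Y) : exists x, s x = y.
    by have [x _ <-] : range s y by [rewrite sS]; exists x.
  exists (map g l) => x; exists (g (s x)); last by apply/sC/hom_eq; rewrite gP.
  by apply: map_f; have : [set: Y] (s x) by []; rewrite lE.
have [m] := ubnP (count (fun y => ~~ `[< C y >]) l).
elim: m C pC lP => // m IHm C pC lP; rewrite ltnS => Cm.
have nC := pfin_normal pC.
have [CT|/existsNP[g nCg]] := pselect (forall g, C g).
  exists 0%N, (fun=> Hp), (fun=> [set: A]), (fun=> [set: B]); split=> //.
  - by split=> //; apply/seteqP; split=> h; [split|case].
  - by move=> i _; split=> //; try (by rewrite -pfin_index //; apply: pfin_full);
      apply/seteqP; split=> h //; case.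
have [Y [s [u [sC u1 up [g0 sg0] nU]]]] := minimal_normal_above pC nCg.
set U := [set x | exists k : nat, s x = u ^+ k] in nU.
have CU : C `<=` U by move=> x /sC sx; exists 0%N; rewrite sx.
have pU : pfin p U := pfin_sub nU pC CU.
have [||n [Q [R [S [[Q0 R0 S0] top inc norm idx]]]]] := IHm U pU.
- by move=> x; have [y yl Cyx] := lP x; exists y => //; apply: CU.
(* The induction counts listed representatives outside C. The one of g0, which maps to u, lies in U
   but not in C, so the count drops. *)
- apply: leq_trans Cm; have [y yl Cy] := lP g0.
  have Uy : U y.
    by exists 1%N; rewrite -sg0; apply/hom_eq/sC.
  have nCy : ~ C y by move=> /sC sy; apply: u1; rewrite -sg0 -sy; apply/esym/hom_eq/sC.
  have sub z : ~~ `[< U z >] -> ~~ `[< C z >].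
    by apply: contraNN => /asboolP Cz; apply/asboolP/CU.
  elim: l yl {lP IHm} => //= z l IHl; rewrite inE => /predU1P[<-|/IHl h].
    rewrite (asboolT Uy) (asboolF nCy) /= add0n add1n ltnS.
    exact: sub_count.
  by rewrite -addnS leq_add //; case: `[< U z >] (sub z) => //= ->.
have tU := trace_on_Hp_subgroup nU.1; have tC := trace_on_Hp_subgroup nC.1.
have [QE|/existsNP[h0 /not_implyP[[Uh0 Hh0] nh0]]] :=
    pselect (forall h, trace_on_Hp U h -> trace_on_Hp C h).
  exists n, Q, R, S; split=> //; split.
  - rewrite Q0; apply/seteqP; split=> h; first exact: QE.
    by case=> Ch Hh; split=> //; apply: CU.
  - by move=> a Ca; apply: R0; apply: CU.
  - by move=> b Cb; apply: S0; apply: CU.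
pose shift T (X0 : T) X k := if k is k'.+1 then X k' else X0 : T.
exists n.+1, (shift _ (trace_on_Hp C) Q), (shift _ (jA @^-1` C) R),
  (shift _ (jB @^-1` C) S); split=> //; first by split.
- case=> [_|j jn]; last exact: inc.
  split; [|by move=> a Ca; apply/R0/CU|by move=> b Cb; apply/S0/CU]; rewrite /= Q0 => h.
  by move=> /trace_on_HpE[Ch Hh]; apply/trace_on_HpE; split=> //; apply: CU.
- case=> [_|j jn]; last exact: norm.
  split=> //=.
  + exact/pfin_index/(pfin_preim jA).
  + exact/pfin_index/(pfin_preim jB).
  + by apply/seteqP; split=> h []; split=> //; move: a; rewrite /= jH.
- case=> [_|j jn]; last exact: idx.
  rewrite /= Q0 /has_index.
  pose si := hom_comp s (hom_comp jA iA).
  apply: card_eq_trans (card_cosets (s := si) tC _) _.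
    move=> x y [Ux Hx] [Uy Hy]; rewrite -hom_eq.
    split=> [[/sC//]|e]; split; first exact/sC.
    by apply: (sgM sHp) => //; apply: (sgV sHp).
  have [k0 uk0] : exists k : nat, si h0 = u ^+ k by [].
  have uk1 : u ^+ k0 <> 1.
    by rewrite -uk0 => e; apply: nh0; split=> //; apply/sC.
  (* As h0 is in the trace of U but not in that of C, its image generates the powers of u, and the
     trace has p classes. *)
  have -> : si @` trace_on_Hp U = (fun k => u ^+ k) @` `I_p.
    apply/seteqP; split=> [_ [x [[k xk] _] <-]|_ [k _ <-]].
      exists (k %% p)%N; first by rewrite /= ltn_mod prime_gt0.
      rewrite [RHS]xk {2}(divn_eq k p) expgnDr mulnC expgnA up expg1n mul1g //.
    have [c ->] := expg_prime_gen k pp up uk1.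
    exists (h0 ^+ c); last by rewrite homX uk0.
    exact: sgX tU _.
  apply: inj_card_eq => a b; rewrite !inE /= => ap bp.
  exact: expg_prime_inj pp u1 up ap bp.
Qed.

Hypothesis finHp : finite_set Hp.

(** H(p) is finite, so finitely many p-quotients combine into one whose kernel C meets H(p)
    trivially; the series above C then starts at 1. *)
Lemma condition_S_of_residual :
  (forall h, Hp h -> h <> 1 -> exists2 M, pfin p M & ~ M (jA (iA h))) ->
  condition_S iA iB p.
Proof.
move=> res; have [l lE] := (finite_seqP _).1 finHp.
have lP h : Hp h <-> h \in l by rewrite lE.
have /choice[M MP] h : exists M, h \in l -> pfin p M /\ (h <> 1 -> ~ M (jA (iA h))).
  have [hl|hl] := boolP (h \in l); last by exists setT.
  have [->|/eqP h1] := eqVneq h 1; first by exists setT; split=> //; apply: pfin_full.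
  by have [|M pM nM] := res h _ h1; [apply/lP|exists M].
have [|C pC CM] := @pfin_bigcap _ p _ l M; first by move=> h /MP[].
have [n [Q [R [S [[Q0 _ _] [Qn Rn Sn] inc norm idx]]]]] := condition_S_above pC.
exists n, Q, R, S; split=> //; split=> //; rewrite Q0.
apply/seteqP; split=> h /=; last first.
  by move=> ->; apply/trace_on_HpE; rewrite !hom1; split; [apply: sg1 (pfin_normal pC).1|apply: sg1].
move=> [Ch /lP hl]; apply: contrapT => h1.
by have [_ nM] := MP h hl; apply: (nM h1); apply: CM.
Qed.

End BuildS.

(** * Freeness of kernels *)

Section Forest.
Variables (G F : groupType) (s : {multiplicative G -> F}) (K : bool -> set G).
Hypothesis finF : finite_group F.
Hypothesis sS : range s = [set: F].
Hypothesis sK : forall b, is_subgroup (K b).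
Hypothesis sKI : forall b k, K b k -> s k = 1 -> k = 1.
Hypothesis Kgen : forall M, is_subgroup M -> (forall b, K b `<=` M) ->
  forall g, M g.

Let coset_inv (D : bool -> set F) :=
  forall b x k, K b k -> D b x -> D b (x * s k).

(* The bipartite graph with vertex set the disjoint union of the orbits of K true
   and of K false on F, and edges the points of F, has a spanning tree.  It is
   encoded by equivariant sections tau of s: x is an edge of the tree when
   tau true x = tau false x, and the last clause says that the tree connects. *)
Definition partial_tree (D : bool -> set F) (tau : bool -> F -> G) : Prop :=
  [/\ coset_inv D,
      forall b x k, K b k -> D b x -> tau b (x * s k) = tau b x * k,
      forall b x, D b x -> s (tau b x) = x,
      D true 1 /\ tau true 1 = 1 &
      forall E : bool -> set F, coset_inv E ->
        (forall x, D true x -> D false x -> tau true x = tau false x ->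
           E true x <-> E false x) ->
        E true 1 -> forall b x, D b x -> E b x].

(** The tree with one vertex, the orbit of 1 under K true; tau sends s k to k, which is well defined
    as s is injective on K true. *)
Lemma partial_tree_init : exists D tau, partial_tree D tau.
Proof.
pose O := [set x | exists k, K true k /\ x = s k].
pose D (b : bool) : set F := if b then O else set0.
have /choice[c cP] x : exists k, O x -> K true k /\ x = s k.
  by have [[k kx]|nx] := pselect (O x); [exists k|exists 1 => /nx].
exists D, (fun=> c).
have cI x k : O x -> K true k -> x = s k -> c x = k.
  move=> Ox Kk xk; have [Kc xc] := cP x Ox.
  apply: (@mulgI _ k^-1); rewrite mulVg; apply: (@sKI true).
    by apply: sgM => //; apply: sgV.
  by apply/hom_eq; rewrite -xk.
have D1 : O 1 by exists 1; split; [apply: sg1|rewrite hom1].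
have OM x k : K true k -> O x -> O (x * s k).
  by move=> Kk [l [Kl ->]]; exists (l * k); split; [apply: sgM|rewrite homM].
have Dinv : coset_inv D by case=> // x k; apply: OM.
split=> //.
- case=> // x k Kk Ox; have [Kc xc] := cP x Ox; apply: cI.
  + exact: OM.
  + exact: sgM.
  + by rewrite homM -xc.
- by case=> // x Ox; have [_ <-] := cP x Ox.
- by split=> //; apply: cI => //; [apply: sg1|rewrite hom1].
- by move=> E Einv _ E1 [] // x [k [Kk ->]]; rewrite -[s k]mul1g; apply: Einv.
Qed.

(** The edge x0 has just one end in the tree. The orbit at its other end is added, and tau is
    extended equivariantly so that both sections agree at x0. *)
Lemma partial_tree_extend D tau c x0 : partial_tree D tau ->
  D c x0 -> ~ D (~~ c) x0 ->
  exists tau', partial_tree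
    (fun b => if b == c then D b
              else D b `|` [set x | exists k, K b k /\ x = x0 * s k]) tau'.
Proof.
move=> [Dinv tauE tauS [D1 tau1] conn] Dx0 nDx0.
have /choice[r rP] x : exists k, (exists k, K (~~ c) k /\ x = x0 * s k) ->
    K (~~ c) k /\ x = x0 * s k.
  have [[k kx]|nx] := pselect (exists k, K (~~ c) k /\ x = x0 * s k).
    by exists k.
  by exists 1 => /nx.
pose O := [set x | exists k, K (~~ c) k /\ x = x0 * s k].
have OM x k : K (~~ c) k -> O x -> O (x * s k).
  by move=> Kk [l [Kl ->]]; exists (l * k); split; [apply: sgM|rewrite homM mulgA].
have O0 : O x0 by exists 1; split; [apply: sg1|rewrite hom1 mulg1].
have rI k : K (~~ c) k -> r (x0 * s k) = k.
  move=> Kk; have [|Kr xr] := rP (x0 * s k); first by exists k.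
  apply: (@mulgI _ k^-1); rewrite mulVg; apply: (@sKI (~~ c)).
    by apply: sgM => //; apply: sgV.
  by apply/hom_eq; apply: mulgI xr.
have OD x : O x -> ~ D (~~ c) x.
  move=> [k [Kk ->]] Dx; apply: nDx0.
  rewrite -[x0](mulgK (s k)) -homV; apply: Dinv => //; exact: sgV.
have neqc b : b != c -> b = ~~ c by case: b; case: (c).
pose tau' b x := if pselect (b = ~~ c /\ O x) then tau c x0 * r x else tau b x.
have tau'O x : O x -> tau' (~~ c) x = tau c x0 * r x.
  by move=> Ox; rewrite /tau'; case: pselect => // -[].
have tau'D b x : D b x -> tau' b x = tau b x.
  rewrite /tau' => Dx; case: pselect => // bO; case: (bO) => e Ox.
  by case: (OD x Ox); rewrite -e.
pose D' b := if b == c then D b else D b `|` [set x | exists k, K b k /\ x = x0 * s k].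
have DD' b x : D b x -> D' b x by move=> Dx; rewrite /D'; case: ifP => //; left.
have D'P b x : D' b x -> D b x \/ (b = ~~ c /\ O x).
  rewrite /D'; case: ifP => [_ Dx|/negbT/neqc ->]; first by left.
  by case=> [Dx|Ox]; [left|right].
have OD' x : O x -> D' (~~ c) x.
  by move=> Ox; rewrite /D' ifN; [right|case: (c)].
exists tau'; split.
- move=> b x k Kk /D'P[Dx|[e Ox]]; first by apply/DD'/Dinv.
  by subst b; apply: OD'; apply: OM.
- move=> b x k Kk /D'P[Dx|[e Ox]].
    by rewrite !tau'D ?tauE //; apply: Dinv.
  subst b; rewrite !tau'O //; last exact: OM.
  case: Ox => l [Kl ->]; rewrite -mulgA -homM !rI ?mulgA //; exact: sgM.
- move=> b x /D'P[Dx|[e Ox]]; first by rewrite tau'D // tauS.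
  by subst b; rewrite tau'O // homM tauS //; have [_ <-] := rP x Ox.
- by split; [apply: DD'|rewrite tau'D].
move=> E Einv Eeq E1.
have Eeq' x : D' true x -> D' false x -> tau' true x = tau' false x ->
  E true x <-> E false x := Eeq x.
have ED : forall b x, D b x -> E b x.
  apply: conn => // x Dt Df e; apply: Eeq; [exact: DD'|exact: DD'|].
  by rewrite !tau'D.
have Ex0 : E (~~ c) x0.
  have e : tau' c x0 = tau' (~~ c) x0.
    have r0 : r x0 = 1 by have := rI 1 (sg1 (sK _)); rewrite hom1 mulg1.
    by rewrite tau'D // tau'O // r0 mulg1.
  have := Eeq' x0; move: (ED c x0 Dx0) (DD' c x0 Dx0) (OD' x0 O0) e.
  case: (c) => Ec Dc Dn e h; first exact: (h Dc Dn e).1.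
  exact: (h Dn Dc (esym e)).2.
move=> b x /D'P[/ED//|[e [k [Kk ->]]]].
by subst b; apply: Einv.
Qed.

(** Extend while some edge has just one end in the tree; finiteness of F stops this. Then D true and
    D false coincide, so they are stable under the generators of G and exhaust F. *)
Lemma spanning_tree : exists tau, partial_tree (fun=> [set: F]) tau.
Proof.
have [l lE] := (finite_seqP _).1 finF.
have lP (x : F) : x \in l by have : [set: F] x by []; rewrite lE.
have [D [tau DT]] := partial_tree_init.
pose mis b (D : bool -> set F) := count (fun x => ~~ `[< D b x >]) l.
have [m] := ubnP (mis true D + mis false D)%N.
elim: m D tau DT => // m IHm D tau DT; rewrite ltnS => Dm.
have [[c [x0 [Dx0 nDx0]]]|nex] :=
    pselect (exists c x0, D c x0 /\ ~ D (~~ c) x0).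
  have [tau' DT'] := partial_tree_extend DT Dx0 nDx0.
  apply: (IHm _ _ DT'); apply: leq_trans Dm; set D' := fun b => _.
  have DD' b x : ~~ `[< D' b x >] -> ~~ `[< D b x >].
    by apply: contraNN => /asboolP Dx; apply/asboolP; rewrite /D'; case: ifP => //; left.
  have lec b : (mis b D' <= mis b D)%N by apply: sub_count => x; apply: DD'.
  have ltc : (mis (~~ c) D' < mis (~~ c) D)%N.
    have D'x0 : D' (~~ c) x0.
      rewrite /D' ifN; last by case: (c).
      by right; exists 1; split; [apply: sg1|rewrite hom1 mulg1].
    have := lP x0; rewrite /mis; elim: (l) => //= z l' IHl.
    rewrite inE => /predU1P[<-|/IHl h].
      rewrite (asboolT D'x0) (asboolF nDx0) /= add0n add1n ltnS.
      by apply: sub_count => x; apply: DD'.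
    rewrite -addnS leq_add //; have := @DD' (~~ c) z.
    by case: (`[< D' _ z >]) => //= ->.
  case: (c) ltc (lec c) => h1 h2; first by rewrite -addnS leq_add.
  by rewrite -addSn leq_add.
have [Dinv tauE tauS [D1 tau1] conn] := DT.
have Deq b c x : D b x -> D c x.
  move=> Dx; have [->//|bc] := eqVneq c b; apply: contrapT => nDx; apply: nex.
  by exists b, x; split=> //; case: b c bc Dx nDx => [] [].
have DT' x : D true x.
  pose M := [set g | forall x, D true x <-> D true (x * s g)].
  have sM : is_subgroup M.
    split=> [z|u v Mu Mv z|u Mu z]; first by rewrite hom1 mulg1.
      by rewrite homM mulgA (Mu z); apply: Mv.
    by rewrite (Mu (z * s u^-1)) homV mulgVK.
  have [g _ <-] : range s x by rewrite sS.
  have /(_ 1) : M g.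
    apply: Kgen sM _ g => b k Kk z; split=> [/(Deq _ b) Dz|/(Deq _ b) Dz].
      by apply: (Deq b); apply: Dinv.
    apply: (Deq b); rewrite -[z](mulgK (s k)) -homV; apply: Dinv => //.
    exact: sgV.
  by rewrite mul1g => <-.
exists tau; have DE b : D b = [set: F].
  by apply/seteqP; split=> // x _; apply: (Deq true).
by move: DT; have -> : D = fun=> [set: F] by apply/funext.
Qed.

End Forest.

(** * Free kernels over a finite quotient F *)

Section FreeKernel.
Variables (H A B G F : groupType)
    (iA : {multiplicative H -> A}) (iB : {multiplicative H -> B})
    (jA : {multiplicative A -> G}) (jB : {multiplicative B -> G})
    (s : {multiplicative G -> F}).
Hypothesis amalgG : is_amalgamated_product iA iB jA jB.
Hypothesis finF : finite_group F.
Hypothesis sS : range s = [set: F].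

Let jH h : jA (iA h) = jB (iB h). Proof. by case: amalgG. Qed.

(** The normal closure of the elements of A and of B killed by s. Modulo it the map to F is
    injective on the images of the factors, as the spanning tree requires. *)
Let vertex_kernel : set G := [set g | forall N, is_normal_subgroup N ->
  (forall a, s (jA a) = 1 -> N (jA a)) -> (forall b, s (jB b) = 1 -> N (jB b)) -> N g].

Let vertex_kernel_normal : is_normal_subgroup vertex_kernel.
Proof.
split; first split.
- by move=> N nN _ _; apply: sg1 nN.1.
- move=> x y Lx Ly N nN NA NB.
  exact: sgM nN.1 (Lx N nN NA NB) (Ly N nN NA NB).
- by move=> x Lx N nN NA NB; apply: sgV nN.1 (Lx N nN NA NB).
- by move=> x y Lx N nN NA NB; apply: nsgJ nN (Lx N nN NA NB).
Qed.

(* The Ribes-Steinberg wreath product argument: a map from the edges of the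
   coset graph to T is a cocycle on A and B, so it extends to a homomorphism of
   G' to T wr F, whose value at the base point of F is the required extension to
   the kernel of a map defined on the edges outside a spanning tree. *)
Lemma free_kernel : exists (G' K : groupType) (r : {multiplicative G -> G'})
    (s' : {multiplicative G' -> F}) (i : {multiplicative K -> G'}),
  [/\ range r = [set: G'], forall g, s' (r g) = s g,
      forall (T : groupType) (t : {multiplicative G -> T}),
        (forall a, s (jA a) = 1 -> t (jA a) = 1) ->
        (forall b, s (jB b) = 1 -> t (jB b) = 1) ->
        forall g, r g = 1 -> t g = 1,
      injective i /\ range i = s' @^-1` [set 1] & free_group K].
Proof.
have [G' [r [rS rL]]] := quotient_exists vertex_kernel_normal.
have kill (T : groupType) (t : {multiplicative G -> T}) :
    (forall a, s (jA a) = 1 -> t (jA a) = 1) ->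
    (forall b, s (jB b) = 1 -> t (jB b) = 1) -> forall g, r g = 1 -> t g = 1.
  by move=> tA tB g /rL Lg; apply: (Lg [set x | t x = 1] (ker_normal t) tA tB).
have [s' s'E] : exists s' : {multiplicative G' -> F}, forall g, s' (r g) = s g.
  by apply: hom_factor rS _ => g; apply: kill.
have s'S : range s' = [set: F].
  apply/seteqP; split=> // x _; have [g _ <-] : range s x by rewrite sS.
  by exists (r g).
pose KK (b : bool) : set G' := if b then range (hom_comp r jA) else range (hom_comp r jB).
have sK b : is_subgroup (KK b) by case: b; apply: range_subgroup.
have sKI b k : KK b k -> s' k = 1 -> k = 1.
  case: b => -[x _ <-] /=; rewrite s'E => sx; apply/rL => N nN NA NB.
    exact: NA.
  exact: NB.
have Kgen M : is_subgroup M -> (forall b, KK b `<=` M) -> forall g, M g.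
  move=> sM KM g; have [x _ <-] : range r g by rewrite rS.
  apply: (amalgam_ind amalgG (preim_subgroup r sM)) => [a|b].
    by apply: (KM true); exists a.
  by apply: (KM false); exists b.
have [tau [_ tauE tauS [_ tau1] conn]] := spanning_tree finF s'S sK sKI Kgen.
have sKer := (ker_normal s').1.
have [K [i [iI iK]]] := subgroup_exists sKer.
(* The loop through the edge x, trivial for edges of the tree. *)
pose eps x := tau true x * (tau false x)^-1.
have s'eps x : s' (eps x) = 1 by rewrite homM homV !tauS // mulgV.
have /choice[e eE] x : exists k, i k = eps x.
  by have : range i (eps x) by [rewrite iK]; case=> k _ <-; exists k.
have epsH x k : KK true k -> KK false k -> eps (x * s' k) = eps x.
  by move=> Kt Kf; rewrite /eps !tauE // invgM mulgA mulgK.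
have eH x k : KK true k -> KK false k -> e (x * s' k) = e x.
  by move=> Kt Kf; apply: iI; rewrite !eE epsH.
(* Rewriting along tau: a generator k contributes 1 or the quotient of eps x by eps (x * s' k), so
   the loops generate the kernel of s'. *)
have gen (M : set G') : is_subgroup M -> (forall x, M (eps x)) ->
    forall g, s' g = 1 -> M g.
  move=> sM Meps g sg.
  pose N := [set g | forall x, M (tau true x * g * (tau true (x * s' g))^-1)].
  suff /(_ 1) : N g by rewrite sg mulg1 tau1 mul1g invg1 mulg1.
  apply: Kgen; [split|case].
  - by move=> x; rewrite mulg1 hom1 mulg1 mulgV; apply: sg1.
  - move=> u v Nu Nv x; have := sgM sM (Nu x) (Nv (x * s' u)).
    by rewrite homM !mulgA mulgVK.
  - move=> u Nu x; have := sgV sM (Nu (x * s' u^-1)).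
    by rewrite homV mulgVK !invgM invgK mulgA.
  - by move=> k Kk x; rewrite tauE // mulgV; apply: sg1.
  move=> k Kk x; have := sgM sM (Meps x) (sgV sM (Meps (x * s' k))).
  by rewrite /eps (tauE false) // invgM invgK !mulgA mulgVK.
exists G', K, r, s', i; split=> //.
exists [set k | exists x, k = e x /\ k <> 1] => T f.
(* A map f on the basis becomes a labelling of the edges, trivial where the loop is trivial. *)
pose w x := if e x == 1 then 1 else f (e x).
have wH x h : w (x * s (jA (iA h))) = w x.
  by rewrite /w -s'E eH //; [exists (iA h)|exists (iB h); rewrite //= jH].
have fAM : {morph (fun a => (fun=> 1, s (jA a)) : wreath T F) : x y / x * y}.
  move=> x y; congr (_, _); last by rewrite !homM.
  by apply/funext => z; rewrite /= mulg1.
have fBM : {morph (fun b => (fun z => w z * (w (z * s (jB b)))^-1, s (jB b))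
    : wreath T F) : x y / x * y}.
  move=> x y; congr (_, _); last by rewrite !homM.
  by apply/funext => z; rewrite /= !homM !mulgA mulgVK.
have [|t [tA tB]] := amalgam_lift amalgG (f := hom_of fAM) (g := hom_of fBM).
  move=> h; congr (_, _); last by rewrite jH.
  by apply/funext => z; rewrite -jH wH mulgV.
have [theta thetaE] : exists u : {multiplicative G' -> wreath T F}, forall g, u (r g) = t g.
  apply: hom_factor rS _; apply: kill => [a|b] sx; rewrite ?tA ?tB; apply/wreath_eq1.
    by [].
  by split=> //= z; rewrite sx mulg1 mulgV.
have theta2 g : (theta g).2 = s' g.
  have [x _ <-] : range r g by rewrite rS.
  rewrite thetaE s'E; apply: (amalgam_hom_ext amalgG
    (k := hom_comp (wreath_snd T F) t) (l := s)) => y /=.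
    by rewrite tA.
  by rewrite tB.
have thetaT k x : KK true k -> (theta k).1 x = 1.
  by case=> a _ <-; rewrite /= thetaE tA.
have thetaF k x : KK false k -> (theta k).1 x = w x * (w (x * s' k))^-1.
  by case=> b _ <-; rewrite /= thetaE tB s'E.
(* The connectivity clause of the tree, applied to E, computes the base value of theta on both
   sections. *)
pose E (b : bool) : set F := if b then [set x | (theta (tau true x)).1 1 = 1]
  else [set x | (theta (tau false x)).1 1 * w x = 1].
have EP b x : E b x.
  apply: conn => // {b x}.
  - case=> x k Kk /= Ex; rewrite tauE // homM wreath_mulE.
      by rewrite (thetaT k) // mulg1.
    by rewrite theta2 tauS // mul1g (thetaF k) // mulgA mulgVK.
  - move=> x _ _ etau; have wx : w x = 1.
      rewrite /w (_ : e x = 1) ?eqxx //; apply: (inj_hom1 iI).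
      by rewrite eE /eps etau mulgV.
    by rewrite /= etau wx mulg1.
  - by rewrite /= tau1 hom1.
have thetaeps x : (theta (eps x)).1 1 = w x.
  rewrite /eps homM homV wreath_mulE theta2 tauS // mul1g.
  have /= -> := EP true x; rewrite mul1g /=.
  rewrite theta2 tauS // mulgV; have /= := EP false x.
  by move/(congr1 (mul ((theta (tau false x)).1 1)^-1)); rewrite mulKg mulg1 => ->.
have s'i k : s' (i k) = 1.
  by have : range i (i k) by [exists k]; rewrite iK.
have hM : {morph (fun k => (theta (i k)).1 1) : x y / x * y}.
  by move=> x y; rewrite /= !homM wreath_mulE theta2 s'i mulg1.
have [h hE] : exists h : {multiplicative K -> T}, forall x, h (e x) = w x.
  by exists (hom_of hM) => x; rewrite /= eE thetaeps.
exists h => [k|h' h'f k].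
  rewrite inE => -[x [kx k1]]; rewrite kx hE /w ifN //.
  by apply/eqP; rewrite -kx.
(* Uniqueness: h and h' agree on a subgroup containing all loops, and these generate the kernel. *)
suff : (i @` [set k | h' k = h k]) (i k) by move=> [k' /= hk' /iI <-].
apply: gen => //.
  split.
  - by exists 1; rewrite /= ?hom1.
  - move=> _ _ [u /= hu <-] [v /= hv <-]; exists (u * v); last by rewrite homM.
    by rewrite /= !(homM h') (homM h) hu hv.
  - move=> _ [u /= hu <-]; exists u^-1; last by rewrite homV.
    by rewrite /= (homV h') (homV h) hu.
move=> x; exists (e x); rewrite ?eE //=.
have [ex|/eqP ex] := eqVneq (e x) 1; first by rewrite ex (hom1 h') (hom1 h).
rewrite h'f; last by rewrite inE; exists x.
by rewrite hE /w ifN //; apply/eqP.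
Qed.

End FreeKernel.

(** * Residual properties of the amalgamated product *)

Lemma image_exists (X Y : groupType) (f : {multiplicative X -> Y}) :
  exists (Z : groupType) (s : {multiplicative X -> Z}) (i : {multiplicative Z -> Y}),
    [/\ range s = [set: Z], injective i & forall x, i (s x) = f x].
Proof.
have [Z [s [sS sE]]] := quotient_exists (ker_normal f).
have [i iE] : exists i : {multiplicative Z -> Y}, forall x, i (s x) = f x.
  by apply: hom_factor sS _ => x /sE.
exists Z, s, i; split=> //; apply: hom_inj => z.
by have [x _ <-] : range s z by [rewrite sS]; rewrite iE => fx; apply/sE.
Qed.

(** Both series run in parallel; the one that ends first stays at its whole group. *)
Lemma nilpotent_prod (X Y : groupType) :
  nilpotent_group X -> nilpotent_group Y -> nilpotent_group (X * Y)%type.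
Proof.
move=> [m [Z [Z0 Zm Zn Zc]]] [n [W [W0 Wn Wnorm Wc]]].
exists (maxn m n), (fun i => [set u : (X * Y)%type | Z (minn i m) u.1 /\ W (minn i n) u.2]).
have step (T : groupType) k (V : nat -> set T) i : V k = [set: T] ->
    (forall i, (i < k)%N -> V i `<=` V i.+1 /\ forall x y, V i.+1 x -> V i [~ x, y]) ->
    V (minn i k) `<=` V (minn i.+1 k) /\
    forall x y, V (minn i.+1 k) x -> V (minn i k) [~ x, y].
  move=> VT Vc; case: (ltnP i k) => ik.
    by rewrite (minn_idPl ik); apply: Vc.
  by rewrite (minn_idPr (leqW ik)) VT.
split.
- rewrite !min0n Z0 W0; by apply/seteqP; split=> [[x y] [/= -> ->] //|_ -> //].
- rewrite (minn_idPr (leq_maxl m n)) (minn_idPr (leq_maxr m n)) Zm Wn.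
  by apply/seteqP; split.
- move=> i _.
  have fM : {morph (fst : X * Y -> X)%type : u v / u * v} by [].
  have gM : {morph (snd : X * Y -> Y)%type : u v / u * v} by [].
  have nZ := preim_normal (hom_of fM) (Zn _ (geq_minr i m)).
  have nW := preim_normal (hom_of gM) (Wnorm _ (geq_minr i n)).
  exact: setI_normal nZ nW.
- move=> i _; have [Z1 Z2] := step _ _ _ i Zm Zc; have [W1 W2] := step _ _ _ i Wn Wc.
  split=> [u [Zu Wu]|u v [Zu Wu]]; first by split; [apply: Z1|apply: W1].
  by split; [apply: Z2|apply: W2].
Qed.

Lemma nilpotent_inj (X Y : groupType) (f : {multiplicative X -> Y}) :
  injective f -> nilpotent_group Y -> nilpotent_group X.
Proof.
move=> fI [n [Z [Z0 Zn Znorm Zc]]]; exists n, (fun i => f @^-1` Z i); split.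
- rewrite Z0; apply/seteqP; split=> x /=; first exact: inj_hom1.
  by move=> ->; rewrite hom1.
- by rewrite Zn.
- by move=> i /Znorm; apply: preim_normal.
- move=> i /Zc[Z1 Z2]; split=> [x /Z1 //|x y Zx]; rewrite /preimage /mkset homR.
  exact: Z2.
Qed.

Section FNClass.
Variable P : nat_pred.

Lemma FN_prod (X Y : groupType) : finite_nilpotent_P_group P X ->
  finite_nilpotent_P_group P Y -> finite_nilpotent_P_group P (X * Y)%type.
Proof.
move=> [fX nX pX] [fY nY pY]; split.
- exact: finite_group_prod.
- exact: nilpotent_prod.
- exact: P_group_prod.
Qed.

Lemma FN_inj (X Y : groupType) (f : {multiplicative X -> Y}) : injective f ->
  finite_nilpotent_P_group P Y -> finite_nilpotent_P_group P X.
Proof.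
move=> fI [fY nY /P_groupP pY]; split.
- exact: finite_inj fI fY.
- exact: nilpotent_inj fI nY.
- by apply/P_groupP => x; apply: torsion_inj fI (pY _).
Qed.

(** In a finite p-quotient y dies if p = r, and x dies otherwise; so no such quotient sees the
    commutator. *)
Lemma commute_coprime_torsion (X : groupType) (r : nat) (x y : X) :
  residually (finite_nilpotent_P_group P) X ->
  torsion r x -> torsion r^' y -> commute x y.
Proof.
move=> resX tx ty; apply/commgP/eqP; apply: contrapT => xy.
have [p [pp pP] [N pN nN]] := residual_p resX xy; apply: nN.
have nN := pfin_normal pN; have [pr|pr] := eqVneq p r.
  by apply: nsgRr nN _; apply: pfin_torsion pN _; rewrite pr.
apply: nsgR nN _; apply: pfin_torsion pN _.
by case: tx => n rn xn; exists n => //; apply: pnat_p'nat rn; rewrite eq_sym.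
Qed.

End FNClass.

Lemma trivial_group_free (K : groupType) : (forall k : K, k = 1) -> free_group K.
Proof.
move=> K1; exists set0 => T f.
have hM : {morph (fun _ : K => 1 : T) : x y / x * y} by move=> x y; rewrite mulg1.
exists (hom_of hM) => [k|h' _ k]; first by rewrite inE.
by rewrite (K1 k) hom1 hom1.
Qed.

Lemma trivial_group_p p (K : groupType) : (forall k : K, k = 1) -> finite_p_group p K.
Proof.
move=> K1; split.
  by apply: sub_finite_set (finite_set1 (1 : K)) => k _; rewrite (K1 k).
by apply/P_groupP => k; rewrite (K1 k); apply: torsion1.
Qed.

Lemma trivial_extension (C D : group_class) (X : groupType) :
  (forall K : groupType, (forall k : K, k = 1) -> C K) -> D X ->
  extension_class C D X.
Proof.
move=> C1 DX; have [K [i [iI iK]]] := subgroup_exists (trivial_normal X).1.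
have idM : {morph (id : X -> X) : x y / x * y} by [].
exists K, X, i, (hom_of idM); split=> //.
- apply: C1 => k; apply: (inj_hom1 iI).
  by have : range i (i k) by [exists k]; rewrite iK.
- by apply/seteqP; split=> // x _; exists x.
Qed.

(** The power of x by the r'-part of n is an r-element. If K contained it together with the r-th
    power of x, it would contain x. *)
Lemma torsion_outside (X : groupType) (K : set X) r x n : prime r ->
  is_subgroup K -> (0 < n)%N -> x ^+ n = 1 -> K (x ^+ r) -> ~ K x ->
  exists2 y, torsion r y & ~ K y.
Proof.
move=> rp sK n0 xn Kxr nKx; exists (x ^+ n`_r^').
  exists (n`_r)%N; first exact: part_pnat.
  by rewrite -expgnA mulnC partnC.
move=> Kx; apply: nKx; apply: (@subgroup_coprime _ K x n`_r^' r) => //.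
  by rewrite coprime_sym (pnat_coprime (pnat_id rp)) // part_pnat.
Qed.

(** * Commutators and quotients of reduced words *)

Section Clash.
Variables (H A B G : groupType)
    (iA : {multiplicative H -> A}) (iB : {multiplicative H -> B})
    (jA : {multiplicative A -> G}) (jB : {multiplicative B -> G}).
Hypothesis amalgG : is_amalgamated_product iA iB jA jB.

Lemma amalgam_sym : is_amalgamated_product iB iA jB jA.
Proof.
case: amalgG => iAI iBI jH univ; split=> // T f g fg.
have [h|k [kA kB] kuniq] := univ T g f; first by rewrite fg.
by exists k => // k' k'B k'A; apply: kuniq.
Qed.

(** The commutator is itself a reduced word, the closing 1 being allowed as last letter from A. *)
Lemma noncommuting_AB a b : ~ range iA a -> ~ range iB b ->
  ~ commute (jA a) (jB b).
Proof.
move=> aH bH /commgP/eqP c.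
have := @reduced_word_neq1 _ _ _ _ _ _ _ _ amalgG a^-1 [:: (b^-1, a); (b, 1)].
apply=> //.
  split=> //; move=> h; apply: bH; exact: sgVE (range_subgroup iB) h.
by rewrite -c /= /commg /conjg !homV hom1 !mulg1 !mulgA.
Qed.

Lemma noncommuting_AA a a' b : ~ range iA a -> ~ range iA a' -> ~ range iB b ->
  ~ commute (jA a) (jA a' ^ jB b).
Proof.
move=> aH a'H bH /commgP/eqP c.
have bH' : ~ range iB b^-1 by move=> h; apply: bH; exact: sgVE (range_subgroup iB) h.
have a'H' : ~ range iA a'^-1 by move=> h; apply: a'H; exact: sgVE (range_subgroup iA) h.
have := @reduced_word_neq1 _ _ _ _ _ _ _ _ amalgG a^-1
  [:: (b^-1, a'^-1); (b, a); (b^-1, a'); (b, 1)].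
apply=> //.
rewrite -c /= /commg /conjg !homV hom1 !invgM !invgK !mulg1 !mulgA //.
Qed.

(** Each letter is kept outside the image of H by its own quotient; this persists in products, and a
    word has finitely many letters. *)
Lemma separate_reduced_word (C : group_class) (l : seq (B * A)) :
  (exists Y, C Y) -> (forall X Y, C X -> C Y -> C (X * Y)%type) ->
  (forall a, ~ range iA a -> exists (Y : groupType) (s : {multiplicative G -> Y}),
     C Y /\ forall h, s (jA a) <> s (jA (iA h))) ->
  (forall b, ~ range iB b -> exists (Y : groupType) (s : {multiplicative G -> Y}),
     C Y /\ forall h, s (jB b) <> s (jA (iA h))) ->
  reduced (range iB) (range iA) l ->
  exists (Y : groupType) (s : {multiplicative G -> Y}), C Y /\
    reduced [set b | exists h, s (jB b) = s (jA (iA h))]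
            [set a | exists h, s (jA a) = s (jA (iA h))] l.
Proof.
move=> [Y0 CY0] Cprod sepA sepB.
have oneM : {morph (fun _ : G => 1 : Y0) : x y / x * y} by move=> x y; rewrite mulg1.
have pairM (X Y : groupType) (s : {multiplicative G -> X}) (t : {multiplicative G -> Y}) :
  {morph (fun g => (s g, t g)) : x y / x * y} by move=> x y; rewrite !homM.
pose red (Y : groupType) (s : {multiplicative G -> Y}) :=
  reduced [set b | exists h, s (jB b) = s (jA (iA h))]
          [set a | exists h, s (jA a) = s (jA (iA h))].
have red_pair (X Y : groupType) (s : {multiplicative G -> X}) (t : {multiplicative G -> Y}) k :
    red Y t k -> red _ (hom_of (pairM X Y s t)) k.
  elim: k => //= -[b a] k IHk [tb ta tk]; split; last exact: IHk.
    by move=> [h [_ e]]; apply: tb; exists h.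
  by move=> /ta ta' [h [_ e]]; apply: ta'; exists h.
elim: l => [_|[b a] l IHl /= [bH aH rl]]; first by exists Y0, (hom_of oneM).
have [Y [s [CY sl]]] := IHl rl; have [X [t [CX tb]]] := sepB b bH.
have [Z [u [CZ ua]]] : exists (Z : groupType) (u : {multiplicative G -> Z}),
    C Z /\ (l <> [::] -> forall h, u (jA a) <> u (jA (iA h))).
  have [l0|/eqP l0] := eqVneq l [::]; first by exists Y0, (hom_of oneM).
  by have [Z [u [CZ ua]]] := sepA a (aH l0); exists Z, u.
exists (Z * (X * Y))%type, (hom_of (pairM _ _ u (hom_of (pairM _ _ t s)))).
split; first by apply: (Cprod) => //; apply: Cprod.
split.
- by move=> [h [_ e _]]; apply: (tb h).
- by move=> /ua ua' [h [e _ _]]; apply: (ua' h).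
have h1 := red_pair _ _ t s l sl.
exact: (red_pair _ _ u _ l h1).
Qed.

End Clash.

(** * Residual properties of G and the conditions S(p) *)

Section Periodic.
Variables (H A B G : groupType)
    (iA : {multiplicative H -> A}) (iB : {multiplicative H -> B})
    (jA : {multiplicative A -> G}) (jB : {multiplicative B -> G})
    (P : nat_pred).
Hypothesis hP : forall p, p \in P -> prime p.
Hypothesis amalgG : is_amalgamated_product iA iB jA jB.
Hypothesis starP : condition_star iA iB P.
Hypothesis perH : periodic H.

Let jH h : jA (iA h) = jB (iB h). Proof. by case: amalgG. Qed.
Let P0 : exists p, p \in P. Proof. by case: starP. Qed.
Let resA : residually (finite_nilpotent_P_group P) A.
Proof. by case: starP => _ _ []. Qed.
Let resB : residually (finite_nilpotent_P_group P) B.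
Proof. by case: starP => _ _ []. Qed.

Lemma star_p_separableA a : ~ range iA a ->
  exists2 p, p \in P & exists2 M, pfin p M & forall h, ~ M ((iA h)^-1 * a).
Proof.
case: starP => _ _ _ [[T [f [bT _ fI]]] _].
exact: amalgam_p_separable hP resA bT fI perH P0 a.
Qed.

Lemma star_p_separableB b : ~ range iB b ->
  exists2 p, p \in P & exists2 M, pfin p M & forall h, ~ M ((iB h)^-1 * b).
Proof.
case: starP => _ _ _ [_ [T [f [bT _ fI]]]].
exact: amalgam_p_separable hP resB bT fI perH P0 b.
Qed.

Lemma star_separable : separable (finite_nilpotent_P_group P) (range iA) /\
  separable (finite_nilpotent_P_group P) (range iB).
Proof.
case: starP => _ _ _ [[T [f [bT _ fI]]] [T' [f' [bT' _ fI']]]]; split.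
  exact: amalgam_separable hP resA bT fI perH P0.
exact: amalgam_separable hP resB bT' fI' perH P0.
Qed.

Lemma star_isolator p : p \in P ->
  [/\ isolator p [set 1] = [set h : H | torsion p h],
      is_subgroup [set h : H | torsion p h] &
      finite_set [set h : H | torsion p h]].
Proof.
move=> pP; case: starP => _ _ _ [[T [f [bT _ fI]]] _]; split.
- exact: isolator_torsion hP resA bT fI perH p pP.
- exact: torsion_p_subgroup hP resA bT fI perH p pP.
- exact: torsion_p_finite hP resA bT fI perH p pP.
Qed.

Lemma separate_subsets p (M : set A) (N : set B) :
  p \in P -> condition_S iA iB p -> pfin p M -> pfin p N ->
  exists (F : groupType) (s : {multiplicative G -> F}),
    [/\ finite_p_group p F, forall a, s (jA a) = 1 -> M a &
        forall b, s (jB b) = 1 -> N b].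
Proof.
move=> pP; have [torE _ _] := star_isolator pP.
exact: (condition_S_separate amalgG (hP pP) perH torE).
Qed.

Lemma separate_letterA p (M : set A) a :
  p \in P -> condition_S iA iB p -> pfin p M -> (forall h, ~ M ((iA h)^-1 * a)) ->
  exists (F : groupType) (s : {multiplicative G -> F}),
    finite_p_group p F /\ forall h, s (jA a) <> s (jA (iA h)).
Proof.
move=> pP Sp pM Ma; have [F [s [pF sM _]]] := separate_subsets pP Sp pM (pfin_full B p).
exists F, s; split=> // h e; apply: (Ma h); apply: sM.
by rewrite homM homV; apply/hom_eq.
Qed.

Lemma separate_letterB p (N : set B) b :
  p \in P -> condition_S iA iB p -> pfin p N -> (forall h, ~ N ((iB h)^-1 * b)) ->
  exists (F : groupType) (s : {multiplicative G -> F}),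
    finite_p_group p F /\ forall h, s (jB b) <> s (jA (iA h)).
Proof.
move=> pP Sp pN Nb; have [F [s [pF _ sN]]] := separate_subsets pP Sp (pfin_full A p) pN.
exists F, s; split=> // h e; apply: (Nb h); apply: sN.
by rewrite homM homV -jH; apply/hom_eq.
Qed.

Lemma detect_factor a : (forall p, p \in P -> condition_S iA iB p) -> a <> 1 ->
  exists (F : groupType) (s : {multiplicative G -> F}),
    finite_nilpotent_P_group P F /\ s (jA a) <> 1.
Proof.
move=> hS a1; have [p [pp pP] [M pM nMa]] := residual_p resA a1.
have [F [s [pF sM _]]] := separate_subsets pP (hS p pP) pM (pfin_full B p).
by exists F, s; split; [apply: p_group_FN pF|move=> /sM].
Qed.

Lemma separable_pfin q (X : groupType) (Y : set X) x :
  is_subgroup Y -> separable (finite_p_group q) Y -> ~ Y x ->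
  exists2 M, pfin q M & forall y, Y y -> ~ M (y^-1 * x).
Proof.
move=> sY sepY nYx; have [T [s [qT _ sx]]] := sepY x nYx.
exists [set z | s z = 1]; first by exists T, s.
by move=> y Yy /hom_eq e; apply: sx; exists y.
Qed.

(** Elements of A are detected through S(p). For the others, all letters are separated from H in
    finite q-quotients for the single prime q, so one finite q-group keeps the word reduced, and a
    wreath product of q-groups detects it. *)
Lemma residual_of_S :
  (exists2 q, q \in P & separable (finite_p_group q) (range iA) /\
                        separable (finite_p_group q) (range iB)) ->
  (forall p, p \in P -> condition_S iA iB p) ->
  residually (finite_nilpotent_P_group P) G.
Proof.
move=> [q qP [sepA sepB]] hS g g1.
suff [F [s [nF sg]]] : exists (F : groupType) (s : {multiplicative G -> F}),
    finite_nilpotent_P_group P F /\ s g <> 1.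
  have [Z [t [i [tS iI tE]]]] := image_exists s; exists Z, t; split=> //.
    exact: FN_inj iI nF.
  by move=> tg; apply: sg; rewrite -tE tg hom1.
have [a [l [gE rl]]] := amalgam_normal_form amalgG g.
have [l0|/eqP l0] := eqVneq l [::].
  rewrite l0 /= mulg1 in gE; rewrite gE; apply: detect_factor => // a1.
  by apply: g1; rewrite gE a1 hom1.
have [||||Y [s [qY ry]]] := separate_reduced_word (jA := jA) (jB := jB)
    (C := finite_p_group q) _ _ _ _ rl.
- by have [Y [_ [qY _]]] := pfin_full G q; exists Y.
- by move=> X Y; apply: finite_p_group_prod.
- move=> x xH; have [M qM Mx] := separable_pfin (range_subgroup iA) sepA xH.
  by apply: (separate_letterA qP (hS q qP) qM) => h; apply: Mx; exists h.
- move=> x xH; have [M qM Mx] := separable_pfin (range_subgroup iB) sepB xH.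
  by apply: (separate_letterB qP (hS q qP) qM) => h; apply: Mx; exists h.
have [T [t [qT _ tg _ _]]] := reduced_word_detected amalgG a (hP qP) l0 ry.
exists (wreath T Y), t; split; last by rewrite gE.
exact: p_group_FN (hP qP) qP (finite_p_group_wreath qT qY).
Qed.

(** Different letters may need different primes of P, so the common quotient F is a finite nilpotent
    P-group, over which a wreath product need not be nilpotent. *)
Lemma detect_reduced_word : (forall p, p \in P -> condition_S iA iB p) ->
  forall l, reduced (range iB) (range iA) l ->
  exists (F : groupType) (s : {multiplicative G -> F}),
    [/\ finite_nilpotent_P_group P F, range s = [set: F] &
    reduced [set b | exists h, s (jB b) = s (jA (iA h))]
            [set a | exists h, s (jA a) = s (jA (iA h))] l].
Proof.
move=> hS l rl; have [p0 p0P] := P0.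
have [||||F [s [nF rF]]] := separate_reduced_word (jA := jA) (jB := jB)
    (C := finite_nilpotent_P_group P) _ _ _ _ rl.
- have [Y [_ [pY _]]] := pfin_full G p0.
  by exists Y; apply: p_group_FN (hP p0P) p0P pY.
- by move=> X Y; apply: FN_prod.
- move=> x /star_p_separableA[p pP [M pM Mx]].
  have [F [s [pF sx]]] := separate_letterA pP (hS p pP) pM Mx.
  by exists F, s; split=> //; apply: p_group_FN (hP pP) pP pF.
- move=> x /star_p_separableB[p pP [M pM Mx]].
  have [F [s [pF sx]]] := separate_letterB pP (hS p pP) pM Mx.
  by exists F, s; split=> //; apply: p_group_FN (hP pP) pP pF.
have [Z [t [i [tS iI tE]]]] := image_exists s; exists Z, t; split=> //.
  exact: FN_inj iI nF.
elim: l rF {rl} => //= -[b a] l IHl [sb sa sl]; split; last exact: IHl.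
  by move=> [h e]; apply: sb; exists h; rewrite -!tE e.
by move=> /sa sa' [h e]; apply: sa'; exists h; rewrite -!tE e.
Qed.

(** The common part of the free and the finite q-group case: elements of A survive in a nilpotent
    quotient, an extension with trivial kernel, and C matters only for words with a nonempty
    list. *)
Lemma extension_of_S (C : group_class) :
  (forall K : groupType, (forall k : K, k = 1) -> C K) ->
  (forall (F : groupType) (s : {multiplicative G -> F}) a l,
     finite_nilpotent_P_group P F -> range s = [set: F] -> l <> [::] ->
     reduced [set b | exists h, s (jB b) = s (jA (iA h))]
             [set a | exists h, s (jA a) = s (jA (iA h))] l ->
     exists (T : groupType) (t : {multiplicative G -> T}),
       [/\ extension_class C (finite_nilpotent_P_group P) T, range t = [set: T] &
           t (jA a * amalgam_word jA jB l) <> 1]) ->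
  (forall p, p \in P -> condition_S iA iB p) ->
  residually (extension_class C (finite_nilpotent_P_group P)) G.
Proof.
move=> C1 Cl hS g g1; have [a [l [gE rl]]] := amalgam_normal_form amalgG g.
have [l0|/eqP l0] := eqVneq l [::].
  rewrite l0 /= mulg1 in gE.
  have [|F [s [nF sa]]] := @detect_factor a hS.
    by move=> a1; apply: g1; rewrite gE a1 hom1.
  have [Z [t [i [tS iI tE]]]] := image_exists s; exists Z, t; split=> //.
    by apply: trivial_extension => //; apply: FN_inj iI nF.
  by move=> tg; apply: sa; rewrite -gE -tE tg hom1.
have [F [s [nF sS rF]]] := detect_reduced_word hS rl.
by rewrite gE; apply: Cl rF.
Qed.

Lemma free_extension_of_S : (forall p, p \in P -> condition_S iA iB p) ->
  residually (extension_class free_group (finite_nilpotent_P_group P)) G.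
Proof.
apply: extension_of_S => [K|F s a l nF sS l0 rF]; first exact: trivial_group_free.
(* A wreath product with a 2-group, the prime being arbitrary, shows that the word survives in the
   quotient G' with free kernel. *)
have [T [t [_ _ tg tA tB]]] := @reduced_word_detected _ _ _ _ _ _ _ _ amalgG F s 2 a l isT l0 rF.
have fF : finite_group F by case: nF.
have [G' [K [r [s' [i [rS s'E kill [iI iK] fK]]]]]] := free_kernel amalgG fF sS.
exists G', r; split=> //; last by move/(kill _ t tA tB).
exists K, F, i, s'; split=> //.
by apply/seteqP; split=> // x _; have [g _ <-] : range s x by [rewrite sS]; exists (r g).
Qed.

(** The quotient is the image of G in the wreath product; its kernel over F consists of functions
    from F to a finite q-group. *)
Lemma p_extension_of_S q : prime q -> (forall p, p \in P -> condition_S iA iB p) ->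
  residually (extension_class (finite_p_group q) (finite_nilpotent_P_group P)) G.
Proof.
move=> qp; apply: extension_of_S => [K|F s a l nF sS l0 rF]; first exact: trivial_group_p.
have [T [t [qT t2 tg _ _]]] := reduced_word_detected amalgG a qp l0 rF.
have [Z [r [i [rS iI rE]]]] := image_exists t.
exists Z, r; split=> //; last by move=> rg; apply: tg; rewrite -rE rg hom1.
pose s' := hom_comp (wreath_snd T F) i.
have [K [k [kI kK]]] := subgroup_exists (ker_normal s').1.
have fF : finite_group F by case: nF.
have ikI : injective (hom_comp i k) by move=> x y /iI/kI.
exists K, F, k, s'; split=> //.
- split; first exact: finite_inj ikI (finite_wreath qT.1 fF).
  apply/P_groupP => x; apply: (torsion_inj ikI).
  apply: wreath_base_torsion qT.2 _ => //.
  by have : range k (k x) by [exists x]; rewrite kK.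
- apply/seteqP; split=> // x _; have [g _ <-] : range s x by rewrite sS.
  by exists (r g); rewrite //= rE t2.
Qed.

(** A nontrivial p-element of a finite nilpotent group is not p'-torsion, so a finite p-quotient
    still detects it. *)
Lemma S_of_detected p : p \in P ->
  (forall h : H, torsion p h -> h <> 1 ->
     exists (T : groupType) (s : {multiplicative G -> T}),
       finite_nilpotent_P_group P T /\ s (jA (iA h)) <> 1) ->
  condition_S iA iB p.
Proof.
move=> pP det; have [torE sH fH] := star_isolator pP; have pp := hP pP.
have sHp : is_subgroup (isolator p [set (1 : H)]) by rewrite torE.
have fHp : finite_set (isolator p [set (1 : H)]) by rewrite torE.
apply: (condition_S_of_residual jH pp sHp fHp); rewrite torE => h th h1.
have [T [s [[fT nT pT] sh]]] := det h th h1.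
have [|N pN nN] := p_residual (x := s (jA (iA h))) pp nT (@finite_group_sections p _ fT).
  by move=> th'; apply: sh; apply: torsion_coprime th'; do 3!apply: torsion_hom.
by exists (s @^-1` N) => //; apply: pfin_preim.
Qed.

Let jAiA_neq1 h : h <> 1 -> jA (iA h) <> 1.
Proof.
move=> h1 e; apply: h1; case: amalgG => iAI _ _ _; apply: (inj_hom1 iAI).
exact: inj_hom1 (amalgam_injA amalgG) e.
Qed.

Lemma S_of_residual p : p \in P -> residually (finite_nilpotent_P_group P) G ->
  condition_S iA iB p.
Proof.
move=> pP resG; apply: S_of_detected => // h _ h1.
by have [T [s [nT _ sh]]] := resG _ (jAiA_neq1 h1); exists T, s.
Qed.

(** A p-element that dies in Q lies in the image of the q-group K, hence is trivial as p and q
    differ; so Q detects the p-elements. *)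
Lemma S_of_p_extension p q : p \in P -> p != q -> prime q ->
  residually (extension_class (finite_p_group q) (finite_nilpotent_P_group P)) G ->
  condition_S iA iB p.
Proof.
move=> pP pq qp resG; apply: S_of_detected => // h th h1.
have [X [t [[K [Q [i [s [[_ /P_groupP qK] nQ iI sS sE]]]]] _ th1]]] :=
  resG _ (jAiA_neq1 h1).
exists Q, (hom_comp s t); split=> // sth; apply: th1.
have : (s @^-1` [set 1]) (t (jA (iA h))) by [].
rewrite sE => -[k _ kE]; rewrite -kE.
apply: (torsion_coprime (pi := p)); first by rewrite kE; do 3!apply: torsion_hom.
apply: torsion_hom; have [n qn kn] := qK k; exists n => //.
by apply: pnat_p'nat qn; rewrite eq_sym.
Qed.

Lemma torsion_in_P (r : nat) (X : groupType) (x : X) : prime r ->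
  residually (finite_nilpotent_P_group P) X -> torsion r x -> x <> 1 -> r \in P.
Proof.
move=> rp resX tx x1; have [p [pp pP] [N pN nNx]] := residual_p resX x1.
have [<- //|pr] := eqVneq p r; case: nNx; apply: pfin_torsion pN _.
by case: tx => n rn xn; exists n => //; apply: pnat_p'nat rn; rewrite eq_sym.
Qed.

End Periodic.

(** * Isolation of H in the factors *)

Section Isolated.
Variables (H A B G : groupType)
    (iA : {multiplicative H -> A}) (iB : {multiplicative H -> B})
    (jA : {multiplicative A -> G}) (jB : {multiplicative B -> G})
    (P : nat_pred).
Hypothesis amalgG : is_amalgamated_product iA iB jA jB.
Hypothesis BH : range iB <> [set: B].
Hypothesis perH : periodic H.
Hypothesis resG : residually (finite_nilpotent_P_group P) G.

(** As H is periodic, x has finite order, and [torsion_outside] applies. *)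
Lemma root_torsion (X : groupType) (i : {multiplicative H -> X}) (r : nat) x :
  prime r -> range i (x ^+ r) -> ~ range i x ->
  exists2 y, torsion r y & ~ range i y.
Proof.
move=> rp [h _ hx] nx; have [n [n0 hn _]] := perH h.
apply: (torsion_outside (n := (r * n)%N) rp (range_subgroup i)) nx.
- by rewrite muln_gt0 prime_gt0.
- by rewrite expgnA -hx -homX hn hom1.
- by exists h.
Qed.

Lemma clash_AB (r : nat) a b : torsion r a -> ~ range iA a -> torsion r^' b ->
  ~ range iB b -> False.
Proof.
move=> ra aH r'b bH; apply: (noncommuting_AB amalgG aH bH).
exact: commute_coprime_torsion resG (torsion_hom jA ra) (torsion_hom jB r'b).
Qed.

Lemma clash_AA (r : nat) a a' : torsion r a -> ~ range iA a -> torsion r^' a' ->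
  ~ range iA a' -> False.
Proof.
move=> ra aH [n r'n an] a'H; have [b bH] : exists b, ~ range iB b.
  apply/existsNP => allB; apply: BH; apply/seteqP; split=> // b _; exact: allB.
apply: (noncommuting_AA amalgG aH a'H bH).
apply: commute_coprime_torsion resG (torsion_hom jA ra) _.
by exists n; rewrite // -conjXg -homX an hom1 conj1g.
Qed.

(** For a prime s other than r, an s-th root outside H would yield an s-element outside H, which
    clashes with a in either factor. *)
Lemma isolated_of_torsion (r : nat) a : torsion r a -> ~ range iA a ->
  isolated r^' (range iA) /\ isolated r^' (range iB).
Proof.
move=> ra aH; split=> s x sp rs xs; apply: contrapT => nx.
  have [y [n sn yn] yH] := root_torsion sp xs nx.
  apply: (clash_AA ra aH _ yH); exists n => //; apply: pnat_p'nat sn.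
  by rewrite inE in rs.
have [y [n sn yn] yH] := root_torsion sp xs nx.
apply: (clash_AB ra aH _ yH); exists n => //; apply: pnat_p'nat sn.
by rewrite inE in rs.
Qed.

End Isolated.

(** If an r-th root is missing from H in A or, by symmetry, in B, then q = r works, and r is in P
    since a nontrivial r-element survives in a finite p-quotient only for p = r. Otherwise H is
    isolated for all primes and any member of P serves. *)
Lemma isolated_of_residual (H A B G : groupType)
    (iA : {multiplicative H -> A}) (iB : {multiplicative H -> B})
    (jA : {multiplicative A -> G}) (jB : {multiplicative B -> G})
    (P : nat_pred) :
  (forall p, p \in P -> prime p) ->
  is_amalgamated_product iA iB jA jB -> condition_star iA iB P -> periodic H ->
  residually (finite_nilpotent_P_group P) G ->
  exists2 q, q \in P & isolated q^' (range iA) /\ isolated q^' (range iB).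
Proof.
move=> hP amalgG [[AH BH] [p0 p0P] [resA resB] _] perH resG.
have amalgG' := amalgam_sym amalgG.
have [[r [x [rp xr nx]]]|isoA] :=
    pselect (exists r x, [/\ prime r, range iA (x ^+ r) & ~ range iA x]).
  have [y ry yH] := root_torsion perH rp xr nx; exists r.
    apply: torsion_in_P rp resA ry _ => y1.
    by apply: yH; rewrite y1; apply: sg1 (range_subgroup iA).
  exact: isolated_of_torsion amalgG BH perH resG r y ry yH.
have [[r [x [rp xr nx]]]|isoB] :=
    pselect (exists r x, [/\ prime r, range iB (x ^+ r) & ~ range iB x]).
  have [y ry yH] := root_torsion perH rp xr nx; exists r.
    apply: torsion_in_P rp resB ry _ => y1.
    by apply: yH; rewrite y1; apply: sg1 (range_subgroup iB).
  by have [] := isolated_of_torsion amalgG' AH perH resG ry yH.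
exists p0 => //; split=> r x rp _ xr; apply: contrapT => nx.
  by apply: isoA; exists r, x.
by apply: isoB; exists r, x.
Qed.

Theorem theorem3 (H A B G : groupType)
    (iA : {multiplicative H -> A}) (iB : {multiplicative H -> B})
    (jA : {multiplicative A -> G}) (jB : {multiplicative B -> G})
    (P : nat_pred)
    (hP : forall p, p \in P -> prime p)
    (amalgG : is_amalgamated_product iA iB jA jB)
    (starP : condition_star iA iB P)
    (periodicH : periodic H) :
  (separable (finite_nilpotent_P_group P) (range iA) /\
   separable (finite_nilpotent_P_group P) (range iB)) /\
  [/\ (exists2 q, q \in P & separable (finite_p_group q) (range iA) /\
                            separable (finite_p_group q) (range iB)) ->
      (forall p, p \in P -> condition_S iA iB p) ->
      residually (finite_nilpotent_P_group P) G,
      residually (finite_nilpotent_P_group P) G ->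
      (exists2 q, q \in P & isolated q^' (range iA) /\
                            isolated q^' (range iB)) /\
      (forall p, p \in P -> condition_S iA iB p) &
      residually (extension_class free_group (finite_nilpotent_P_group P)) G /\
      (forall q, prime q ->
         residually (extension_class (finite_p_group q)
                                     (finite_nilpotent_P_group P)) G) <->
      (forall p, p \in P -> condition_S iA iB p)].
Proof.
split; first exact: star_separable hP starP periodicH.
split.
- exact: residual_of_S hP amalgG starP periodicH.
- move=> resG; split; first exact: isolated_of_residual amalgG starP periodicH resG.
  by move=> p pP; apply: S_of_residual amalgG starP periodicH p pP resG.
split=> [[_ resq] p pP|hS]; last first.
  split; first exact: free_extension_of_S hP amalgG starP periodicH hS.
  by move=> q qp; apply: p_extension_of_S hP amalgG starP periodicH q qp hS.
(* With q different from p, the p-elements of H survive modulo q-subgroups. *)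
have [q qp pq] : exists2 q, prime q & p != q.
  by have [->|p2] := eqVneq p 2; [exists 3|exists 2].
exact: S_of_p_extension hP amalgG starP periodicH p q pP pq qp (resq q qp).
Qed.
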